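(* Let $R,F\in\Gamma_0(\mathbb{R}^n)$, $J,G\in\Gamma_0(\mathbb{R}^m)$ and $L:\mathbb{R}^n\to\mathbb{R}^m$ satisfy assumptions (A.1)-(A.4) of the context. Let $\gamma_R,\gamma_J>0$ satisfy $$2\min\{\beta_F,\beta_G\}\,\min\Big\{\frac1{\gamma_J},\frac1{\gamma_R}\Big\}\Big(1-\sqrt{\gamma_J\gamma_R\|L\|^2}\Big)>1 ,$$ and let $\{(x_k,v_k)\}_{k\in\mathbb{N}}$ be generated by the Primal–Dual iteration of the context with $\theta=1$, so that $(x_k,v_k)\to(x^\star,v^\star)$ for some Kuhn–Tucker pair $(x^\star,v^\star)$. Suppose that $R\in\mathrm{PSF}_{x^\star}(\mathcal{M}^R_{x^\star})$, $J^*\in\mathrm{PSF}_{v^\star}(\mathcal{M}^{J^*}_{v^\star})$, that $$-L^*v^\star-\nabla F(x^\star)\in\mathrm{ri}\big(\partial R(x^\star)\big),\qquad Lx^\star-\nabla G^*(v^\star)\in\mathrm{ri}\big(\partial J^*(v^\star)\big),$$ and that $F$ is $C^2$ in a neighbourhood of $x^\star$ and $G^*$ is $C^2$ in a neighbourhood of $v^\star$. Put $z_k=(x_k,v_k)$ and $z^\star=(x^\star,v^\star)$, and let $M_{\mathrm{PD}}$ be the matrix defined in the context, with $\theta=1$. Then for all $k$ large enough $$z_{k+1}-z^\star=M_{\mathrm{PD}}(z_k-z^\star)+o(\|z_k-z^\star\|).$$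
   Context: **Problem and assumptions.** $\Gamma_0(\mathbb{R}^n)$ is the set of proper convex lower semicontinuous functions $\mathbb{R}^n\to\,]-\infty,+\infty]$; $J^*$ denotes the Legendre–Fenchel conjugate; $\mathrm{ri}$ is relative interior; $\mathrm{P}_T$ is the orthogonal projection onto $T$; $\mathrm{prox}_{\gamma R}(x)=\mathrm{argmin}_z \frac12\|z-x\|^2+\gamma R(z)$. The underlying primal problem is $\min_{x}R(x)+F(x)+(J\,\triangledown\,G)(Lx)$, where $(J\,\triangledown\,G)(y)=\inf_{v}J(v)+G(y-v)$. Assumptions: (A.1) $R,F\in\Gamma_0(\mathbb{R}^n)$ and $\nabla F$ is $(1/\beta_F)$-Lipschitz continuous for some $\beta_F>0$; (A.2) $J,G\in\Gamma_0(\mathbb{R}^m)$ and $G$ is $\beta_G$-strongly convex for some $\beta_G>0$ (so $\nabla G^*$ is $(1/\beta_G)$-Lipschitz); (A.3) $L:\mathbb{R}^n\to\mathbb{R}^m$ is linear; (A.4) $0\in\mathrm{ran}\big(\partial R+\nabla F+L^*(\partial J\,\square\,\partial G)L\big)$, where $\partial J\,\square\,\partial G=(\partial J^{-1}+\partial G^{-1})^{-1}$. A pair $(x^\star,v^\star)$ is a Kuhn–Tucker pair if $0\in\partial R(x^\star)+L^*v^\star+\nabla F(x^\star)$ and $0\in\partial J^*(v^\star)-Lx^\star+\nabla G^*(v^\star)$. **Primal–Dual iteration** (parameters $\gamma_R,\gamma_J>0$, $\theta$; arbitrary $x_0,v_0$): $x_{k+1}=\mathrm{prox}_{\gamma_RR}(x_k-\gamma_R\nabla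 F(x_k)-\gamma_RL^*v_k)$, $\bar x_{k+1}=x_{k+1}+\theta(x_{k+1}-x_k)$, $v_{k+1}=\mathrm{prox}_{\gamma_JJ^*}(v_k-\gamma_J\nabla G^*(v_k)+\gamma_JL\bar x_{k+1})$. It is known that for $\theta=1$ and under (A.1)-(A.4) and the displayed step-size condition the iterates converge to a Kuhn–Tucker pair. **Partial smoothness.** $\mathrm{par}(C)$ is the linear subspace parallel to the affine hull of a convex set $C$; $T^R_x:=\mathrm{par}(\partial R(x))^\perp$. $R\in\mathrm{PSF}_x(\mathcal{M})$ ($R$ is partly smooth at $x$ relative to $\mathcal{M}\ni x$), where $R\in\Gamma_0$ and $\partial R(x)\ne\emptyset$, means: (1) $\mathcal{M}$ is a $C^2$-smooth embedded submanifold around $x$ and $R|_{\mathcal{M}}$ is $C^2$ around $x$; (2) the tangent space of $\mathcal{M}$ at $x$ equals $T^R_x$; (3) the set-valued map $\partial R$ is continuous at $x$ relative to $\mathcal{M}$. **Riemannian Hessian.** For $f$ that is $C^2$ along $\mathcal{M}$ near $x\in\mathcal{M}$, $\nabla^2_{\mathcal{M}}f(x)$ is the symmetric linear map on the tangent space $\mathcal{T}$ of $\mathcal{M}$ at $x$ with $\langle\nabla^2_{\mathcal{M}}f(x)h,h\rangle=\frac{d^2}{dt^2}f(\mathrm{P}_{\mathcal{M}}(x+th))|_{t=0}$ for $h\in\mathcal{T}$, $\mathrm{P}_{\mathcal{M}}$ being the projection onto $\mathcal{M}$. **The matrix $M_{\mathrm{PD}}$.** Let $T^R=T^R_{x^\star}$,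 $T^{J^*}=T^{J^*}_{v^\star}$, $\overline R(x)=R(x)+\langle x,L^*v^\star+\nabla F(x^\star)\rangle$, $\overline{J^*}(y)=J^*(y)-\langle y,Lx^\star-\nabla G^*(v^\star)\rangle$, $H_{\overline R}=\gamma_R\mathrm{P}_{T^R}\nabla^2_{\mathcal{M}^R_{x^\star}}\overline R(x^\star)\mathrm{P}_{T^R}$, $H_{\overline{J^*}}=\gamma_J\mathrm{P}_{T^{J^*}}\nabla^2_{\mathcal{M}^{J^*}_{v^\star}}\overline{J^*}(v^\star)\mathrm{P}_{T^{J^*}}$ (these are positive semidefinite under the stated hypotheses), $W_{\overline R}=(\mathrm{Id}_n+H_{\overline R})^{-1}$, $W_{\overline{J^*}}=(\mathrm{Id}_m+H_{\overline{J^*}})^{-1}$, $H_F=\mathrm{P}_{T^R}\nabla^2F(x^\star)\mathrm{P}_{T^R}$, $H_{G^*}=\mathrm{P}_{T^{J^*}}\nabla^2G^*(v^\star)\mathrm{P}_{T^{J^*}}$, $\overline H_F=\mathrm{Id}_n-\gamma_RH_F$, $\overline H_{G^*}=\mathrm{Id}_m-\gamma_JH_{G^*}$, $\overline L=\mathrm{P}_{T^{J^*}}L\,\mathrm{P}_{T^R}$. Then $$M_{\mathrm{PD}}=\begin{bmatrix}W_{\overline R}\overline H_F&-\gamma_RW_{\overline R}\overline L^*\\ \gamma_J(1+\theta)W_{\overline{J^*}}\overline LW_{\overline R}\overline H_F-\theta\gamma_JW_{\overline{J^*}}\overline L& W_{\overline{J^*}}\overline H_{G^*}-\gamma_R\gamma_J(1+\theta)W_{\overline{J^*}}\overline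 LW_{\overline R}\overline L^*\end{bmatrix}.$$ *)

(* Defs.v *)
From HB Require Import structures.
From mathcomp Require Import all_boot all_order all_algebra.
From mathcomp Require Import all_classical all_reals all_analysis.

Set Implicit Arguments.
Unset Strict Implicit.
Unset Printing Implicit Defensive.

Import Order.TTheory GRing.Theory Num.Theory.
Import numFieldNormedType.Exports.

Local Open Scope classical_set_scope.
Local Open Scope ring_scope.

(* R^n is 'cV[K]_n with K : realType.  The library norm `|x| on 'cV[K]_n is the
   sup norm; it is used only through the topology it induces.  Every metric
   quantity (Lipschitz constants, strong convexity, prox, projections, operator
   norm) uses the Euclidean norm enorm. *)

Section Euclidean.
Context {K : realType}.

Definition dotv {n} (x y : 'cV[K]_n) : K := \sum_i x i 0 * y i 0.

Definition enorm {n} (x : 'cV[K]_n) : K := Num.sqrt (dotv x x).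

Definition opnorm {m n} (A : 'M[K]_(m, n)) : K :=
  sup [set enorm (A *m x) | x in [set x : 'cV[K]_n | enorm x <= 1]].

Definition orthocompl {n} (S : set 'cV[K]_n) : set 'cV[K]_n :=
  [set h | forall u, S u -> dotv h u = 0].

(* Matrix of the orthogonal projection onto a linear subspace T. *)
Definition orthoproj {n} (T : set 'cV[K]_n) : 'M[K]_n :=
  get [set P : 'M[K]_n | forall x, T (P *m x) /\ orthocompl T (x - P *m x)].

Definition argmin {n} (f : 'cV[K]_n -> \bar K) : set 'cV[K]_n :=
  [set z | forall w, (f z <= f w)%E].

(* A nearest point of M to y, unique when M is a C^2 submanifold around x and
   y is close to x. *)
Definition nearest {n} (M : set 'cV[K]_n) (y : 'cV[K]_n) : 'cV[K]_n :=
  get [set p | M p /\ forall q, M q -> enorm (y - p) <= enorm (y - q)].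

End Euclidean.

Section ConvexSets.
Context {K : realType} {n : nat}.
Implicit Types C : set 'cV[K]_n.

Definition affine_set C : Prop :=
  forall x y (t : K), C x -> C y -> C (t *: x + (1 - t) *: y).

Definition affhull C : set 'cV[K]_n := smallest affine_set C.

(* For nonempty C this is affhull C translated by any of its own points. *)
Definition par C : set 'cV[K]_n :=
  [set x - y | x in affhull C & y in affhull C].

Definition ri C : set 'cV[K]_n :=
  [set x | C x /\ \forall y \near x, affhull C y -> C y].

End ConvexSets.

Section Operators.
Context {K : realType} {n : nat}.
Implicit Types A B : 'cV[K]_n -> set 'cV[K]_n.

Definition opinv A : 'cV[K]_n -> set 'cV[K]_n := fun v => [set u | A u v].

Definition opadd A B : 'cV[K]_n -> set 'cV[K]_n :=
  fun x => [set u + v | u in A x & v in B x].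

Definition parallel_sum A B : 'cV[K]_n -> set 'cV[K]_n :=
  opinv (opadd (opinv A) (opinv B)).

Definition opran A : set 'cV[K]_n := \bigcup_x A x.

(* L^* o B o L *)
Definition opcomp {m} (L : 'M[K]_(m, n)) (B : 'cV[K]_m -> set 'cV[K]_m) :
    'cV[K]_n -> set 'cV[K]_n :=
  fun x => [set L^T *m w | w in B (L *m x)].

Definition opfun (g : 'cV[K]_n -> 'cV[K]_n) : 'cV[K]_n -> set 'cV[K]_n :=
  fun x => [set g x].

End Operators.

Section ConvexFunctions.
Context {K : realType} {n : nat}.
Implicit Types f : 'cV[K]_n -> \bar K.

Definition proper_fun f : Prop :=
  (forall x, f x != -oo%E) /\ exists x, (f x < +oo)%E.

Definition strongly_convex_fun (b : K) f : Prop :=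
  forall (x y : 'cV[K]_n) (t : K), 0 < t < 1 ->
    (f (t *: x + (1 - t) *: y)%R + (b / 2 * t * (1 - t) * enorm (x - y)%R ^+ 2)%:E
       <= t%:E * f x + (1 - t)%:E * f y)%E.

Definition convex_fun f : Prop :=
  forall (x y : 'cV[K]_n) (t : K), 0 < t < 1 ->
    (f (t *: x + (1 - t) *: y)%R <= t%:E * f x + (1 - t)%:E * f y)%E.

Definition Gamma0 f : Prop :=
  [/\ proper_fun f, convex_fun f & lower_semicontinuous f].

Definition conjugate f : 'cV[K]_n -> \bar K :=
  fun u => ereal_sup (range (fun x => ((dotv x u)%:E - f x)%E)).

Definition subdiff f (x : 'cV[K]_n) : set 'cV[K]_n :=
  [set u | forall y, (f x + (dotv u (y - x)%R)%:E <= f y)%E].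

Definition prox (g : K) f (x : 'cV[K]_n) : 'cV[K]_n :=
  get (argmin (fun z => ((2^-1 * enorm (z - x)%R ^+ 2)%:E + g%:E * f z)%E)).

End ConvexFunctions.

(* Differential calculus for extended-real-valued functions goes through
   fine \o f; finiteness near the point is always required explicitly. *)
Section Smoothness.
Context {K : realType} {n : nat}.

Definition basisv (i : 'I_n) : 'cV[K]_n := delta_mx i 0.

Definition grad (f : 'cV[K]_n -> \bar K) (x : 'cV[K]_n) : 'cV[K]_n :=
  \col_i 'D_(basisv i) (fine \o f) x.

Definition hess (f : 'cV[K]_n -> K) (x : 'cV[K]_n) : 'M[K]_n :=
  \matrix_(i, j) 'D_(basisv j) ('D_(basisv i) f) x.

Definition finite_differentiable (f : 'cV[K]_n -> \bar K) (x : 'cV[K]_n) : Prop :=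
  (\forall y \near x, f y \is a fin_num) /\ differentiable (fine \o f) x.

Definition C2_near (f : 'cV[K]_n -> K) (x : 'cV[K]_n) : Prop :=
  \forall y \near x,
    [/\ differentiable f y,
        forall i, differentiable ('D_(basisv i) f) y &
        {for y, continuous (hess f)}].

Definition finite_C2_near (f : 'cV[K]_n -> \bar K) (x : 'cV[K]_n) : Prop :=
  (\forall y \near x, f y \is a fin_num) /\ C2_near (fine \o f) x.

End Smoothness.

Section PartialSmoothness.
Context {K : realType} {n : nat}.
Implicit Types (M : set 'cV[K]_n) (f : 'cV[K]_n -> \bar K) (x : 'cV[K]_n).

(* Around x, M is the zero set of p real C^2 functions whose gradients at x are
   linearly independent. *)
Definition C2_submanifold_near M x : Prop :=
  M x /\ exists (p : nat) (phi : 'I_p -> 'cV[K]_n -> K),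
    [/\ forall i, C2_near (phi i) x,
        row_free (\matrix_(i < p, j < n) 'D_(basisv j) (phi i) x) &
        \forall y \near x, M y <-> forall i, phi i y = 0].

(* Velocities at x of the curves drawn on M. *)
Definition tangent M x : set 'cV[K]_n :=
  [set h : 'cV[K]_n | exists c : K -> 'cV[K]_n,
    [/\ c 0 = x, \forall t \near (0 : K), M (c t) & is_derive (0 : K) (1 : K) c h]].

(* The restriction of f to M agrees around x with a C^2 function on an open
   neighbourhood of x. *)
Definition C2_along M f x : Prop :=
  exists g : 'cV[K]_n -> K,
    C2_near g x /\ \forall y \near x, M y -> f y = (g y)%:E.

(* Painleve-Kuratowski continuity at x relative to M: the outer limit of S at x
   along M is contained in S x, which is contained in the inner limit. *)
Definition setmap_continuous M (S : 'cV[K]_n -> set 'cV[K]_n) x : Prop :=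
  (forall (y u : nat -> 'cV[K]_n) (u0 : 'cV[K]_n),
     (forall k, M (y k)) -> y @ \oo --> x ->
     (forall k, S (y k) (u k)) -> u @ \oo --> u0 -> S x u0) /\
  (forall (y : nat -> 'cV[K]_n) (u0 : 'cV[K]_n),
     (forall k, M (y k)) -> y @ \oo --> x -> S x u0 ->
     exists u : nat -> 'cV[K]_n,
       (\forall k \near \oo, S (y k) (u k)) /\ u @ \oo --> u0).

Definition Tspace f x : set 'cV[K]_n := orthocompl (par (subdiff f x)).

Definition PSF f x M : Prop :=
  [/\ Gamma0 f /\ (subdiff f x !=set0),
      C2_submanifold_near M x /\ C2_along M f x,
      tangent M x = Tspace f x &
      setmap_continuous M (subdiff f) x].

(* The Riemannian Hessian of f at x, a symmetric map on the tangent space,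
   extended by 0 on its orthogonal complement. *)
Definition riem_hess M f x : 'M[K]_n :=
  let P := orthoproj (tangent M x) in
  get [set H : 'M[K]_n |
    [/\ H^T = H, P *m H *m P = H &
        forall h, tangent M x h ->
          dotv (H *m h) h =
          derive1n 2 (fun t : K => fine (f (nearest M (x + t *: h)))) 0]].

End PartialSmoothness.

Section PrimalDual.
Context {K : realType} {n m : nat}.
Variables (R F : 'cV[K]_n -> \bar K) (J G : 'cV[K]_m -> \bar K).
Variable L : 'M[K]_(m, n).

Definition kuhn_tucker (x : 'cV[K]_n) (v : 'cV[K]_m) : Prop :=
  [set u + L^T *m v + grad F x | u in subdiff R x] 0 /\
  [set u - L *m x + grad (conjugate G) v | u in subdiff (conjugate J) v] 0.

Variables gR gJ theta : K.

Definition primal_dual (x : nat -> 'cV[K]_n) (v : nat -> 'cV[K]_m) : Prop :=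
  forall k,
    x k.+1 = prox gR R (x k - gR *: grad F (x k) - gR *: (L^T *m v k)) /\
    let xbar := x k.+1 + theta *: (x k.+1 - x k) in
    v k.+1 = prox gJ (conjugate J)
      (v k - gJ *: grad (conjugate G) (v k) + gJ *: (L *m xbar)).

Variables (MR : set 'cV[K]_n) (MJ : set 'cV[K]_m).
Variables (xs : 'cV[K]_n) (vs : 'cV[K]_m).

Definition Rbar (x : 'cV[K]_n) : \bar K :=
  (R x + (dotv x (L^T *m vs + grad F xs)%R)%:E)%E.

Definition Jsbar (y : 'cV[K]_m) : \bar K :=
  (conjugate J y - (dotv y (L *m xs - grad (conjugate G) vs)%R)%:E)%E.

Definition M_PD : 'M[K]_(n + m) :=
  let PR := orthoproj (Tspace R xs) in
  let PJ := orthoproj (Tspace (conjugate J) vs) in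
  let HR := gR *: (PR *m riem_hess MR Rbar xs *m PR) in
  let HJ := gJ *: (PJ *m riem_hess MJ Jsbar vs *m PJ) in
  let WR := invmx (1%:M + HR) in
  let WJ := invmx (1%:M + HJ) in
  let HF := PR *m hess (fine \o F) xs *m PR in
  let HG := PJ *m hess (fine \o conjugate G) vs *m PJ in
  let HFbar := 1%:M - gR *: HF in
  let HGbar := 1%:M - gJ *: HG in
  let Lbar := PJ *m L *m PR in
  block_mx
    (WR *m HFbar)
    (- (gR *: (WR *m Lbar^T)))
    ((gJ * (1 + theta)) *: (WJ *m Lbar *m WR *m HFbar)
       - (theta * gJ) *: (WJ *m Lbar))
    (WJ *m HGbar
       - (gR * gJ * (1 + theta)) *: (WJ *m Lbar *m WR *m Lbar^T)).

End PrimalDual.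

(* Main.v *)
Require Import Defs.
From HB Require Import structures.
From mathcomp Require Import all_boot all_order all_algebra.
From mathcomp Require Import all_classical all_reals all_analysis.
From mathcomp Require Import ring lra.

(* Both updates of the iteration are of the form y k = prox c f (a k), so that
   u k = (a k - y k) / c is a subgradient of f at y k, with y k -> x and
   u k -> us in the relative interior of the subdifferential of f at x.

   Identification: if p k is the point of M nearest to y k, then y k - p k is
   a combination of the gradients at p k of the equations of M.  Inner
   semicontinuity provides subgradients at p k converging to us + d for all
   small d normal to M at x, and monotonicity of the subdifferential then
   forces y k = p k.

   Expansion: on M a subgradient is the gradient of a C^2 extension of f plus
   a combination of the gradients of the equations.  Projecting on the tangent
   space gives P (u k - us) = P Q P (y k - x) + o(|y k - x|) where Q is the
   Hessian of the Lagrangian, and P Q P is the Riemannian Hessian of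
   f - <., us>: differentiate twice along the curve of nearest points to
   x + t h, which the implicit function theorem makes differentiable near 0.
   Minimality of x for f - <., us> makes P Q P positive semidefinite, so
   1 + c P Q P can be inverted in both updates.

   Strict differentiability is used throughout: C^1 maps have it, it passes to
   implicit functions by a direct estimate, and it gives closeness of
   derivatives at neighbouring points for free. *)

Set Implicit Arguments.
Unset Strict Implicit.
Unset Printing Implicit Defensive.

Import Order.TTheory GRing.Theory Num.Theory.
Import numFieldNormedType.Exports.

Local Open Scope classical_set_scope.
Local Open Scope ring_scope.

(** The obstacle is that a prox step only yields estimates relative to the new error |y k - x|,
    because the subgradient sits at the new point. They become estimates relative to the old error
    by absorption: new error = O(old error) + o(new error), hence O(old error). Inverting 1 + c P Q
    P is what gives the expansion the solved form that absorption needs. The projections in the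
    matrix also act on the current error; its normal component is negligible because the current
    iterate is itself the output of an earlier prox step.

    Multipliers are needed twice, for subgradients along M and for nearest points. Both come from
    one Lagrange rule proved by quadratic penalisation, so M is never parametrised. A second
    derivative at 0 requires the curve of nearest points to be differentiable at all small t, with
    velocities tending to the one at 0; carrying the multiplier along with the point turns this into
    an equation whose derivative is invertible. *)

Section MatrixNorm.
Context {K : realType}.

Lemma entry_le_norm m n (A : 'M[K]_(m, n)) i j : `|A i j| <= `|A|.
Proof.
rewrite [leRHS]/Num.norm /= mx_normrE.
by apply/bigmax_geP; right; exists (i, j).
Qed.

Lemma norm_le_entries m n (A : 'M[K]_(m, n)) (c : K) :
  0 <= c -> (forall i j, `|A i j| <= c) -> `|A| <= c.
Proof.
move=> c0 Ac; rewrite [leLHS]/Num.norm /= mx_normrE.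
by apply: bigmax_le => // -[i j] _ /=.
Qed.

Lemma norm_mulmx m n p (A : 'M[K]_(m, n)) (B : 'M[K]_(n, p)) :
  `|A *m B| <= n%:R * `|A| * `|B|.
Proof.
apply: norm_le_entries => [|i j]; first by rewrite !mulr_ge0.
rewrite mxE; apply: le_trans (ler_norm_sum _ _ _) _.
rewrite -mulrA mulr_natl -[leRHS](_ : \sum_(k < n) `|A| * `|B| = _); last first.
  by rewrite sumr_const card_ord.
by apply: ler_sum => k _; rewrite normrM ler_pM // entry_le_norm.
Qed.

Lemma norm_trmx m n (A : 'M[K]_(m, n)) : `|A^T| = `|A|.
Proof.
apply/eqP; rewrite eq_le; apply/andP; split; apply: norm_le_entries => // i j.
  by rewrite mxE entry_le_norm.
by rewrite -[A]trmxK mxE trmxK entry_le_norm.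
Qed.

(** The summand 1 makes the constant positive, so that it can be divided by; the many denominators
    [|h| + 1] and [n%:R + 1] below have the same origin. *)
Lemma norm_mulmx_bound m n (A : 'M[K]_(m, n)) :
  exists2 C : K, 0 < C & forall p (B : 'M[K]_(n, p)), `|A *m B| <= C * `|B|.
Proof.
exists (n%:R * `|A| + 1); first by rewrite ltr_wpDl // mulr_ge0.
move=> p B; apply: le_trans (norm_mulmx _ _) _.
by rewrite ler_wpM2r // lerDl.
Qed.

Lemma norm_usub m n p (w : 'M[K]_(m + n, p)) : `|usubmx w| <= `|w|.
Proof. by apply: norm_le_entries => // i j; rewrite mxE entry_le_norm. Qed.

Lemma norm_dsub m n p (w : 'M[K]_(m + n, p)) : `|dsubmx w| <= `|w|.
Proof. by apply: norm_le_entries => // i j; rewrite mxE entry_le_norm. Qed.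

Lemma norm_col_mx m n p (u : 'M[K]_(m, p)) (v : 'M[K]_(n, p)) :
  `|col_mx u v| <= `|u| + `|v|.
Proof.
apply: norm_le_entries => [|i j]; first by rewrite addr_ge0.
rewrite mxE; case: splitP => k _.
  by rewrite (le_trans (entry_le_norm _ _ _)) // lerDl.
by rewrite (le_trans (entry_le_norm _ _ _)) // lerDr.
Qed.

End MatrixNorm.

Section Dot.
Context {K : realType}.

Lemma dotvE n (x y : 'cV[K]_n) : dotv x y = (x^T *m y) 0 0.
Proof. by rewrite mxE; apply: eq_bigr => i _; rewrite mxE. Qed.

Lemma dotvC n (x y : 'cV[K]_n) : dotv x y = dotv y x.
Proof. by apply: eq_bigr => i _; rewrite mulrC. Qed.

Lemma dotvDr n (x y z : 'cV[K]_n) : dotv x (y + z) = dotv x y + dotv x z.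
Proof. by rewrite !dotvE mulmxDr mxE. Qed.

Lemma dotvDl n (x y z : 'cV[K]_n) : dotv (x + y) z = dotv x z + dotv y z.
Proof. by rewrite dotvC dotvDr !(dotvC z). Qed.

Lemma dotvZr n a (x y : 'cV[K]_n) : dotv x (a *: y) = a * dotv x y.
Proof. by rewrite !dotvE -scalemxAr mxE. Qed.

Lemma dotvZl n a (x y : 'cV[K]_n) : dotv (a *: x) y = a * dotv x y.
Proof. by rewrite dotvC dotvZr dotvC. Qed.

Lemma dotvNr n (x y : 'cV[K]_n) : dotv x (- y) = - dotv x y.
Proof. by rewrite -scaleN1r dotvZr mulN1r. Qed.

Lemma dotvNl n (x y : 'cV[K]_n) : dotv (- x) y = - dotv x y.
Proof. by rewrite dotvC dotvNr dotvC. Qed.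

Lemma dotvBr n (x y z : 'cV[K]_n) : dotv x (y - z) = dotv x y - dotv x z.
Proof. by rewrite dotvDr dotvNr. Qed.

Lemma dotvBl n (x y z : 'cV[K]_n) : dotv (x - y) z = dotv x z - dotv y z.
Proof. by rewrite dotvDl dotvNl. Qed.

Lemma dotv0r n (x : 'cV[K]_n) : dotv x 0 = 0.
Proof. by rewrite -(scale0r 0) dotvZr mul0r. Qed.

Lemma dotv0l n (x : 'cV[K]_n) : dotv 0 x = 0.
Proof. by rewrite dotvC dotv0r. Qed.

Lemma dotv_mulmx m n (A : 'M[K]_(m, n)) x y :
  dotv x (A *m y) = dotv (A^T *m x) y.
Proof. by rewrite !dotvE trmx_mul trmxK mulmxA. Qed.

Lemma dotv_delta n (x : 'cV[K]_n) i : dotv (delta_mx i 0) x = x i 0.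
Proof.
rewrite /dotv (bigD1 i) //= mxE !eqxx mul1r big1 ?addr0 // => j ji.
by rewrite mxE (negPf ji) mul0r.
Qed.

Lemma dotvv_ge0 n (x : 'cV[K]_n) : 0 <= dotv x x.
Proof. by apply: sumr_ge0 => i _; rewrite -expr2 sqr_ge0. Qed.

Lemma norm_sqr_le_dotv n (x : 'cV[K]_n) : `|x| ^+ 2 <= dotv x x.
Proof.
rewrite -ler_sqrt ?exprn_ge0 ?dotvv_ge0// sqrtr_sqr normr_id.
apply: norm_le_entries => [|i j]; first exact: sqrtr_ge0.
rewrite -sqrtr_sqr ler_sqrt ?sqr_ge0 ?dotvv_ge0 // {j}[j]ord1.
rewrite /dotv (bigD1 i) //= -expr2 lerDl.
by apply: sumr_ge0 => k _; rewrite -expr2 sqr_ge0.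
Qed.

Lemma dotvv_eq0 n (x : 'cV[K]_n) : (dotv x x == 0) = (x == 0).
Proof.
apply/idP/eqP => [/eqP x0|->]; last by rewrite dotv0r.
have := norm_sqr_le_dotv x; rewrite x0 => h.
apply/eqP; rewrite -normr_eq0 -(sqrf_eq0 `|x|) eq_le h /=.
exact: sqr_ge0.
Qed.

Lemma norm_dotv n (x y : 'cV[K]_n) : `|dotv x y| <= n%:R * `|x| * `|y|.
Proof.
rewrite dotvE; apply: le_trans (entry_le_norm _ _ _) _.
by rewrite (le_trans (norm_mulmx _ _)) // norm_trmx.
Qed.

Lemma dotvv_le_norm n (x : 'cV[K]_n) : dotv x x <= n%:R * `|x| ^+ 2.
Proof.
by rewrite (le_trans (ler_norm _)) // (le_trans (norm_dotv _ _)) // mulrA.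
Qed.

Lemma norm_le_enorm n (x : 'cV[K]_n) : `|x| <= enorm x.
Proof.
by rewrite /enorm -[leLHS]normr_id -sqrtr_sqr ler_sqrt ?dotvv_ge0 // norm_sqr_le_dotv.
Qed.

Lemma enorm_sqr n (x : 'cV[K]_n) : enorm x ^+ 2 = dotv x x.
Proof. by rewrite sqr_sqrtr // dotvv_ge0. Qed.

Lemma ler_enorm n m (x : 'cV[K]_n) (y : 'cV[K]_m) :
  (enorm x <= enorm y) = (dotv x x <= dotv y y).
Proof. by rewrite ler_sqrt // dotvv_ge0. Qed.

End Dot.

(** * Subspaces, affine hulls and orthogonal projections *)

Section LinearAlgebra.
Context {K : realType}.

Lemma unitmx_ker n (A : 'M[K]_n) :
  (forall x : 'cV_n, A *m x = 0 -> x = 0) -> A \in unitmx.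
Proof.
move=> Aker; rewrite -unitmx_tr -row_free_unit -kermx_eq0.
apply/eqP/row_matrixP => i; rewrite row0.
apply: trmx_inj; rewrite trmx0; apply: Aker.
have : row i (kermx A^T) *m A^T = 0 by rewrite -row_mul mulmx_ker row0.
by move/(congr1 trmx); rewrite trmx_mul trmxK trmx0.
Qed.

Lemma gram_unitmx p n (Phi : 'M[K]_(p, n)) :
  row_free Phi -> Phi *m Phi^T \in unitmx.
Proof.
move=> freePhi; apply: unitmx_ker => x PPx.
apply: trmx_inj; apply: (row_free_inj freePhi).
rewrite trmx0 mul0mx -[Phi]trmxK -trmx_mul; apply: (trmx_inj); rewrite trmxK trmx0.
apply/eqP; rewrite -dotvv_eq0 dotv_mulmx trmxK.
by rewrite mulmxA PPx dotv0l.
Qed.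

(* A has maximal rank among the matrices whose row space lies in S. *)
Lemma subspace_rowspace n (S : set 'cV[K]_n) :
  S 0 -> (forall x y, S x -> S y -> S (x + y)) ->
  (forall a x, S x -> S (a *: x)) ->
  exists A : 'M[K]_n, forall x, S x <-> (x^T <= A)%MS.
Proof.
move=> S0 SD SZ.
pose inS (A : 'M[K]_n) := forall u : 'rV_n, (u <= A)%MS -> S u^T.
pose rk r := `[< exists2 A, inS A & \rank A = r >].
have rk_le r : rk r -> (r <= n)%N.
  by move=> /asboolP[A _ <-]; exact: rank_leq_row.
have rk0 : exists r, rk r.
  exists 0%N; apply/asboolP; exists 0; last by rewrite mxrank0.
  by move=> u; rewrite submx0 => /eqP ->; rewrite trmx0.
case: (ex_maxnP rk0 rk_le) => r /asboolP[A AS rA] rmax.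
exists A => x; split => [Sx|/AS]; last by rewrite trmxK.
have AxS : inS (A + x^T)%MS.
  move=> u /sub_addsmxP[[a b] -> /=]; rewrite linearD /=.
  apply: SD; first by apply: AS; exact: submxMl.
  by rewrite [b]mx11_scalar mul_scalar_mx linearZ /= trmxK; exact: SZ.
have := rmax (\rank (A + x^T)%MS).
have -> : rk (\rank (A + x^T)%MS) by apply/asboolP; exists (A + x^T)%MS.
move=> /(_ isT); rewrite -rA => rle.
have : (A + x^T <= A)%MS.
  by have [_ <-] := mxrank_leqif_sup (addsmxSl A x^T); rewrite eqn_leq rle mxrankS ?addsmxSl.
exact: submx_trans (addsmxSr _ _).
Qed.

(** Only finitely many vectors h are needed: the columns of [cokermx A] are orthogonal to S, and
    pairing d with them is the membership test [submxE] for the row space of A. *)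
Lemma subspace_biorth n (S : set 'cV[K]_n) (d : 'cV[K]_n) :
  S 0 -> (forall x y, S x -> S y -> S (x + y)) ->
  (forall a x, S x -> S (a *: x)) ->
  (forall h, orthocompl S h -> dotv h d = 0) -> S d.
Proof.
move=> S0 SD SZ orth; have [A SA] := subspace_rowspace S0 SD SZ.
have dot_col (w : 'cV[K]_n) (B : 'M[K]_n) j : dotv (col j B) w = (w^T *m B) 0 j.
  by rewrite /dotv mxE; apply: eq_bigr => k _; rewrite !mxE mulrC.
apply/SA; rewrite submxE; apply/eqP/rowP => j; rewrite [RHS]mxE -dot_col.
by apply: orth => u /SA; rewrite submxE dot_col => /eqP ->; rewrite mxE.
Qed.

Section AffineHull.
Context {n : nat}.
Implicit Types C : set 'cV[K]_n.

Lemma affine_affhull C : affine_set (affhull C).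
Proof.
by move=> x y t Dx Dy A CA; apply: (CA.1); [exact: (Dx A CA)|exact: (Dy A CA)].
Qed.

Lemma sub_affhull C : C `<=` affhull C.
Proof. by move=> x Cx A [_]; apply. Qed.

Lemma affine_subspace_biorth (D : set 'cV[K]_n) a d :
  affine_set D -> D a ->
  (forall h, (forall u, D (a + u) -> dotv h u = 0) -> dotv h d = 0) ->
  D (a + d).
Proof.
move=> affD Da; apply: (@subspace_biorth n [set u | D (a + u)]) => /=.
- by rewrite addr0.
- move=> x y Dx Dy.
  (* Take the midpoint of a + x and a + y, then double its distance from a: the second combination
     has coefficients 2 and -1. *)
  have -> : a + (x + y) =
      2 *: (2^-1 *: (a + x) + (1 - 2^-1) *: (a + y)) + (1 - 2) *: a.
    by apply/matrixP => i j; rewrite !mxE; field.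
  by apply: (affD) => //; exact: affD.
- move=> t x Dx.
  have -> : a + t *: x = t *: (a + x) + (1 - t) *: a.
    by apply/matrixP => i j; rewrite !mxE; ring.
  exact: affD.
Qed.

(** By biorthogonality d is a direction of the affine hull of C, so the line through u along d stays
    in that hull, where relative interiority leaves room around u. *)
Lemma ri_orth C u d : ri C u ->
  (forall h, orthocompl (par C) h -> dotv h d = 0) ->
  exists2 e : K, 0 < e & forall t, `|t| < e -> C (u + t *: d).
Proof.
move=> [Cu /nbhs_ballP[r /= r0 ballC]] orth.
have affd t : affhull C (u + t *: d).
  apply: affine_subspace_biorth; first exact: affine_affhull.
    exact: sub_affhull.
  move=> h hort; rewrite dotvZr orth ?mulr0 // => _ [x Dx [y Dy <-]].
  have -> : x - y = (x - u) - (y - u) by rewrite opprB addrA subrK.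
  by rewrite dotvBr !hort ?subrr // addrC subrK.
exists (r / (`|d| + 1)) => [|t td]; first by rewrite divr_gt0 // ltr_wpDl.
apply: ballC (affd t); rewrite -ball_normE /ball_ /=.
rewrite opprD addNKr normrN normrZ.
move: td; rewrite ltr_pdivlMr ?ltr_wpDl // => /le_lt_trans; apply.
by rewrite ler_wpM2l // lerDl.
Qed.

End AffineHull.

Section OrthogonalProjection.
Context {p n : nat} (Phi : 'M[K]_(p, n)) (T : set 'cV[K]_n).
Hypotheses (Phi_free : row_free Phi) (TE : T = [set h | Phi *m h = 0]).

Let Q : 'M[K]_n := 1%:M - Phi^T *m invmx (Phi *m Phi^T) *m Phi.

Let Phi_Q : Phi *m Q = 0.
Proof. by rewrite mulmxBr mulmx1 !mulmxA mulmxV ?gram_unitmx // mul1mx subrr. Qed.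

(** The value returned by [get] is pinned down by uniqueness: the difference of two projections of x
    lies in T and is also a difference of two vectors orthogonal to T. *)
Lemma orthoproj_kerE :
  orthoproj T = 1%:M - Phi^T *m invmx (Phi *m Phi^T) *m Phi.
Proof.
rewrite -/Q /orthoproj; set A := [set _ | _].
have QA : A Q.
  move=> x; rewrite TE /=; split; first by rewrite mulmxA Phi_Q mul0mx.
  move=> h /= Phih; rewrite mulmxBl mul1mx opprB addrC subrK -!mulmxA.
  by rewrite dotvC dotv_mulmx trmxK Phih dotv0l.
have /= getA : A (get A) by apply: (@getPex _ A); exists Q.
apply/matrixP => i j.
have entryE (B : 'M[K]_n) : B i j = (B *m (delta_mx j 0 : 'cV[K]_n)) i 0 by rewrite -colE mxE.
rewrite !entryE {entryE}.
set P := get A; congr (fun_of_matrix _ _ _); set x := delta_mx _ _.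
apply/eqP; rewrite -subr_eq0 -dotvv_eq0.
have [TP OP] := getA x; have [TQ OQ] := QA x.
have Td : T (P *m x - Q *m x).
  by move: TP TQ; rewrite TE /= mulmxBr => -> ->; rewrite subr0.
have dE : P *m x - Q *m x = (x - Q *m x) - (x - P *m x).
  by rewrite opprB [RHS]addrC addrA subrK.
by rewrite {1}dE dotvBl OQ // OP // subrr.
Qed.

Lemma orthoproj_tr : (orthoproj T)^T = orthoproj T.
Proof.
rewrite orthoproj_kerE !linearB /= trmx1 !trmx_mul trmxK trmx_inv trmx_mul trmxK.
by rewrite mulmxA.
Qed.

Lemma mul_orthoproj : Phi *m orthoproj T = 0.
Proof. by rewrite orthoproj_kerE. Qed.

Lemma mul_orthoproj_tr : orthoproj T *m Phi^T = 0.
Proof. by rewrite -orthoproj_tr -trmx_mul mul_orthoproj trmx0. Qed.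

Lemma orthoproj_compl : exists B : 'M[K]_(n, p), 1%:M - orthoproj T = B *m Phi.
Proof.
by exists (Phi^T *m invmx (Phi *m Phi^T)); rewrite orthoproj_kerE opprB addrC subrK.
Qed.

Lemma orthoproj_idem : orthoproj T *m orthoproj T = orthoproj T.
Proof.
have [B /(congr1 (mulmx^~ (orthoproj T)))] := orthoproj_compl.
rewrite mulmxBl mul1mx -mulmxA mul_orthoproj mulmx0.
by move/eqP; rewrite subr_eq0 => /eqP <-.
Qed.

Lemma orthoproj_id (h : 'cV[K]_n) : Phi *m h = 0 -> orthoproj T *m h = h.
Proof.
move=> Phih; have [B /(congr1 (mulmx^~ h))] := orthoproj_compl.
rewrite mulmxBl mul1mx -mulmxA Phih mulmx0.
by move/eqP; rewrite subr_eq0 => /eqP <-.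
Qed.

End OrthogonalProjection.

End LinearAlgebra.

(** * Landau estimates along an arbitrary filter *)

Section LittleO.
Context {K : realType} {T : Type} (F : set_system T) {FF : Filter F}.
Implicit Types (V W : normedModType K) (g : T -> K).

(* g carries no absolute value; it is nonnegative in all uses. *)
Definition lo V (f : T -> V) g :=
  forall e : K, 0 < e -> \forall t \near F, `|f t| <= e * g t.

Definition bo V (f : T -> V) g :=
  exists2 C : K, 0 < C & \forall t \near F, `|f t| <= C * g t.

Lemma lo_bo V (f : T -> V) g : lo f g -> bo f g.
Proof. by move=> fg; exists 1 => //; exact: fg. Qed.

Lemma loD V (f h : T -> V) g : lo f g -> lo h g -> lo (fun t => f t + h t) g.
Proof.
move=> fg hg e e0; have e20 : 0 < e / 2 by rewrite divr_gt0.
near=> t; apply: (le_trans (ler_normD _ _)).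
have : `|f t| <= e / 2 * g t by near: t; exact: fg.
have : `|h t| <= e / 2 * g t by near: t; exact: hg.
lra.
Unshelve. all: by end_near. Qed.

Lemma loN V (f : T -> V) g : lo f g -> lo (fun t => - f t) g.
Proof. by move=> fg e /fg; apply: filterS => t; rewrite normrN. Qed.

Lemma loB V (f h : T -> V) g : lo f g -> lo h g -> lo (fun t => f t - h t) g.
Proof. by move=> fg hg; apply: loD => //; exact: loN. Qed.

Lemma boD V (f h : T -> V) g : bo f g -> bo h g -> bo (fun t => f t + h t) g.
Proof.
move=> [C C0 fg] [D D0 hg]; exists (C + D); first exact: addr_gt0.
near=> t; apply: (le_trans (ler_normD _ _)).
by rewrite mulrDl lerD //; near: t.
Unshelve. all: by end_near. Qed.

Lemma boN V (f : T -> V) g : bo f g -> bo (fun t => - f t) g.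
Proof. by move=> [C C0 fg]; exists C => //; apply: filterS fg => t; rewrite normrN. Qed.

Lemma boB V (f h : T -> V) g : bo f g -> bo h g -> bo (fun t => f t - h t) g.
Proof. by move=> fg hg; apply: boD => //; exact: boN. Qed.

Lemma lo_trans V W (f : T -> V) (h : T -> W) g :
  lo f (fun t => `|h t|) -> bo h g -> lo f g.
Proof.
move=> fh [C C0 hg] e e0; have eC0 : 0 < e / C by rewrite divr_gt0.
near=> t; have hC : `|h t| <= C * g t by near: t.
have : `|f t| <= e / C * `|h t| by near: t; exact: fh.
move=> /le_trans; apply.
have := ler_wpM2l (ltW eC0) hC; rewrite mulrA divfK// gt_eqF//.
Unshelve. all: by end_near. Qed.

Lemma lo_mulmx m n (A : 'M[K]_(m, n)) (f : T -> 'cV[K]_n) g :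
  lo f g -> lo (fun t => A *m f t) g.
Proof.
move=> fg e e0; have [C C0 CA] := norm_mulmx_bound A.
have eC0 : 0 < e / C by rewrite divr_gt0.
apply: filterS (fg _ eC0) => t ft; apply: le_trans (CA _ _) _.
have := ler_wpM2l (ltW C0) ft.
by rewrite mulrA mulrCA divff ?gt_eqF// mulr1.
Qed.

Lemma bo_mulmx m n (A : 'M[K]_(m, n)) (f : T -> 'cV[K]_n) g :
  bo f g -> bo (fun t => A *m f t) g.
Proof.
move=> [D D0 fg]; have [C C0 CA] := norm_mulmx_bound A.
exists (C * D); first by rewrite mulr_gt0.
apply: filterS fg => t ft; apply: le_trans (CA _ _) _.
by rewrite -mulrA ler_pM2l.
Qed.

Lemma loZ V a (f : T -> V) g : lo f g -> lo (fun t => a *: f t) g.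
Proof.
move=> fg e e0; have eC0 : 0 < e / (`|a| + 1) by rewrite divr_gt0 // ltr_wpDl.
apply: filterS (fg _ eC0) => t ft; rewrite normrZ.
have := ler_wpM2l (_ : 0 <= `|a| + 1) ft; rewrite addr_ge0// => /(_ isT).
rewrite mulrA mulrCA divff ?gt_eqF ?ltr_wpDl// mulr1; apply: le_trans.
by rewrite ler_wpM2r // lerDl.
Qed.

Lemma boZ V a (f : T -> V) g : bo f g -> bo (fun t => a *: f t) g.
Proof.
move=> [D D0 fg]; exists ((`|a| + 1) * D); first by rewrite mulr_gt0 // ltr_wpDl.
apply: filterS fg => t ft; rewrite normrZ -mulrA.
by rewrite ler_pM // lerDl.
Qed.

(** The error r may be measured against f itself: eventually |f| <= C g + (g + |f|) / 2, and half of
    |f| moves to the left. This turns errors relative to the next iterate into errors relative to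
    the current one. *)
Lemma bo_absorb V W (f : T -> V) (h : T -> V) (r : T -> W) g :
  lo r (fun t => g t + `|f t|) -> bo h g ->
  (forall t, `|f t| <= `|h t| + `|r t|) -> bo f g.
Proof.
move=> rg [C C0 hg] fE; exists (2 * C + 1); first lra.
near=> t; have := fE t.
have : `|h t| <= C * g t by near: t.
have : `|r t| <= 2^-1 * (g t + `|f t|) by near: t; apply: rg; rewrite invr_gt0.
lra.
Unshelve. all: by end_near. Qed.

Lemma lo_eq V (f h : T -> V) g : f =1 h -> lo f g -> lo h g.
Proof. by move=> /funext ->. Qed.

Lemma bo_eq V (f h : T -> V) g : f =1 h -> bo f g -> bo h g.
Proof. by move=> /funext ->. Qed.

Lemma lo_near V (f h : T -> V) g :
  (\forall t \near F, f t = h t) -> lo f g -> lo h g.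
Proof.
move=> fh fg e e0; near=> t; have <- : f t = h t by near: t.
by near: t; exact: fg.
Unshelve. all: by end_near. Qed.

End LittleO.

(** * Strict differentiability *)

Section StrictDiff.
Context {K : realType}.
Implicit Types U V W : normedModType K.

(** Both points vary, which is what yields a Lipschitz bound near x ([sdiff_lip]) and the comparison
    of derivatives ([sdiff_close]). [D] is a bare function, with linearity and boundedness kept in
    [blin], so that sums, compositions and columns of derivatives can be written directly. *)
Definition sdiff V W (f : V -> W) (D : V -> W) (x : V) :=
  forall e : K, 0 < e -> exists2 d : K, 0 < d & forall y z : V,
    `|y - x| < d -> `|z - x| < d -> `|f y - f z - D (y - z)| <= e * `|y - z|.

Definition blin V W (D : V -> W) :=
  [/\ forall x y, D (x + y) = D x + D y,
      forall a x, D (a *: x) = a *: D x &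
      exists2 C : K, 0 < C & forall x, `|D x| <= C * `|x|].

Lemma blin0 V W (D : V -> W) : blin D -> D 0 = 0.
Proof. by move=> [_ DZ _]; rewrite -(scale0r 0) DZ scale0r. Qed.

Lemma blinB V W (D : V -> W) x y : blin D -> D (x - y) = D x - D y.
Proof. by move=> [DD DZ _]; rewrite DD -scaleN1r DZ scaleN1r. Qed.

Lemma blin_mulmx m n (A : 'M[K]_(m, n)) : blin (mulmx A : 'cV_n -> 'cV_m).
Proof.
split; [exact: mulmxDr|by move=> a x; rewrite scalemxAr|].
by have [C C0 CA] := norm_mulmx_bound A; exists C => // x; exact: CA.
Qed.

Lemma blin_dotv n (u : 'cV[K]_n) : blin (dotv u : 'cV[K]_n -> K).
Proof.
split; [exact: dotvDr|by move=> a x; rewrite dotvZr|].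
exists (n%:R * `|u| + 1); first by rewrite ltr_wpDl // mulr_ge0.
by move=> x; rewrite (le_trans (norm_dotv _ _)) // ler_wpM2r // lerDl.
Qed.

Lemma sdiff_eqD V W (f : V -> W) D D' x : D =1 D' -> sdiff f D x -> sdiff f D' x.
Proof. by move=> /funext ->. Qed.

Lemma sdiff_cst V W (a : W) (x : V) : sdiff (fun=> a) (fun=> 0) x.
Proof.
move=> e e0; exists 1 => // y z _ _.
by rewrite subrr subr0 normr0 mulr_ge0 // ltW.
Qed.

Lemma sdiff_lin V W (D : V -> W) x : blin D -> sdiff D D x.
Proof.
move=> bD e e0; exists 1 => // y z _ _.
by rewrite (blinB y) // subrr normr0 mulr_ge0 // ltW.
Qed.

Lemma sdiff_subr n (a x : 'cV[K]_n) :
  sdiff (fun y : 'cV[K]_n => y - a) (mulmx 1%:M) x.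
Proof.
move=> e e0; exists 1 => // u v _ _.
by rewrite mul1mx opprB addrA subrK subrr normr0 mulr_ge0 // ltW.
Qed.

Lemma blin_scale V (v : V) : blin (fun s : K => s *: v).
Proof.
split; [by move=> s t; rewrite scalerDl|by move=> a s; rewrite scalerA|].
exists (`|v| + 1) => [|s]; first by rewrite ltr_wpDl.
by rewrite normrZ mulrC ler_wpM2r // lerDl.
Qed.

Lemma sdiffD V W (f g : V -> W) D E x :
  sdiff f D x -> sdiff g E x ->
  sdiff (fun y => f y + g y) (fun h => D h + E h) x.
Proof.
move=> fD gE e e0; have e20 : 0 < e / 2 by rewrite divr_gt0.
have [d d0 fd] := fD _ e20; have [d' d'0 gd] := gE _ e20.
exists (Num.min d d'); first by rewrite lt_min d0.
move=> y z; rewrite !lt_min => /andP[yd yr] /andP[zd zr].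
have -> : f y + g y - (f z + g z) - (D (y - z) + E (y - z)) =
    (f y - f z - D (y - z)) + (g y - g z - E (y - z)).
  by rewrite !opprD [f y + _ + _]addrACA [LHS]addrACA.
apply: (le_trans (ler_normD _ _)).
have := fd _ _ yd zd; have := gd _ _ yr zr; lra.
Qed.

Lemma blinD V W (D E : V -> W) : blin D -> blin E -> blin (fun h => D h + E h).
Proof.
move=> [DD DZ [C C0 DC]] [ED EZ [C' C'0 EC]]; split.
- by move=> x y; rewrite DD ED addrACA.
- by move=> a x; rewrite DZ EZ scalerDr.
- exists (C + C') => [|x]; first exact: addr_gt0.
  by rewrite (le_trans (ler_normD _ _)) // mulrDl lerD.
Qed.

Lemma blin_cst0 V W : blin (fun _ : V => 0 : W).
Proof.
split; [by rewrite addr0|by move=> a _; rewrite scaler0|].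
by exists 1 => // x; rewrite normr0 mul1r.
Qed.

Lemma blin_comp U V W (D : U -> V) (E : V -> W) : blin D -> blin E -> blin (E \o D).
Proof.
move=> [DD DZ [C C0 DC]] [ED EZ [C' C'0 EC]]; split => /=.
- by move=> x y; rewrite DD ED.
- by move=> a x; rewrite DZ EZ.
- exists (C' * C) => [|x]; first exact: mulr_gt0.
  by rewrite (le_trans (EC _)) // -mulrA ler_pM2l.
Qed.

Lemma sdiff_sum V W n (f : 'I_n -> V -> W) D x :
  (forall i, sdiff (f i) (D i) x) ->
  sdiff (fun y => \sum_i f i y) (fun h => \sum_i D i h) x.
Proof.
elim: n f D => [|n IH] f D fD.
  have -> : (fun y => \sum_(i < 0) f i y) = fun=> 0.
    by apply/funext => y; rewrite big_ord0.
  have -> : (fun y => \sum_(i < 0) D i y) = fun=> 0.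
    by apply/funext => y; rewrite big_ord0.
  exact: sdiff_cst.
have -> : (fun y => \sum_(i < n.+1) f i y) =
    fun y => f ord0 y + \sum_(i < n) f (lift ord0 i) y.
  by apply/funext => y; rewrite big_ord_recl.
have -> : (fun y => \sum_(i < n.+1) D i y) =
    fun y => D ord0 y + \sum_(i < n) D (lift ord0 i) y.
  by apply/funext => y; rewrite big_ord_recl.
apply: sdiffD; first exact: fD.
by apply: (IH (fun i => f (lift ord0 i)) (fun i => D (lift ord0 i))) => i; exact: fD.
Qed.

Lemma blin_sum V W n (D : 'I_n -> V -> W) :
  (forall i, blin (D i)) -> blin (fun h => \sum_i D i h).
Proof.
elim: n D => [|n IH] D bD.
  have -> : (fun y => \sum_(i < 0) D i y) = fun=> 0.
    by apply/funext => y; rewrite big_ord0.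
  exact: blin_cst0.
have -> : (fun y => \sum_(i < n.+1) D i y) =
    fun y => D ord0 y + \sum_(i < n) D (lift ord0 i) y.
  by apply/funext => y; rewrite big_ord_recl.
by apply: blinD => //; apply: (IH (fun i => D (lift ord0 i))) => i; exact: bD.
Qed.

Lemma sdiff_lip V W (f : V -> W) D x : blin D -> sdiff f D x ->
  exists2 C : K, 0 < C & exists2 d : K, 0 < d & forall y z : V,
    `|y - x| < d -> `|z - x| < d -> `|f y - f z| <= C * `|y - z|.
Proof.
move=> [_ _ [C C0 DC]] /(_ 1 ltr01)[d d0 fd].
exists (C + 1); first by rewrite addr_gt0.
exists d => // y z yd zd; have := fd _ _ yd zd; have := DC (y - z).
have := ler_normD (f y - f z - D (y - z)) (D (y - z)); rewrite subrK.
lra.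
Qed.

Lemma sdiff_cont V W (f : V -> W) D x : blin D -> sdiff f D x ->
  forall e : K, 0 < e -> exists2 d : K, 0 < d & forall y : V,
    `|y - x| < d -> `|f y - f x| < e.
Proof.
move=> bD /(sdiff_lip bD)[C C0 [d d0 fd]] e e0.
exists (Num.min d (e / C)); first by rewrite lt_min d0 divr_gt0.
move=> y; rewrite lt_min ltr_pdivlMr // => /andP[yd ye].
apply: le_lt_trans (fd _ _ yd _) _; first by rewrite subrr normr0.
by rewrite mulrC.
Qed.

Lemma sdiff_comp U V W (f : U -> V) (g : V -> W) D E x :
  blin D -> blin E -> sdiff f D x -> sdiff g E (f x) -> sdiff (g \o f) (E \o D) x.
Proof.
move=> bD bE fD gE e e0.
have [C C0 [d1 d10 fl]] := sdiff_lip bD fD; have [_ _ [C' C'0 EC]] := bE.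
have e1 : 0 < e / (2 * C) by rewrite divr_gt0 // mulr_gt0.
have e2 : 0 < e / (2 * C') by rewrite divr_gt0 // mulr_gt0.
have [d2 d20 gd] := gE _ e1; have [d3 d30 fd] := fD _ e2.
have [d4 d40 fc] := sdiff_cont bD fD d20.
exists (Num.min d1 (Num.min d3 d4)); first by rewrite !lt_min d10 d30.
move=> y z; rewrite !lt_min => /and3P[y1 y3 y4] /and3P[z1 z3 z4] /=.
have -> : g (f y) - g (f z) - E (D (y - z)) =
    (g (f y) - g (f z) - E (f y - f z)) + E (f y - f z - D (y - z)).
  by rewrite (blinB (f y - f z)) // addrA subrK.
apply: (le_trans (ler_normD _ _)).
have h1 := gd _ _ (fc _ y4) (fc _ z4); have h2 := fl _ _ y1 z1.
have h3 := EC (f y - f z - D (y - z)); have h4 := fd _ _ y3 z3.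
have h5 := ler_wpM2l (ltW e1) h2; have h6 := ler_wpM2l (ltW C'0) h4.
have E1 : e / (2 * C) * (C * `|y - z|) = e / 2 * `|y - z|.
  by field; rewrite gt_eqF.
have E2 : C' * (e / (2 * C') * `|y - z|) = e / 2 * `|y - z|.
  by field; rewrite gt_eqF.
rewrite E1 in h5; rewrite E2 in h6; lra.
Qed.

Lemma sdiffZ V W (a : V -> K) (b : V -> W) Da Db x :
  blin Da -> blin Db -> sdiff a Da x -> sdiff b Db x ->
  sdiff (fun y => a y *: b y) (fun h => Da h *: b x + a x *: Db h) x.
Proof.
move=> bDa bDb aD bD e e0.
have [Ca Ca0 [d1 d10 la]] := sdiff_lip bDa aD.
have [Cb Cb0 [d2 d20 lb]] := sdiff_lip bDb bD.
have [_ _ [Cd Cd0 Dl]] := bDa.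
(* The remainder is split below into four products; each constant bounds one of them by e / 4 times
   |y - z|. The later minimum of e2 and 1 also ensures |b y| <= |b x| + 1. *)
pose e1 := e / (4 * (`|b x| + 1)); pose e2 := e / (4 * Cd).
pose e3 := e / (4 * Cb); pose e4 := e / (4 * (`|a x| + 1)).
have b10 : 0 < `|b x| + 1 by rewrite ltr_wpDl.
have a10 : 0 < `|a x| + 1 by rewrite ltr_wpDl.
have e10 : 0 < e1 by rewrite divr_gt0 // mulr_gt0.
have e20 : 0 < e2 by rewrite divr_gt0 // mulr_gt0.
have e30 : 0 < e3 by rewrite divr_gt0 // mulr_gt0.
have e40 : 0 < e4 by rewrite divr_gt0 // mulr_gt0.
have [d3 d30 h3] := aD _ e10; have [d4 d40 h4] := bD _ e40.
have e20' : 0 < Num.min e2 1 by rewrite lt_min e20 ltr01.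
have [d5 d50 h5] := sdiff_cont bDb bD e20'.
have [d6 d60 h6] := sdiff_cont bDa aD e30.
exists (Num.min d3 (Num.min d4 (Num.min d5 (Num.min d6 (Num.min d1 d2))))).
  by rewrite !lt_min d30 d40 d50 d60 d10.
move=> y z; rewrite !lt_min.
move=> /andP[y3 /andP[y4 /andP[y5 /andP[y6 /andP[y1 y2]]]]].
move=> /andP[z3 /andP[z4 /andP[z5 /andP[z6 /andP[z1 z2]]]]].
set h := y - z.
have -> : a y *: b y - a z *: b z - (Da h *: b x + a x *: Db h) =
   ((a y - a z - Da h) *: b y + Da h *: (b y - b x)) +
   ((a z - a x) *: (b y - b z) + a x *: (b y - b z - Db h)).
  have step (p q : K) (u v : W) : (p - q) *: u + q *: (u - v) = p *: u - q *: v.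
    by rewrite scalerBl scalerBr addrA subrK.
  by rewrite !step [RHS]addrACA scalerBl scalerBr subrKA opprD.
have nby : `|b y| <= `|b x| + 1.
  have := h5 _ y5; rewrite lt_min => /andP[_ /ltW].
  by have := ler_normD (b y - b x) (b x); rewrite subrK; lra.
have nby2 : `|b y - b x| <= e2.
  by have := h5 _ y5; rewrite lt_min => /andP[/ltW].
have t1 : `|(a y - a z - Da h) *: b y| <= e / 4 * `|h|.
  rewrite normrZ; apply: le_trans (ler_pM _ _ (h3 _ _ y3 z3) nby) _ => //.
  by rewrite le_eqVlt -/h /e1; apply/orP; left; apply/eqP; field; rewrite gt_eqF.
have t2 : `|Da h *: (b y - b x)| <= e / 4 * `|h|.
  rewrite normrZ; apply: le_trans (ler_pM _ _ (Dl h) nby2) _ => //.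
  by rewrite le_eqVlt /e2; apply/orP; left; apply/eqP; field; rewrite gt_eqF.
have t3 : `|(a z - a x) *: (b y - b z)| <= e / 4 * `|h|.
  rewrite normrZ; apply: le_trans (ler_pM _ _ (ltW (h6 _ z6)) (lb _ _ y2 z2)) _ => //.
  by rewrite le_eqVlt -/h /e3; apply/orP; left; apply/eqP; field; rewrite gt_eqF.
have t4 : `|a x *: (b y - b z - Db h)| <= e / 4 * `|h|.
  rewrite normrZ; apply: le_trans (ler_pM _ _ (_ : _ <= `|a x| + 1) (h4 _ _ y4 z4)) _ => //.
    by rewrite lerDl.
  by rewrite le_eqVlt -/h /e4; apply/orP; left; apply/eqP; field; rewrite gt_eqF.
apply: (le_trans (ler_normD _ _)).
have := ler_normD ((a y - a z - Da h) *: b y) (Da h *: (b y - b x)).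
have := ler_normD ((a z - a x) *: (b y - b z)) (a x *: (b y - b z - Db h)).
lra.
Qed.

Lemma blinZ V W (Da : V -> K) (Db : V -> W) (b : W) (a : K) :
  blin Da -> blin Db -> blin (fun h => Da h *: b + a *: Db h).
Proof.
move=> bDa bDb; apply: blinD.
  exact: (blin_comp bDa (blin_scale b)).
apply: (blin_comp (E := fun k : W => a *: k) bDb); split.
- by move=> x y; rewrite scalerDr.
- by move=> t x; rewrite !scalerA mulrC.
- exists (`|a| + 1); first by rewrite ltr_wpDl.
  by move=> x; rewrite normrZ ler_wpM2r // lerDl.
Qed.

Lemma fin_radius n (P : 'I_n -> K -> Prop) :
  (forall i d d', P i d -> 0 < d' -> d' <= d -> P i d') ->
  (forall i, exists2 d : K, 0 < d & P i d) ->
  exists2 d : K, 0 < d & forall i, P i d.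
Proof.
elim: n P => [|n IH] P anti ex; first by exists 1 => // -[].
have [d d0 dP] := IH (fun i => P (lift ord0 i)) (fun i => @anti _)
  (fun i => ex _).
have [d' d'0 d'P] := ex ord0.
have m0 : 0 < Num.min d d' by rewrite lt_min d0.
exists (Num.min d d') => // i; case: (unliftP ord0 i) => [j|] ->.
  by apply: anti (dP j) m0 _; rewrite ge_min lexx.
by apply: anti d'P m0 _; rewrite ge_min lexx orbT.
Qed.

Lemma sdiff_col V n (f : 'I_n -> V -> K) (D : 'I_n -> V -> K) x :
  (forall i, sdiff (f i) (D i) x) ->
  sdiff (fun y => \col_i f i y : 'cV[K]_n) (fun h => \col_i D i h) x.
Proof.
move=> fD e e0.
have [|i|d d0 fd] := @fin_radius n (fun i d => forall y z : V,
    `|y - x| < d -> `|z - x| < d ->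
    `|f i y - f i z - D i (y - z)| <= e * `|y - z|).
- move=> i d d' P d'0 dd' y z yd zd.
  by apply: P; [exact: lt_le_trans yd _|exact: lt_le_trans zd _].
- exact: fD.
exists d => // y z yd zd; apply: norm_le_entries.
  by rewrite mulr_ge0 // ltW.
by move=> i j; rewrite !mxE; exact: fd.
Qed.

Lemma sdiff_col_mx V m n (f : V -> 'cV[K]_m) (g : V -> 'cV[K]_n) D E x :
  sdiff f D x -> sdiff g E x ->
  sdiff (fun y => col_mx (f y) (g y)) (fun h => col_mx (D h) (E h)) x.
Proof.
move=> fD gE e e0; have e20 : 0 < e / 2 by rewrite divr_gt0.
have [d d0 fd] := fD _ e20; have [d' d'0 gd] := gE _ e20.
exists (Num.min d d'); first by rewrite lt_min d0.
move=> y z; rewrite !lt_min => /andP[yd yr] /andP[zd zr].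
rewrite !opp_col_mx !add_col_mx; apply: le_trans (norm_col_mx _ _) _.
have := fd _ _ yd zd; have := gd _ _ yr zr; lra.
Qed.

Lemma blin_col_mx V m n (D : V -> 'cV[K]_m) (E : V -> 'cV[K]_n) :
  blin D -> blin E -> blin (fun h => col_mx (D h) (E h)).
Proof.
move=> [DD DZ [C C0 DC]] [ED EZ [C' C'0 EC]]; split.
- by move=> x y; rewrite DD ED add_col_mx.
- by move=> a x; rewrite DZ EZ scale_col_mx.
- exists (C + C') => [|x]; first exact: addr_gt0.
  by rewrite (le_trans (norm_col_mx _ _)) // mulrDl lerD.
Qed.

Lemma blin_usub m n : blin (usubmx : 'cV[K]_(m + n) -> 'cV[K]_m).
Proof.
split; [exact: linearD|by move=> a x; rewrite linearZ|].
by exists 1 => // x; rewrite mul1r norm_usub.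
Qed.

Lemma sdiff_at V W (f : V -> W) D x : sdiff f D x ->
  forall e : K, 0 < e -> exists2 d : K, 0 < d & forall h : V,
    `|h| < d -> `|f (x + h) - f x - D h| <= e * `|h|.
Proof.
move=> fD e /fD[d d0 fd]; exists d => // h hd.
have := fd (x + h) x; rewrite subrr normr0 addrAC subrr add0r; exact.
Qed.

Lemma lo_comp V W (f : V -> W) D x (T : Type) (F : set_system T) (y : T -> V) :
  Filter F -> sdiff f D x -> (y @ F --> x) ->
  lo F (fun t => f (y t) - f x - D (y t - x)) (fun t => `|y t - x|).
Proof.
move=> FF fD yx e /(sdiff_at fD)[d d0 fd].
have /cvgr_distC_lt /(_ _ d0) := yx.
by apply: filterS => t /fd; rewrite subrKC.
Qed.

(** The increment of f between x' and x' + s h is approximated by both derivatives, by strictness at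
    x and by differentiability at x'. Homogeneity then removes the small factor s. *)
Lemma sdiff_close V W (f : V -> W) D x : blin D -> sdiff f D x ->
  forall e : K, 0 < e -> exists2 d : K, 0 < d & forall x' D',
    `|x' - x| < d -> blin D' -> sdiff f D' x' -> forall h, `|D' h - D h| <= e * `|h|.
Proof.
move=> bD fD e e0; have [d d0 fd] := fD _ (divr_gt0 e0 (ltr0n _ 2)).
exists d => // x' D' x'd bD' /(_ _ (divr_gt0 e0 (ltr0n _ 2)))[d' d'0 fd'] h.
have [->|h0] := eqVneq h 0.
  by rewrite (blin0 bD) (blin0 bD') subrr !normr0 mulr0.
have nh : 0 < `|h| by rewrite normr_gt0.
(* Below this length, x' + s h stays within d' of x' and within d of x. *)
pose r : K := Num.min d' (d - `|x' - x|).
have r0 : 0 < r by rewrite lt_min d'0 subr_gt0.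
pose s : K := r / (2 * `|h|).
have s0 : 0 < s by rewrite divr_gt0 // mulr_gt0.
have sh : `|s *: h| < r.
  rewrite normrZ gtr0_norm //; have -> : s * `|h| = r / 2 by rewrite /s; field; rewrite gt_eqF.
  lra.
have {}sh : `|s *: h| < d' /\ `|s *: h| < d - `|x' - x|.
  by move: sh; rewrite lt_min => /andP.
clearbody s.
have E y : x' + y - x' = y by rewrite addrC addKr.
have h1 := fd' (x' + s *: h) x'; have h2 := fd (x' + s *: h) x'.
rewrite E in h1 h2; rewrite subrr normr0 in h1.
have {}h1 := h1 sh.1 d'0.
have {}h2 : `|f (x' + s *: h) - f x' - D (s *: h)| <= e / 2 * `|s *: h|.
  apply: h2 => //; rewrite addrAC addrC (le_lt_trans (ler_normD _ _)) //.
  by have := sh.2; lra.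
have : `|D' (s *: h) - D (s *: h)| <= e * `|s *: h|.
  have -> : D' (s *: h) - D (s *: h) =
     (f (x' + s *: h) - f x' - D (s *: h)) - (f (x' + s *: h) - f x' - D' (s *: h)).
    by rewrite [RHS]addrC opprB subrKA.
  by apply: (le_trans (ler_normB _ _)); lra.
case: bD bD' => _ DZ _ [_ D'Z _].
have s1 : 0 < `|s| by rewrite gtr0_norm.
rewrite DZ D'Z -scalerBr !normrZ mulrCA.
by rewrite (ler_pM2l s1).
Qed.

(* Implicit function theorem along a given curve w: continuity of w at t
   replaces the existence part, so E need not be surjective around w t. *)
Lemma implicit_sdiff V W (E : V -> W) D (w : K -> V) (t : K) (b : W) (d : V) c :
  blin D -> sdiff E D (w t) -> 0 < c -> (forall h, c * `|h| <= `|D h|) -> D d = b ->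
  (forall e : K, 0 < e -> exists2 r : K, 0 < r &
     forall s, `|s - t| < r -> `|w s - w t| < e) ->
  (exists2 r : K, 0 < r & forall s u, `|s - t| < r -> `|u - t| < r ->
     E (w s) - E (w u) = (s - u) *: b) ->
  sdiff w (fun s : K => s *: d : V) t.
Proof.
move=> bD ED c0 Dc Dd wc [r1 r10 Ew] e e0.
have c20 : 0 < c / 2 by rewrite divr_gt0.
have b10 : 0 < `|b| + 1 by rewrite ltr_wpDl.
(* The bound c / 2 lets the remainder be absorbed and makes w Lipschitz at t, with constant 2 (|b| +
   1) / c; the other bound turns this Lipschitz estimate into the required precision e. *)
pose e1 := Num.min (c / 2) (e * c ^+ 2 / (2 * (`|b| + 1))).
have e10 : 0 < e1 by rewrite lt_min c20 !(divr_gt0, mulr_gt0, exprn_gt0).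
have [d1 d10 Ed] := ED _ e10; have [r2 r20 wd] := wc _ d10.
exists (Num.min r1 r2); first by rewrite lt_min r10.
move=> s u; rewrite !lt_min => /andP[s1 s2] /andP[u1 u2].
have := Ed _ _ (wd _ s2) (wd _ u2); rewrite Ew //.
have := Dc (w s - w u); set h := w s - w u => h1 h2.
have e1c : e1 <= c / 2 by rewrite ge_min lexx.
have e1e : e1 <= e * c ^+ 2 / (2 * (`|b| + 1)) by rewrite ge_min lexx orbT.
have h3 : c / 2 * `|h| <= (`|b| + 1) * `|s - u|.
  have h4 := ler_normB ((s - u) *: b) ((s - u) *: b - D h).
  rewrite subKr normrZ in h4.
  have h5 : e1 * `|h| <= c / 2 * `|h| by rewrite ler_wpM2r.
  have : 0 <= `|s - u| by []. have : 0 <= `|h| by [].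
  nra.
have h6 := Dc (h - (s - u) *: d).
have {}h6 : c * `|h - (s - u) *: d| <= e1 * `|h|.
  by apply: le_trans h6 _; have [_ DZ _] := bD; rewrite blinB // DZ Dd -normrN opprB.
rewrite -(ler_pM2l c0); apply: le_trans h6 _.
have h7 : e1 * `|h| <= e * c ^+ 2 / (2 * (`|b| + 1)) * `|h| by rewrite ler_wpM2r.
apply: le_trans h7 _.
have -> : e * c ^+ 2 / (2 * (`|b| + 1)) * `|h| = e * c / (`|b| + 1) * (c / 2 * `|h|).
  by field; rewrite gt_eqF.
have k0 : 0 <= e * c / (`|b| + 1) by rewrite ltW // !(divr_gt0, mulr_gt0).
apply: le_trans (ler_wpM2l k0 h3) _.
rewrite le_eqVlt; apply/orP; left; apply/eqP; field; rewrite gt_eqF//.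
Qed.

End StrictDiff.

(** * Derivatives, gradients and symmetry of the Hessian *)

Section Derivatives.
Context {K : realType}.
Implicit Types V W : normedModType K.

Lemma is_derive_eps V (f : K -> V) (s : K) (l : V) :
  (forall e : K, 0 < e -> exists2 d : K, 0 < d & forall h : K, `|h| < d ->
     `|f (s + h) - f s - h *: l| <= e * `|h|) ->
  is_derive (s : K^o) 1 f l.
Proof.
move=> fl.
have cv : (fun h : K => h^-1 *: ((f \o shift s) (h *: 1) - f s)) @ 0^' --> l.
  apply/cvgrPdist_le => e e0; have [d d0 fd] := fl _ e0.
  near=> h; have h0 : h != 0 by near: h; exact: nbhs_dnbhs_neq.
  have hd : `|h| < d by near: h; exact: dnbhs0_lt.
  have := fd h hd; rewrite /= [h *: 1]mulr1 [h + s]addrC distrC => fh.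
  have nh : 0 < `|h| by rewrite normr_gt0.
  rewrite -(ler_pM2l nh) -normrZ scalerBr scalerA divff // scale1r.
  by rewrite [leRHS]mulrC.
by apply: DeriveDef; [apply/cvg_ex; exists l | exact: cvg_lim].
Unshelve. all: by end_near. Qed.

Lemma diff_eps V W (f : V -> W) (x : V) : differentiable f x ->
  forall e : K, 0 < e -> exists2 d : K, 0 < d & forall h : V, `|h| < d ->
     `|f (x + h) - f x - 'd f x h| <= e * `|h|.
Proof.
move=> /diff_locally /eqaddoP fx e e0.
have /nbhs_ballP[d /= d0 fd] := fx e e0.
exists d => // h hd; rewrite -addrA -opprD addrC addrC [x + h]addrC.
by apply: (fd h); rewrite -ball_normE /ball_ /= sub0r normrN.
Qed.

Definition gradv n (f : 'cV[K]_n -> K) (x : 'cV[K]_n) : 'cV[K]_n :=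
  \col_i 'D_(basisv i) f x.

Lemma diff_gradv n (f : 'cV[K]_n -> K) x h : differentiable f x ->
  'd f x h = dotv (gradv f x) h.
Proof.
move=> fx; have {1}-> : h = \sum_i h i 0 *: basisv i.
  rewrite {1}[h]matrix_sum_delta; apply: eq_bigr => i _.
  by rewrite big_ord1.
rewrite linear_sum; apply: eq_bigr => i _.
by rewrite linearZ /= mxE deriveE // mulrC.
Qed.

Lemma line_mvt n (g : 'cV[K]_n -> K) z h :
  (forall s : K, 0 <= s <= 1 -> differentiable g (z + s *: h)) ->
  exists2 s : K, 0 < s < 1 & g (z + h) - g z = dotv (gradv g (z + s *: h)) h.
Proof.
move=> dg; pose f (s : K) := g (z + s *: h).
have fd (s : K) : 0 <= s <= 1 ->
    is_derive (s : K^o) 1 f (dotv (gradv g (z + s *: h)) h).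
  move=> /dg gs; apply: is_derive_eps => e e0.
  have h1 : 0 < `|h| + 1 by rewrite ltr_wpDl.
  have [d d0 gd] := diff_eps gs (divr_gt0 e0 h1).
  exists (d / (`|h| + 1)) => [|k]; first exact: divr_gt0.
  rewrite ltr_pdivlMr // => kd.
  have kh : `|k *: h| <= `|k| * (`|h| + 1) by rewrite normrZ ler_wpM2l // lerDl.
  have := gd (k *: h) (le_lt_trans kh kd).
  rewrite diff_gradv // dotvZr /f scalerDl addrA => /le_trans; apply.
  apply: le_trans (ler_wpM2l (ltW (divr_gt0 e0 h1)) kh) _.
  by rewrite mulrCA divfK ?gt_eqF // mulrC.
have [||s s01] := @MVT K f (fun s => dotv (gradv g (z + s *: h)) h) 0 1 ltr01.
- by move=> s; rewrite in_itv /= => /andP[s0 s1]; apply: fd; rewrite !ltW.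
- apply: derivable_within_continuous => s; rewrite in_itv /= => s01.
  by have := fd _ s01; case.
rewrite /f scale1r scale0r addr0 subr0 mulr1 => E; by exists s => //; move: s01; rewrite in_itv.
Qed.

(** Apply the mean value theorem on the segment from z to y. Balls are convex, so the intermediate
    gradient is close to the one at x; n + 1 compensates the factor n of [norm_dotv]. *)
Lemma C1_sdiff n (g : 'cV[K]_n -> K) x :
  (\forall y \near x, differentiable g y) ->
  (forall i, {for x, continuous ('D_(basisv i) g)}) ->
  sdiff g (dotv (gradv g x)) x.
Proof.
move=> /nbhs_ballP[r /= r0 dg] cg e e0.
have n10 : 0 < n%:R + 1 :> K by rewrite ltr_wpDl.
have e1 : 0 < e / (n%:R + 1) by exact: divr_gt0.
have : \forall y \near x, forall i,
    `|'D_(basisv i) g x - 'D_(basisv i) g y| < e / (n%:R + 1).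
  apply: (@filter_forall _ _ (fun i y =>
    `|'D_(basisv i) g x - 'D_(basisv i) g y| < e / (n%:R + 1)) (nbhs x)) => i.
  have /cvgrPdist_lt := cg i.
  exact.
move=> /nbhs_ballP[d /= d0 gd].
exists (Num.min d r); first by rewrite lt_min d0.
move=> y z; rewrite !lt_min => /andP[yd yr] /andP[zd zr].
have seg q (s : K) : 0 <= s <= 1 -> `|y - x| < q -> `|z - x| < q ->
    `|x - (z + s *: (y - z))| < q.
  move=> /andP[s0 s1] yq zq.
  have -> : x - (z + s *: (y - z)) = - (s *: (y - x) + (1 - s) *: (z - x)).
    by apply/matrixP => i j; rewrite !mxE; ring.
  rewrite normrN (le_lt_trans (ler_normD _ _)) // !normrZ ger0_norm // ger0_norm ?subr_ge0 //.
  have [a b] : `|y - x| <= Num.max `|y - x| `|z - x| /\ `|z - x| <= Num.max `|y - x| `|z - x|.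
    by rewrite !le_max !lexx orbT.
  have m : Num.max `|y - x| `|z - x| < q by rewrite gt_max yq.
  have s1' : 0 <= 1 - s by rewrite subr_ge0.
  have := ler_wpM2l s0 a; have := ler_wpM2l s1' b; lra.
have [s s01|s /andP[s0 s1]] := @line_mvt n g z (y - z).
  by apply: dg; rewrite -ball_normE /=; exact: seg.
rewrite subrKC => ->; rewrite -dotvBl.
apply: le_trans (norm_dotv _ _) _; rewrite ler_wpM2r //.
have : `|gradv g (z + s *: (y - z)) - gradv g x| <= e / (n%:R + 1).
  apply: norm_le_entries => [|i j]; first exact: ltW.
  rewrite !mxE distrC ltW //; apply: gd; rewrite -ball_normE /=.
  by apply: seg => //; rewrite !ltW.
move=> /(ler_wpM2l (ler0n _ n)) /le_trans; apply.
rewrite mulrCA ler_piMr ?ltW // ltr_pdivrMr // mul1r ltrDl //.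
Qed.

(* All that is used of C^2 regularity. *)
Definition c2 n (f : 'cV[K]_n -> K) (x : 'cV[K]_n) :=
  \forall y \near x, sdiff f (dotv (gradv f y)) y /\
                     sdiff (gradv f) (mulmx (hess f y)) y.

Lemma C2_near_c2 n (f : 'cV[K]_n -> K) x : C2_near f x -> c2 f x.
Proof.
(* The regularity must hold in a neighbourhood of each nearby y, since [C1_sdiff] at y asks for
   differentiability around y. *)
move=> /near_join f2; near=> y.
have fy : C2_near f y by near: y.
split.
  apply: C1_sdiff; first by apply: filterS fy => z [].
  move=> i; apply: differentiable_continuous.
  by have [_] := nbhs_singleton fy.
have -> : gradv f = fun y => \col_i ('D_(basisv i) f) y by [].
apply: (@sdiff_eqD _ _ _ _ (fun h => \col_i dotv (gradv ('D_(basisv i) f) y) h)).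
  move=> h; apply/matrixP => i j; rewrite mxE [j]ord1 !mxE.
  by apply: eq_bigr => k _; rewrite !mxE.
apply: sdiff_col => i; apply: C1_sdiff.
  by apply: filterS fy => z [_ + _]; apply.
move=> j; have [_ _ cont] := nbhs_singleton fy.
suff : ('D_(basisv j) ('D_(basisv i) f) : 'cV[K]_n -> K) @ nbhs y -->
    'D_(basisv j) ('D_(basisv i) f) y by [].
apply/cvgrPdist_lt => e e0.
have : (hess f : 'cV[K]_n -> _) @ nbhs y --> hess f y by exact: cont.
move=> /cvgrPdist_lt/(_ e e0).
apply: filterS => z; apply: le_lt_trans.
by apply: le_trans (entry_le_norm _ i j); rewrite !mxE.
Unshelve. all: by end_near. Qed.

Lemma differentiable_shiftr n (f : 'cV[K]_n -> K) c x :
  differentiable f (x + c) -> differentiable (fun y => f (y + c)) x.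
Proof.
move=> fx; apply: (@differentiable_comp _ _ _ _ (fun y => y + c) f) => //.
Qed.

Lemma gradv_shiftB n (f : 'cV[K]_n -> K) c x :
  differentiable f (x + c) -> differentiable f x ->
  gradv (fun y => f (y + c) - f y) x = gradv f (x + c) - gradv f x.
Proof.
move=> fxc fx; apply/matrixP => i j; rewrite !mxE deriveB //; last 2 first.
- by apply: diff_derivable; exact: differentiable_shiftr.
- exact: diff_derivable.
congr (_ - _); apply: (congr1 (fun g : K -> K => lim (g @ 0^'))).
by apply/funext => h /=; rewrite addrA.
Qed.

(* Schwarz: the second difference f(x+ta+tb) - f(x+ta) - f(x+tb) + f(x), which
   is symmetric in a and b, is t^2 <Q b, a> + o(t^2). *)
Lemma c2_second_diff n (f : 'cV[K]_n -> K) x (a b : 'cV[K]_n) :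
  (\forall y \near x, differentiable f y) ->
  sdiff (gradv f) (mulmx (hess f x)) x ->
  forall e : K, 0 < e -> exists2 d : K, 0 < d & forall t : K, 0 < t < d ->
    `|f (x + t *: a + t *: b) - f (x + t *: a) - f (x + t *: b) + f x -
      t ^+ 2 * dotv (hess f x *m b) a| <= e * t ^+ 2.
Proof.
move=> /nbhs_ballP[r /= r0 df] gf e e0.
pose C : K := `|a| + `|b| + 1.
have C0 : 0 < C by rewrite ltr_wpDl // addr_ge0.
have n1 : 0 < n%:R + 1 :> K by rewrite ltr_wpDl.
have P0 : 0 < 2 * (n%:R + 1) * C ^+ 2 by rewrite !(mulr_gt0, exprn_gt0).
pose e1 : K := e / (2 * (n%:R + 1) * C ^+ 2).
have e10 : 0 < e1 by rewrite divr_gt0.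
have [d d0 gd] := sdiff_at gf e10.
exists (Num.min r d / C) => [|t /andP[t0]]; first by rewrite divr_gt0 // lt_min r0.
rewrite ltr_pdivlMr // lt_min => /andP[tr td].
have small (s u : K) : 0 <= s <= t -> 0 <= u <= t -> `|s *: a + u *: b| <= t * C.
  move=> /andP[s0 st] /andP[u0 ut]; rewrite (le_trans (ler_normD _ _)) // !normrZ.
  rewrite !ger0_norm // /C; have h1 := ler_wpM2r (normr_ge0 a) st.
  have h2 := ler_wpM2r (normr_ge0 b) ut; lra.
have dfx (s u : K) : 0 <= s <= t -> 0 <= u <= t -> differentiable f (x + (s *: a + u *: b)).
  move=> st ut; apply: df; rewrite -ball_normE /= opprD addNKr normrN.
  exact: le_lt_trans (small _ _ st ut) _.
have tt : 0 <= t <= t by rewrite lexx ltW.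
have t00 : 0 <= (0 : K) <= t by rewrite lexx ltW.
have st (s : K) : 0 <= s <= 1 -> 0 <= s * t <= t.
  by move=> /andP[s0 s1]; rewrite mulr_ge0 ?(ltW t0) // ler_piMl // ltW.
(* Mean value theorem in the direction a for y |-> f (y + t b) - f y. Its gradient is a difference
   of two gradients of f, each expanded at x, and the contributions of s t a cancel. *)
have [s s01|s s01] := @line_mvt n (fun y => f (y + t *: b) - f y) x (t *: a).
  rewrite scalerA; apply: differentiableB.
    by apply: differentiable_shiftr; rewrite -addrA; apply: dfx => //; exact: st.
  by have := dfx _ _ (st s s01) t00; rewrite scale0r addr0.
have {}s01 : 0 <= s <= 1 by case/andP: s01 => ? ?; rewrite !ltW.
rewrite scalerA gradv_shiftB; last 2 first.
- by rewrite -addrA; apply: dfx => //; exact: st.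
- by have := dfx _ _ (st s s01) t00; rewrite scale0r addr0.
have bound k : `|k| <= t * C -> `|gradv f (x + k) - gradv f x - hess f x *m k| <= e1 * (t * C).
  by move=> kt; apply: le_trans (gd k (le_lt_trans kt td)) _; rewrite ler_pM2l.
have h1 := bound _ (small _ _ (st s s01) tt).
have h2 := bound _ (small _ _ (st s s01) t00).
rewrite scale0r addr0 in h2; rewrite addrA in h1.
have -> : f (x + t *: a + t *: b) - f (x + t *: a) - f (x + t *: b) + f x =
   f (x + t *: a + t *: b) - f (x + t *: a) - (f (x + t *: b) - f x) by ring.
move=> ->.
set A := gradv f _ in h1 *; set B := gradv f _ in h2 *.
pose Z : 'cV[K]_n := A - gradv f x - hess f x *m ((s * t) *: a + t *: b).
pose Y : 'cV[K]_n := B - gradv f x - hess f x *m ((s * t) *: a).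
have {}h1 : `|Z| <= e1 * (t * C) := h1.
have {}h2 : `|Y| <= e1 * (t * C) := h2.
have AB : A - B = t *: (hess f x *m b) + (Z - Y).
  rewrite /Z /Y mulmxDr -!scalemxAr.
  by apply/matrixP => i j; rewrite !mxE; ring.
clearbody A B Z Y.
have -> : dotv (A - B) (t *: a) - t ^+ 2 * dotv (hess f x *m b) a = t * dotv (Z - Y) a.
  by rewrite AB dotvZr (dotvDl (t *: _)) (dotvZl t); ring.
rewrite normrM (gtr0_norm t0).
have h3 : `|dotv (Z - Y) a| <= e * t.
  apply: le_trans (norm_dotv _ _) _.
  have h4 : `|Z - Y| <= 2 * (e1 * (t * C)) by have h5 := ler_normB Z Y; lra.
  have aC : `|a| <= C by rewrite /C -addrA lerDl addr_ge0.
  have -> : e * t = (n%:R + 1) * (2 * (e1 * (t * C))) * C.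
    by rewrite /e1; field; rewrite !gt_eqF.
  apply: ler_pM => //.
  by apply: ler_pM => //; rewrite lerDl.
by rewrite expr2 mulrA mulrC; apply: ler_wpM2r h3; exact: ltW.
Qed.

Lemma c2_hess_sym n (f : 'cV[K]_n -> K) (x : 'cV[K]_n) :
  (\forall y \near x, differentiable f y) ->
  sdiff (gradv f) (mulmx (hess f x)) x ->
  (hess f x)^T = hess f x.
Proof.
move=> df gf.
suff sym a b : dotv (hess f x *m b) a = dotv (hess f x *m a) b.
  apply/matrixP => i j; rewrite mxE.
  have colH (A : 'M[K]_n) k l : A k l = dotv (A *m delta_mx l 0) (delta_mx k 0).
    by rewrite dotvC dotv_delta -colE mxE.
  by rewrite !colH sym.
apply/eqP; rewrite -subr_eq0 -normr_eq0 eq_le normr_ge0 andbT leNgt; apply/negP.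
(* With q the defect of symmetry, precision q / 4 in both expansions of the same second difference
   leaves t^2 q <= (q / 2) t^2. *)
set q := `|_| => q0; have q4 : 0 < q / 4 by rewrite divr_gt0.
have [d d0 h1] := c2_second_diff a b df gf q4.
have [d' d'0 h2] := c2_second_diff b a df gf q4.
pose t := Num.min d d' / 2.
have m0 : 0 < Num.min d d' by rewrite lt_min d0.
have t0 : 0 < t by rewrite divr_gt0.
have tm : t < Num.min d d' by rewrite /t; lra.
move: tm; rewrite lt_min => /andP[td td'].
have := h1 t; have := h2 t; rewrite t0 td td' => /(_ isT) + /(_ isT).
rewrite [x + t *: b + t *: a]addrAC.
set S := f (x + t *: a + t *: b); set A := f (x + t *: a); set B := f (x + t *: b).
move=> k1 k2.
have : t ^+ 2 * q <= q / 2 * t ^+ 2.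
  rewrite -[t ^+ 2 in leLHS]gtr0_norm ?exprn_gt0 // -normrM.
  rewrite [X in `|X|](_ : _ = (S - B - A + f x - t ^+ 2 * dotv (hess f x *m a) b) -
     (S - A - B + f x - t ^+ 2 * dotv (hess f x *m b) a)); last by ring.
  by apply: le_trans (ler_normB _ _) _; lra.
have : 0 < t ^+ 2 by rewrite exprn_gt0.
nra.
Qed.

End Derivatives.

(** * Compactness: minima of semicontinuous functions and increasing covers *)

Section Compactness.
Context {K : realType}.

Lemma compact_cball n (x : 'cV[K]_n) (r : K) :
  compact [set y : 'cV[K]_n | `|y - x| <= r].
Proof.
have -> : [set y : 'cV[K]_n | `|y - x| <= r] =
    (fun y : 'rV[K]_n => y^T) @` [set y : 'rV[K]_n | `|x^T - y| <= r].
  apply/seteqP; split => [y /= yr|_ /= [y yr <-]].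
    by exists y^T; rewrite ?trmxK //= -linearB /= norm_trmx distrC.
  by rewrite -[x]trmxK -linearB /= norm_trmx distrC.
apply: continuous_compact.
  apply: continuous_subspaceT => y.
  suff : (fun y : 'rV[K]_n => y^T) @ nbhs y --> y^T by [].
  apply/cvgrPdist_lt => e e0; near=> z.
  rewrite -linearB /= norm_trmx; near: z.
  have /cvgrPdist_lt := @cvg_id _ (nbhs y); exact.
apply: bounded_closed_compact; last exact: closed_closed_ball_.
exists (`|x| + `|r|); split => [|M xM y /= xy]; first exact: num_real.
rewrite -[y](subKr x^T) (le_trans (ler_normB _ _)) // norm_trmx.
by apply: le_trans (ltW xM); rewrite lerD2l (le_trans xy) // ler_norm.
Unshelve. all: by end_near. Qed.

(** The minimiser is a cluster point of the filter generated by the sublevel sets; the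
    semicontinuity hypothesis is relative to B. *)
Lemma lsc_min (T : topologicalType) (B : set T) (f : T -> \bar K) :
  compact B -> B !=set0 ->
  (forall x (a : K), B x -> (a%:E < f x)%E ->
     \forall y \near x, B y -> (a%:E < f y)%E) ->
  exists2 x, B x & forall y, B y -> (f x <= f y)%E.
Proof.
move=> cB [b Bb] lsc.
pose F : set_system T := filter_from B (fun y => [set z | B z /\ (f z <= f y)%E]).
have FF : ProperFilter F.
  apply: filter_from_proper; last by move=> y By; exists y.
  apply: filter_from_filter; first by exists b.
  move=> i j Bi Bj; case: (leP (f i) (f j)) => ij; [exists i|exists j] => // z /= [Bz zi].
    by split; split => //; exact: le_trans ij.
  by split; split => //; exact: le_trans (ltW ij).
have [|x [Bx clx]] := cB F FF; first by exists b => // z [].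
exists x => // y By; rewrite leNgt; apply/negP => yx.
(* A real level separating f y from f x, either of which may be infinite. *)
have [a ya ax] : exists2 a : K, (f y <= a%:E)%E & (a%:E < f x)%E.
  case: (f y) yx => [r| |] yx; first by exists r.
  - by move: yx; rewrite ltNge leey.
  - case: (f x) yx => [r _| _|//].
      by exists (r - 1); [exact: leNye|rewrite lte_fin ltrBlDr ltrDl].
    by exists 0; [exact: leNye|exact: ltry].
have [z [/= [Bz zy] /(_ Bz) az]] := clx _ _
  (ex_intro2 _ _ y By (fun z => id) : F [set z | B z /\ (f z <= f y)%E]) (lsc _ _ Bx ax).
by have := lt_le_trans az (le_trans zy ya); rewrite ltxx.
Qed.

(** If no U k covered B, the sets B \ U k would generate a proper filter, and the local hypothesis
    fails at any of its cluster points. *)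
Lemma compact_increasing_cover (T : topologicalType) (B : set T) (U : nat -> set T) :
  compact B -> (forall i j, (i <= j)%N -> U i `<=` U j) ->
  (forall x, B x -> exists k, \forall y \near x, B y -> U k y) ->
  exists k, B `<=` U k.
Proof.
move=> cB mono cov; apply: contrapT => /forallNP no.
pose F : set_system T := filter_from setT (fun k => [set z | B z /\ ~ U k z]).
have FF : ProperFilter F.
  apply: filter_from_proper; last first.
    move=> k _; apply: contrapT => /forallNP nz; apply: (no k) => z Bz.
    by apply: contrapT => Uz; apply: (nz z).
  apply: filter_from_filter; first by exists 0%N.
  move=> i j _ _; exists (maxn i j) => // z /= [Bz Uz].
  by split; split => // Uiz; apply: Uz; apply: mono Uiz; rewrite leq_max leqnn ?orbT.
have [|x [Bx clx]] := cB F FF; first by exists 0%N => // z [].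
have [k Uk] := cov x Bx.
have [z [/= [Bz nU] /(_ Bz)]] := clx _ _
  (ex_intro2 _ _ k Logic.I (fun z => id) : F [set z | B z /\ ~ U k z]) Uk.
exact.
Qed.

End Compactness.

(** * Proximal points and their subgradients *)

Section Prox.
Context {K : realType} {n : nat}.
Implicit Types f : 'cV[K]_n -> \bar K.

Lemma subdiff_fin f x u : proper_fun f -> subdiff f x u -> f x \is a fin_num.
Proof.
move=> [fN [y fy]] fu; rewrite fin_numE fN /=; apply/eqP => fx.
have := fu y; rewrite fx /= leye_eq => /eqP fyE.
by rewrite fyE in fy.
Qed.

Lemma dotv_continuous_sqr (a z : 'cV[K]_n) : forall e : K, 0 < e ->
  \forall y \near z, `|dotv (y - a) (y - a) - dotv (z - a) (z - a)| < e.
Proof.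
move=> e e0.
pose C : K := n%:R * (1 + 2 * `|z - a|) + 1.
have C0 : 0 < C by rewrite ltr_wpDl // mulr_ge0 // addr_ge0 // mulr_ge0.
near=> y.
have y1 : `|y - z| < 1.
  rewrite distrC; near: y; have /cvgrPdist_lt := @cvg_id _ (nbhs z); exact.
have ye : `|y - z| < e / C.
  rewrite distrC; near: y; have /cvgrPdist_lt := @cvg_id _ (nbhs z); apply.
  exact: divr_gt0.
have -> : dotv (y - a) (y - a) - dotv (z - a) (z - a) =
    dotv (y - z) ((y - z) + 2 *: (z - a)).
  have -> : y - a = (y - z) + (z - a) by rewrite subrKA.
  rewrite !(dotvDl (y - z)) !(dotvDr _ (y - z)) dotvZr (dotvC (z - a) (y - z)).
  by ring.
apply: le_lt_trans (norm_dotv _ _) _.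
have h : `|(y - z) + 2 *: (z - a)| <= 1 + 2 * `|z - a|.
  by rewrite (le_trans (ler_normD _ _)) // normrZ ger0_norm // lerD2r ltW.
have h1 : n%:R * `|y - z| * `|(y - z) + 2 *: (z - a)| <= C * `|y - z|.
  rewrite mulrAC ler_wpM2r // /C.
  by have := ler_wpM2l (ler0n K n) h; lra.
by apply: le_lt_trans h1 _; rewrite mulrC -ltr_pdivlMr.
Unshelve. all: by end_near. Qed.

(** One subgradient gives an affine minorant of f, so the quadratic term dominates far from a:
    outside a large ball the objective exceeds its value at x0, and inside it a minimum exists by
    compactness. *)
Lemma argmin_prox (g : K) f a x0 u0 : 0 < g -> Gamma0 f -> subdiff f x0 u0 ->
  argmin (fun z => ((2^-1 * enorm (z - a)%R ^+ 2)%:E + g%:E * f z)%E) !=set0.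
Proof.
move=> g0 [fp _ lsc] fu.
have := subdiff_fin fp fu; rewrite fin_numElt => /andP[]; case fx0 : (f x0) => [c0| |] // _ _.
set h := fun z => _.
have q_ge z : 2^-1 * `|z - a| ^+ 2 <= 2^-1 * enorm (z - a) ^+ 2.
  by rewrite ler_pM2l ?invr_gt0 // enorm_sqr norm_sqr_le_dotv.
pose al : K := g * (n%:R * `|u0|).
pose be : K := al * `|a - x0| + 2^-1 * enorm (x0 - a) ^+ 2.
have al0 : 0 <= al by rewrite !mulr_ge0 // ltW.
have be0 : 0 <= be by rewrite addr_ge0 // mulr_ge0 // ?sqr_ge0 // invr_ge0.
(* For rho > r one has rho >= 1 and rho - 2 al >= 2 be + 1, hence rho^2 / 2 - al rho >= be; the last
   summand puts x0 in the ball. *)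
pose r : K := 2 * al + 2 * be + 1 + `|x0 - a|.
have [|||z Bz zmin] := @lsc_min K _ [set y : 'cV[K]_n | `|y - a| <= r] h.
- exact: compact_cball.
- by exists x0 => /=; rewrite /r lerDr addr_ge0 // addr_ge0 // mulr_ge0.
- move=> z b _ bz.
  (* Semicontinuity of f applies to real levels only, so f z, possibly +oo, is replaced by a real r'
     below it that still keeps the objective above b. *)
  have [r' r'z br'] : exists2 r' : K, (r'%:E < f z)%E & b < 2^-1 * enorm (z - a) ^+ 2 + g * r'.
    have := fp.1 z; move: bz; rewrite /h; case: (f z) => [c| |] // bz _.
      move: bz; rewrite -EFinM -EFinD lte_fin => bz.
      pose e : K := 2^-1 * enorm (z - a) ^+ 2 + g * c - b.
      have e0 : 0 < e by rewrite subr_gt0.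
      exists (c - e / (2 * g)); first by rewrite lte_fin ltrBlDr ltrDl divr_gt0 // mulr_gt0.
      rewrite mulrBr; have -> : g * (e / (2 * g)) = e / 2 by field; rewrite gt_eqF.
      by rewrite /e; rewrite /e in e0; lra.
    exists ((b - 2^-1 * enorm (z - a) ^+ 2 + 1) / g); first exact: ltry.
    rewrite [g * _]mulrC divfK ?gt_eqF //; lra.
  have [V zV Vf] := lsc _ _ r'z.
  have e0 : 0 < 2^-1 * enorm (z - a) ^+ 2 + g * r' - b by rewrite subr_gt0.
  near=> y => _.
  have fy : (r'%:E < f y)%E by apply: Vf; near: y.
  have qy : `|dotv (y - a) (y - a) - dotv (z - a) (z - a)| <
            2 * (2^-1 * enorm (z - a) ^+ 2 + g * r' - b).
    by near: y; apply: dotv_continuous_sqr; rewrite mulr_gt0.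
  move: qy; rewrite ltr_norml => /andP[qy _].
  have hh : ((2^-1 * enorm (y - a) ^+ 2 + g * r')%:E <= h y)%E.
    by rewrite /h EFinD (EFinM g) leeD2l // lee_wpmul2l ?lee_fin ?ltW.
  by apply: lt_le_trans hh; rewrite lte_fin; move: qy; rewrite !enorm_sqr; lra.
exists z => w; have [wr|rw] := leP `|w - a| r; first exact: zmin.
apply: (@le_trans _ _ (h x0)).
  by apply: zmin; rewrite /= /r lerDr addr_ge0 // addr_ge0 // mulr_ge0.
have fw : ((c0 + dotv u0 (w - x0))%:E <= f w)%E by have := fu w; rewrite fx0.
have : ((2^-1 * enorm (w - a) ^+ 2 + g * (c0 + dotv u0 (w - x0)))%:E <= h w)%E.
  by rewrite /h EFinD (EFinM g) leeD2l // lee_pmul2l.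
apply: le_trans; rewrite /h fx0 -EFinM -EFinD lee_fin.
have dw : - (n%:R * `|u0| * (`|w - a| + `|a - x0|)) <= dotv u0 (w - x0).
  have := norm_dotv u0 (w - x0); rewrite ler_norml => /andP[+ _]; apply: le_trans.
  rewrite lerN2 ler_wpM2l ?mulr_ge0 //.
  by rewrite -[w - x0](subrKA a) ler_normD.
have dw' : - (al * (`|w - a| + `|a - x0|)) <= g * dotv u0 (w - x0).
  by have := ler_wpM2l (ltW g0) dw; rewrite mulrN /al mulrA.
have := q_ge w; move: rw; rewrite /r; set rho := `|w - a| in dw' * => rw hq.
suff : be <= 2^-1 * rho ^+ 2 - al * rho by rewrite /be; lra.
have xa : 0 <= `|x0 - a| by [].
have r1 : 1 <= rho by lra.
have r2 : 2 * be + 1 <= rho - 2 * al by lra.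
have : 1 * (2 * be + 1) <= rho * (rho - 2 * al) by apply: ler_pM => //; lra.
lra.
Unshelve. all: by end_near. Qed.

(** Compare p with t y + (1 - t) p: convexity of f and division by t give the subgradient inequality
    up to a term t D / 2, with t arbitrarily small. *)
Lemma prox_subdiff (g : K) f a x0 u0 : 0 < g -> Gamma0 f -> subdiff f x0 u0 ->
  subdiff f (prox g f a) (g^-1 *: (a - prox g f a)).
Proof.
move=> g0 Gf fu; have [fp conv _] := Gf.
have : argmin (fun z => ((2^-1 * enorm (z - a)%R ^+ 2)%:E + g%:E * f z)%E) (prox g f a).
  by apply: getPex; exact: argmin_prox g0 Gf fu.
set p := prox g f a => pmin y.
have := subdiff_fin fp fu; rewrite fin_numElt => /andP[]; case fx0 : (f x0) => [c0| |] // _ _.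
have [c pc] : exists c, f p = c%:E.
  have := pmin x0; have := fp.1 p; rewrite fx0 /=; case: (f p) => [c| |] // _; first by exists c.
  by rewrite mulry gtr0_sg // mul1e.
rewrite pc; have := fp.1 y; case fy : (f y) => [r| |] // _; last by rewrite leey.
rewrite -EFinD lee_fin dotvZl.
set D := dotv (y - p) (y - p); have D0 : 0 <= D by exact: dotvv_ge0.
have key (t : K) : 0 < t < 1 -> dotv (a - p) (y - p) + g * c <= g * r + t * (D / 2).
  move=> t01; have := conv y p t t01; rewrite pc fy -!EFinM -EFinD.
  set z := t *: y + (1 - t) *: p => fz.
  have := pmin z; rewrite pc -!EFinM -!EFinD => /le_trans h.
  have {}h := h _ (leeD2l _ (lee_wpmul2l (_ : (0 <= g%:E)%E) fz)).
  have g0' : (0%:E <= g%:E)%E by rewrite lee_fin ltW.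
  have := h g0'.
  rewrite -EFinM -EFinD lee_fin !enorm_sqr.
  have -> : z - a = t *: (y - p) - (a - p).
    by rewrite /z; apply/matrixP => i j; rewrite !mxE; ring.
  rewrite -[dotv (p - a) _](_ : dotv (a - p) (a - p) = _); last first.
    by rewrite -[p - a]opprB dotvNl dotvNr opprK.
  rewrite (dotvBl (t *: _)) !(dotvBr _ (t *: _)) !dotvZl !dotvZr -/D (dotvC (y - p) (a - p)).
  case/andP: t01 => t0 t1 hh.
  rewrite -(ler_pM2l t0); lra.
rewrite -(ler_pM2l g0) mulrDr mulrA mulfV ?gt_eqF // mul1r addrC leNgt; apply/negP => lt.
set del := dotv (a - p) (y - p) + g * c - g * r.
have del0 : 0 < del by rewrite subr_gt0.
(* If the inequality failed by del > 0, this t would give t D / 2 < del, against [key]. *)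
pose t := Num.min 2^-1 (del / (D + 1)).
have D1 : 0 < D + 1 by rewrite ltr_wpDl.
have t0 : 0 < t by rewrite lt_min invr_gt0 ltr0n divr_gt0.
have t1 : t < 1 by rewrite gt_min invf_lt1 ?ltr1n.
have tD : t * (D + 1) <= del by rewrite -ler_pdivlMr // ge_min lexx orbT.
have := key t; rewrite t0 t1 => /(_ isT).
have tD0 : 0 <= t * D by rewrite mulr_ge0 // ltW.
move: tD; rewrite /del; lra.
Qed.

End Prox.

(** * Lagrange multiplier rule by quadratic penalisation *)

Section Multiplier.
Context {K : realType}.

Lemma fermat n (f : 'cV[K]_n -> K) g x :
  sdiff f (dotv g) x -> (exists2 r : K, 0 < r & forall y, `|y - x| < r -> f x <= f y) ->
  g = 0.
Proof.
move=> fg [r r0 fmin]; apply/eqP; rewrite -normr_eq0 eq_le normr_ge0 andbT leNgt.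
apply/negP => ng; have e0 : 0 < `|g| / 2 by rewrite divr_gt0.
have [d d0 fd] := sdiff_at fg e0.
pose t : K := Num.min r d / (2 * `|g|).
have m0 : 0 < Num.min r d by rewrite lt_min r0.
have t0 : 0 < t by rewrite divr_gt0 // mulr_gt0.
have : `|t *: - g| < Num.min r d.
  rewrite normrZ normrN gtr0_norm //.
  have -> : t * `|g| = Num.min r d / 2 by rewrite /t; field; rewrite gt_eqF.
  lra.
clearbody t; rewrite lt_min => /andP[tr td].
have := fd _ td; rewrite dotvZr dotvNr normrZ normrN (gtr0_norm t0) ler_norml => /andP[_ h1].
have h2 : f x <= f (x + t *: - g) by apply: fmin; rewrite addrAC subrr add0r.
have : t * dotv g g <= t * (`|g| ^+ 2 / 2) by lra.
rewrite ler_pM2l //; have := norm_sqr_le_dotv g.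
have : 0 < `|g| ^+ 2 by rewrite exprn_gt0.
lra.
Qed.

Lemma sdiff_dotvv n (x : 'cV[K]_n) :
  sdiff (fun y : 'cV[K]_n => dotv y y) (dotv (2 *: x)) x.
Proof.
move=> e e0; have P0 : 0 < 2 * (n%:R + 1) :> K by rewrite mulr_gt0 // ltr_wpDl.
exists (e / (2 * (n%:R + 1))) => [|y z yd zd]; first by rewrite divr_gt0.
have -> : dotv y y - dotv z z - dotv (2 *: x) (y - z) =
    dotv ((y - x) + (z - x)) (y - z).
  rewrite !dotvDl !dotvNl dotvZl !(dotvBr _ y z) (dotvC z y); ring.
apply: (le_trans (norm_dotv _ _)); rewrite ler_wpM2r //.
have h : `|y - x + (z - x)| <= 2 * (e / (2 * (n%:R + 1))).
  by have := ler_normD (y - x) (z - x); lra.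
apply: le_trans (ler_wpM2l (ler0n K n) h) _.
have -> : n%:R * (2 * (e / (2 * (n%:R + 1)))) = e * (n%:R / (n%:R + 1)) :> K.
  by field; rewrite gt_eqF // ltr_wpDl.
rewrite ler_piMr ?ltW // ltr_pdivrMr ?ltr_wpDl // mul1r ltrDl //.
Qed.

Lemma sdiff_normsq m n (f : 'cV[K]_n -> 'cV[K]_m) (A : 'M[K]_(m, n)) x :
  sdiff f (mulmx A) x ->
  sdiff (fun y => dotv (f y) (f y)) (dotv (2 *: (A^T *m f x))) x.
Proof.
move=> fA; apply: (@sdiff_eqD _ _ _ _ (dotv (2 *: f x) \o mulmx A)).
  by move=> h /=; rewrite dotv_mulmx scalemxAr.
exact: (@sdiff_comp _ _ _ _ f (fun y => dotv y y) _ _ _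
  (blin_mulmx A) (blin_dotv _) fA (sdiff_dotvv _)).
Qed.

(** Solve J0 J0^T l = J0 J^T l - J0 (J - J0)^T l. For J close to J0 the last term contributes at
    most |l| / 2 and is absorbed, so a multiplier is controlled by the normal vector it represents,
    uniformly in J. *)
Lemma multiplier_bound p n (J0 : 'M[K]_(p, n)) : J0 *m J0^T \in unitmx ->
  exists2 C : K, 0 < C & exists2 d : K, 0 < d & forall (J : 'M[K]_(p, n)) (l : 'cV[K]_p),
    `|J - J0| < d -> `|l| <= C * `|J0 *m (J^T *m l)|.
Proof.
move=> unitJ; have [C C0 HC] := norm_mulmx_bound (invmx (J0 *m J0^T)).
have [D D0 HD] := norm_mulmx_bound J0.
have p1 : 0 < p%:R + 1 :> K by rewrite ltr_wpDl.
have P0 : 0 < 2 * C * D * (p%:R + 1) by rewrite !mulr_gt0.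
exists (2 * C); first by rewrite mulr_gt0.
exists (2 * C * D * (p%:R + 1))^-1; first by rewrite invr_gt0.
move=> J l Jd.
have lE : l = invmx (J0 *m J0^T) *m (J0 *m (J^T *m l) - J0 *m ((J - J0)^T *m l)).
  rewrite -mulmxBr -mulmxBl linearB /= opprB addrC subrK.
  by rewrite (mulmxA J0) mulKmx.
have hl := HC _ (J0 *m (J^T *m l) - J0 *m ((J - J0)^T *m l)); rewrite -lE in hl.
have h1 := ler_normB (J0 *m (J^T *m l)) (J0 *m ((J - J0)^T *m l)).
have h2 := HD _ ((J - J0)^T *m l).
have h3 := norm_mulmx ((J - J0)^T) l; rewrite norm_trmx in h3.
have h4 : C * (D * (p%:R * `|J - J0| * `|l|)) <= `|l| / 2.
  have : (2 * C * D * (p%:R + 1)) * `|J - J0| <= 1.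
    by rewrite mulrC -ler_pdivlMr // div1r ltW.
  have a1 : 0 <= C * D * `|J - J0| by rewrite !mulr_ge0 // ltW.
  move=> a2; have a3 : 2 * (C * D * p%:R * `|J - J0|) <= 1 by lra.
  by have := ler_wpM2r (normr_ge0 l) a3; lra.
have h5 := ler_wpM2l (ltW D0) h3; have h6 : C * `|J0 *m ((J - J0)^T *m l)| <= `|l| / 2.
  by apply: le_trans h4; rewrite ler_pM2l // (le_trans h2).
have h7 := ler_wpM2l (ltW C0) h1.
lra.
Qed.

Lemma sdiff_near_lt (V : normedModType K) (f : V -> K) D (x : V) (a : K) :
  blin D -> sdiff f D x -> a < f x -> \forall y \near x, a < f y.
Proof.
move=> bD fD ax; have e0 : 0 < f x - a by rewrite subr_gt0.
have [d d0 fd] := sdiff_cont bD fD e0.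
apply/nbhs_ballP; exists d => //= y; rewrite -ball_normE /= distrC => /fd.
by rewrite ltr_norml => /andP[+ _]; lra.
Qed.

Section Penalty.
Context {n p : nat} (F : 'cV[K]_n -> K) (gF : 'cV[K]_n -> 'cV[K]_n).
Context (ph : 'cV[K]_n -> 'cV[K]_p) (J : 'cV[K]_n -> 'M[K]_(p, n)).
Context (x : 'cV[K]_n) (r : K).
Hypothesis FD : forall y, `|y - x| < r -> sdiff F (dotv (gF y)) y.
Hypothesis phD : forall y, `|y - x| < r -> sdiff ph (mulmx (J y)) y.
Hypothesis phx : ph x = 0.
Hypothesis Fmin : forall y, `|y - x| < r -> ph y = 0 -> F x <= F y.

(** The term |y - x|^2 makes x a strict minimiser on the zero set of [ph], so even feasible points
    of a small sphere around x have a penalised value above F x. *)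
Let Phi (k : nat) y := F y + (dotv (y - x) (y - x) + k%:R * dotv (ph y) (ph y)).

Let PhiD k y : `|y - x| < r ->
  sdiff (Phi k) (dotv (gF y + (2 *: (y - x) + k%:R *: (2 *: ((J y)^T *m ph y))))) y.
Proof.
move=> yr.
have D2 := sdiff_normsq (sdiff_subr x y); have D3 := sdiff_normsq (phD yr).
have D4 : sdiff (fun y => k%:R * dotv (ph y) (ph y))
    (dotv (k%:R *: (2 *: ((J y)^T *m ph y)))) y.
  apply: (@sdiff_eqD _ _ _ _ (( *:%R k%:R : K -> K) \o dotv (2 *: ((J y)^T *m ph y)))).
    by move=> h /=; rewrite [RHS]dotvZl.
  have bk : blin ( *:%R k%:R : K -> K).
    split; [by move=> ? ?; rewrite scalerDr|by move=> a b; rewrite !scalerA mulrC|].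
    by exists (`|k%:R| + 1) => [|z]; rewrite ?ltr_wpDl // normrM ler_wpM2r // lerDl.
  by apply: sdiff_comp D3 _; [exact: blin_dotv| exact: bk|exact: sdiff_lin].
apply: (@sdiff_eqD _ _ _ _ (fun h => dotv (gF y) h + (dotv (2 *: ((1%:M)^T *m (y - x))) h +
    dotv (k%:R *: (2 *: ((J y)^T *m ph y))) h))).
  by move=> h; rewrite !(dotvDl _ _ h) trmx1 mul1mx.
by apply: sdiffD; [exact: FD|exact: sdiffD].
Qed.

(** A single k pushes the whole sphere of radius rho above F x, by compactness and monotonicity in
    k. A minimiser over the closed ball has value at most F x, so it is interior and critical. *)
Lemma penalty_critical (rho : K) : 0 < rho < r ->
  exists k q, `|q - x| < rho /\
    gF q + (2 *: (q - x) + k%:R *: (2 *: ((J q)^T *m ph q))) = 0 :> 'cV[K]_n.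
Proof.
move=> /andP[rho0 rhor].
have Phix k : Phi k x = F x.
  by rewrite /Phi subrr phx !dotv0r mulr0 !addr0.
have inr y : `|y - x| <= rho -> `|y - x| < r by move/le_lt_trans; apply.
have [|||k Uk] := @compact_increasing_cover _ [set y | `|y - x| <= rho]
    (fun k => [set y | `|y - x| < rho \/ F x < Phi k y]).
- exact: compact_cball.
- move=> i j ij y /= [|h]; [by left|right]; apply: lt_le_trans h _.
  by rewrite /Phi !lerD2l ler_wpM2r ?dotvv_ge0 // ler_nat.
- move=> y /= yrho; have yr := inr _ yrho.
  have [ylt|yge] := ltP `|y - x| rho.
    exists 0%N; have e0 : 0 < rho - `|y - x| by rewrite subr_gt0.
    apply/nbhs_ballP; exists (rho - `|y - x|) => //= z.
    rewrite -ball_normE /= distrC => zy _; left.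
    by have := ler_normD (z - y) (y - x); rewrite subrKA; lra.
  have [k hk] : exists k, F x < Phi k y.
    have d2 : 0 < dotv (y - x) (y - x).
      by apply: lt_le_trans (norm_sqr_le_dotv _); rewrite exprn_gt0 // (lt_le_trans rho0).
    have [phy|phy] := eqVneq (ph y) 0.
      by exists 0%N; rewrite /Phi mul0r addr0; have := Fmin yr phy; lra.
    have s0 : 0 < dotv (ph y) (ph y) by rewrite lt_neqAle eq_sym dotvv_eq0 phy dotvv_ge0.
    (* Large enough for k |ph y|^2 to exceed F x - F y at this infeasible point. *)
    exists (Num.truncn (`|F x - F y| / dotv (ph y) (ph y))).+1; rewrite /Phi.
    have : `|F x - F y| < (Num.truncn (`|F x - F y| / dotv (ph y) (ph y))).+1%:R *
        dotv (ph y) (ph y).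
      by rewrite -ltr_pdivrMr // truncnS_gt.
    have := ler_norm (F x - F y); lra.
  exists k; have := sdiff_near_lt (blin_dotv _) (PhiD k yr) hk.
  by apply: filterS => z hz _; right.
have [|||q qrho qmin] := @lsc_min K _ [set y | `|y - x| <= rho] (fun y => (Phi k y)%:E).
- exact: compact_cball.
- by exists x; rewrite /= subrr normr0 ltW.
- move=> y a /= yrho; rewrite lte_fin => ay.
  have := sdiff_near_lt (blin_dotv _) (PhiD k (inr _ yrho)) ay.
  by apply: filterS => z az _; rewrite lte_fin.
have qlt : `|q - x| < rho.
  case: (Uk q qrho) => // qx; have := qmin x; rewrite /= subrr normr0 ltW // lee_fin Phix.
  by move=> /(_ isT); rewrite leNgt qx.
exists k, q; split => //; apply: fermat (PhiD k (inr _ qrho)) _.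
exists (rho - `|q - x|) => [|y yq]; first by rewrite subr_gt0.
rewrite -lee_fin; apply: qmin => /=.
by have := ler_normD (y - q) (q - x); rewrite subrKA; lra.
Qed.

(** No limit is extracted. P kills the range of (J x)^T; if P (gF x) were nonzero, one critical
    point q close enough to x would contradict it, since there the perturbed gradient w equals (J
    q)^T l and so P w = P (J q - J x)^T l is small. *)
Lemma multiplier_rule : 0 < r ->
  (forall e : K, 0 < e -> exists2 d : K, 0 < d & forall y, `|y - x| < d -> `|gF y - gF x| < e) ->
  (forall e : K, 0 < e -> exists2 d : K, 0 < d & forall y, `|y - x| < d -> `|J y - J x| < e) ->
  J x *m (J x)^T \in unitmx -> exists mu, gF x = (J x)^T *m mu.
Proof.
move=> r0 gFc Jc unitJ.
pose B := invmx (J x *m (J x)^T) *m J x.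
pose P := 1%:M - (J x)^T *m B.
suff : P *m gF x = 0.
  rewrite mulmxBl mul1mx => /eqP; rewrite subr_eq0 => /eqP PE.
  by exists (B *m gF x); rewrite mulmxA.
have PJ : P *m (J x)^T = 0.
  by rewrite mulmxBl mul1mx -!mulmxA mulVmx // mulmx1 subrr.
clearbody P.
apply/eqP; rewrite -normr_eq0 eq_le normr_ge0 andbT leNgt; apply/negP => q0.
have [CP CP0 HP] := norm_mulmx_bound P; have [D D0 HD] := norm_mulmx_bound (J x).
have [C C0 [d0 d00 Hl]] := multiplier_bound unitJ.
pose G : K := `|gF x| + 3; have G0 : 0 < G by rewrite ltr_wpDl.
pose S : K := CP * 3 + CP * (p%:R * (C * (D * G))).
have S0 : 0 < S by rewrite ltr_pwDl ?mulr_gt0 // !mulr_ge0 // ltW.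
pose e : K := Num.min 1 (`|P *m gF x| / (2 * S)).
have e0 : 0 < e by rewrite lt_min ltr01 divr_gt0 // mulr_gt0.
have e1 : e <= 1 by rewrite ge_min lexx.
have eS : e * S < `|P *m gF x|.
  have : e * (2 * S) <= `|P *m gF x|.
    by rewrite -ler_pdivlMr ?mulr_gt0 // ge_min lexx orbT.
  have : 0 < e * S by rewrite mulr_gt0.
  lra.
clearbody e.
have [d1 d10 H1] := gFc _ e0.
have e20 : 0 < Num.min e d0 by rewrite lt_min e0.
have [d2 d20 H2] := Jc _ e20.
pose rho : K := Num.min (Num.min d1 d2) (Num.min e (r / 2)).
have rho0 : 0 < rho by rewrite !lt_min d10 d20 e0 divr_gt0.
have [|k [q [qrho crit]]] := @penalty_critical rho.
  by rewrite rho0 /=; apply: (@le_lt_trans _ _ (r / 2)); [rewrite !ge_min lexx !orbT|lra].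
move: qrho; rewrite !lt_min => /andP[/andP[q1 q2] /andP[qe _]].
have {}H1 := H1 _ q1; have := H2 _ q2; rewrite lt_min => /andP[Je Jd].
pose w := gF q + 2 *: (q - x); pose l := - (k%:R *: (2 *: ph q)) : 'cV[K]_p.
have wl : w = (J q)^T *m l.
  move/eqP: crit; rewrite addrA addr_eq0 => /eqP.
  by rewrite /w => ->; rewrite mulmxN -!scalemxAr.
have wx : `|w - gF x| <= 3 * e.
  rewrite /w addrAC (le_trans (ler_normD _ _)) // normrZ ger0_norm //.
  lra.
have wG : `|w| <= G.
  by have := ler_normD (w - gF x) (gF x); rewrite subrK /G; lra.
(* l contains the uncontrolled factor k, so it is bounded through the vector w = (J q)^T l that it
   represents. *)
have lG : `|l| <= C * (D * G).
  apply: le_trans (Hl _ l Jd) _; rewrite -wl ler_pM2l //.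
  by apply: le_trans (HD _ _) _; rewrite ler_pM2l.
have Pw : P *m w = P *m ((J q - J x)^T *m l).
  have JE : (J q)^T = (J x)^T + (J q - J x)^T by rewrite -linearD /= subrKC.
  by rewrite wl {1}JE mulmxDl mulmxDr (mulmxA P (J x)^T) PJ mul0mx add0r.
have nPw : `|P *m w| <= CP * (p%:R * (C * (D * G))) * e.
  rewrite Pw (le_trans (HP _ _)) // -mulrA ler_pM2l //.
  apply: (le_trans (norm_mulmx _ _)); rewrite norm_trmx -mulrA -mulrA ler_wpM2l //.
  by rewrite mulrC ler_pM // ltW.
have : `|P *m gF x| <= e * S.
  have -> : P *m gF x = P *m w - P *m (w - gF x) by rewrite -mulmxBr subKr.
  apply: (le_trans (ler_normB _ _)).
  have := HP _ (w - gF x); have := ler_wpM2l (ltW CP0) wx; rewrite /S; lra.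
by rewrite leNgt eS.
Qed.

End Penalty.

End Multiplier.

Section Surjective.
Context {K : realType}.

Lemma blin_surj n (D : 'cV[K]_n -> 'cV[K]_n) c : blin D -> 0 < c ->
  (forall h, c * `|h| <= `|D h|) -> forall b, exists d, D d = b.
Proof.
move=> bD c0 Dc b; have [DD DZ _] := bD.
pose A : 'M[K]_n := \matrix_(i, j) D (delta_mx j 0) i 0.
have DA h : D h = A *m h.
  have DS (s : seq 'I_n) : D (\sum_(j <- s) h j 0 *: delta_mx j 0) =
      \sum_(j <- s) h j 0 *: D (delta_mx j 0).
    by elim: s => [|j s IH]; rewrite ?big_nil ?(blin0 bD) // !big_cons DD DZ IH.
  have {1}-> : h = \sum_j h j 0 *: delta_mx j 0.
    by rewrite {1}[h]matrix_sum_delta; apply: eq_bigr => i _; rewrite big_ord1.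
  rewrite DS; apply/matrixP => i k; rewrite summxE mxE; apply: eq_bigr => j _.
  by rewrite !mxE [k]ord1 mulrC.
have uA : A \in unitmx.
  apply: unitmx_ker => h Ah; have := Dc h; rewrite DA Ah normr0.
  by rewrite pmulr_rle0 // normr_le0 => /eqP.
by exists (invmx A *m b); rewrite DA mulKVmx.
Qed.

Lemma derive_eps (V : normedModType K) (f : K -> V) (s : K) (l : V) :
  is_derive (s : K^o) 1 f l -> forall e : K, 0 < e -> exists2 d : K, 0 < d &
    forall h : K, `|h| < d -> `|f (s + h) - f s - h *: l| <= e * `|h|.
Proof.
move=> [fd fl] e e0; move: fd; rewrite /derivable => /cvg_ex[/= l' cl'].
have ll' : l' = l by rewrite -fl; apply/esym; exact: cvg_lim cl'.
rewrite {}ll' in cl'; have /cvgrPdist_le /(_ e e0) := cl'.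
rewrite near_withinE => /nbhs_ballP[d /= d0 hd]; exists d => // h hh.
have [->|h0] := eqVneq h 0.
  by rewrite addr0 subrr scale0r subr0 normr0 normr0 mulr0.
have := hd h; rewrite -ball_normE /= sub0r normrN => /(_ hh h0).
rewrite [h *: 1]mulr1 [h + s]addrC distrC => fh.
have -> : f (s + h) - f s - h *: l = h *: (h^-1 *: (f (s + h) - f s) - l).
  by rewrite scalerBr scalerA divff // scale1r.
by rewrite normrZ mulrC ler_wpM2r.
Qed.

End Surjective.

(** * Nearest points and tangent space of a C^2 submanifold *)

Section Manifold.
Context {K : realType} {n p : nat}.
Context (M : set 'cV[K]_n) (ph : 'cV[K]_n -> 'cV[K]_p) (J : 'cV[K]_n -> 'M[K]_(p, n)).
Context (H : 'I_p -> 'cV[K]_n -> 'M[K]_n) (x : 'cV[K]_n) (r : K).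

(* Around x, M is the zero set of ph, J is the Jacobian of ph and H i y the
   Hessian at y of the i-th component of ph. *)
Record local_equations : Prop := LocalEquations {
  le_r0 : 0 < r;
  le_M : forall y, `|y - x| < r -> (M y <-> ph y = 0);
  le_ph : forall y, `|y - x| < r -> sdiff ph (mulmx (J y)) y;
  le_J : forall i y, `|y - x| < r -> sdiff (fun z => (row i (J z))^T) (mulmx (H i y)) y;
  le_free : row_free (J x);
  le_x : M x }.

Hypothesis LE : local_equations.
Let r0 : 0 < r := le_r0 LE.

Lemma trJ_mul y (l : 'cV[K]_p) : (J y)^T *m l = \sum_i l i 0 *: (row i (J y))^T.
Proof.
apply/matrixP => i j; rewrite mxE summxE; apply: eq_bigr => k _.
by rewrite !mxE [j]ord1 mulrC.
Qed.

Let x_near : `|x - x| < r. Proof. by rewrite subrr normr0. Qed.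

Lemma ph_base : ph x = 0.
Proof. exact: (le_M LE x_near).1 (le_x LE). Qed.

Lemma J_lip y : `|y - x| < r -> exists2 C : K, 0 < C & exists2 d : K, 0 < d &
  forall z, `|z - y| < d -> `|J z - J y| <= C * `|z - y|.
Proof.
move=> yr.
have lip i : exists2 C : K, 0 < C & exists2 d : K, 0 < d &
    forall z, `|z - y| < d -> `|(row i (J z))^T - (row i (J y))^T| <= C * `|z - y|.
  have [C C0 [d d0 h]] := sdiff_lip (blin_mulmx _) (le_J LE i yr).
  by exists C => //; exists d => // z zd; apply: h; rewrite // subrr normr0.
(* One parameter d encodes both the radius d and the Lipschitz constant d^-1, so that a single call
   makes both uniform over the rows. *)
have [|i|d d0 hd] := @fin_radius K p (fun i d => forall C, 0 < C -> C < d ->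
    forall z, `|z - y| < C -> `|(row i (J z))^T - (row i (J y))^T| <= d^-1 * `|z - y|).
- move=> i d d' h d'0 dd' C C0 Cd' z zC.
  apply: le_trans (h C C0 (lt_le_trans Cd' dd') z zC) _.
  by rewrite ler_wpM2r // lef_pV2 // posrE // (lt_le_trans d'0).
- have [C C0 [d d0 h]] := lip i; exists (Num.min d C^-1).
    by rewrite lt_min d0 invr_gt0.
  move=> C' C'0; rewrite lt_min => /andP[Cd _] z zC.
  apply: le_trans (h z (lt_trans zC Cd)) _; rewrite ler_wpM2r //.
  rewrite -[leLHS]invrK lef_pV2 ?posrE ?lt_min ?d0 ?invr_gt0 //.
  by rewrite ge_min lexx orbT.
exists d^-1; first by rewrite invr_gt0.
exists (d / 2) => [|z zd]; first by rewrite divr_gt0.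
apply: norm_le_entries => [|i j]; first by rewrite mulr_ge0 // invr_ge0 ltW.
have d2 : 0 < d / 2 by rewrite divr_gt0.
have dd : d / 2 < d by lra.
apply: le_trans (hd i (d / 2) d2 dd z zd).
by apply: le_trans (entry_le_norm _ j 0); rewrite !mxE.
Qed.

Lemma J_cont y : `|y - x| < r -> forall e : K, 0 < e -> exists2 d : K, 0 < d &
  forall z, `|z - y| < d -> `|J z - J y| < e.
Proof.
move=> /J_lip[C C0 [d d0 h]] e e0.
exists (Num.min d (e / C)); first by rewrite lt_min d0 divr_gt0.
move=> z; rewrite lt_min ltr_pdivlMr // => /andP[zd ze].
by apply: le_lt_trans (h z zd) _; rewrite mulrC.
Qed.

Lemma multiplier_bound_near : exists2 C : K, 0 < C & exists2 d : K, 0 < d &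
  forall y (l : 'cV[K]_p), `|y - x| < d -> `|l| <= C * `|J x *m ((J y)^T *m l)|.
Proof.
have [C C0 [d d0 h]] := multiplier_bound (gram_unitmx (le_free LE)).
have [d' d'0 h'] := J_cont x_near d0.
by exists C => //; exists d' => // y l /h'; exact: h.
Qed.

Lemma gram_near : exists2 d : K, 0 < d & forall y, `|y - x| < d ->
  J y *m (J y)^T \in unitmx.
Proof.
have [C C0 [d d0 h]] := multiplier_bound_near; exists d => // y yd.
apply: unitmx_ker => l; rewrite -mulmxA => Jl.
have /eqP : dotv ((J y)^T *m l) ((J y)^T *m l) = 0.
  by rewrite dotv_mulmx trmxK Jl dotv0l.
rewrite dotvv_eq0 => /eqP Jl0; have := h y l yd.
by rewrite Jl0 mulmx0 normr0 mulr0 normr_le0 => /eqP.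
Qed.

(** The same radius d serves every base point y of M near x, because surjectivity of the Jacobian
    persists there ([gram_near]); the objective is constrained only near y. *)
Lemma manifold_multiplier : exists2 d : K, 0 < d & forall y F gF,
  `|y - x| < d -> M y ->
  (exists2 s : K, 0 < s & forall z, `|z - y| < s -> sdiff F (dotv (gF z)) z) ->
  (forall e : K, 0 < e -> exists2 d : K, 0 < d &
     forall z, `|z - y| < d -> `|gF z - gF y| < e) ->
  (exists2 s : K, 0 < s & forall z, `|z - y| < s -> M z -> F y <= F z) ->
  exists mu, gF y = (J y)^T *m mu.
Proof.
have [d d0 unitJ] := gram_near.
exists (Num.min d r) => [|y F gF]; first by rewrite lt_min d0.
rewrite lt_min => /andP[yd yr] My [s1 s10 FD] gFc [s2 s20 Fmin].
have ry : 0 < r - `|y - x| by rewrite subr_gt0.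
pose s := Num.min (Num.min s1 s2) (r - `|y - x|).
have inr z : `|z - y| < r - `|y - x| -> `|z - x| < r.
  by have := ler_normD (z - y) (y - x); rewrite subrKA; lra.
apply: (@multiplier_rule _ _ _ F gF ph J y s).
- by move=> z; rewrite !lt_min => /andP[/andP[zs _] _]; exact: FD.
- by move=> z; rewrite !lt_min => /andP[_ /inr zr]; exact: (le_ph LE).
- exact: (le_M LE yr).1.
- move=> z; rewrite !lt_min => /andP[/andP[_ zs] /inr zr] phz.
  by apply: Fmin => //; exact: (le_M LE zr).2.
- by rewrite !lt_min s10 s20.
- exact: gFc.
- exact: J_cont.
- exact: unitJ.
Qed.

(** The equations describe M only near x, while nearest points compete with all of M. A point q of M
    with |q - x| > r / 2 loses against x: (n + 1) |x - y| < r / 4 <= |q - y|, where n + 1 covers the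
    passage between the sup and Euclidean norms. *)
Lemma nearest_spec y : `|y - x| < r / (4 * (n%:R + 1)) ->
  M (nearest M y) /\
  forall q, M q -> dotv (y - nearest M y) (y - nearest M y) <= dotv (y - q) (y - q).
Proof.
move=> yr.
have n1 : 1 <= n%:R + 1 :> K by rewrite lerDr.
have n0 : 0 < n%:R + 1 :> K by rewrite ltr_wpDl.
suff /getPex : exists q0, M q0 /\ forall q, M q -> enorm (y - q0) <= enorm (y - q).
  by move=> [Mq qmin]; split=> // q /qmin; rewrite ler_enorm.
have r20 : 0 < r / 2 by rewrite divr_gt0.
have inr z : `|z - x| <= r / 2 -> `|z - x| < r by lra.
(* The value +oo off the zero set encodes the constraint; semicontinuity there holds because [ph]
   stays nonzero nearby. *)
pose f q : \bar K := if ph q == 0 then (dotv (q - y) (q - y))%:E else +oo%E.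
have [|||q0 /= q0r qmin] := @lsc_min K _ [set q | `|q - x| <= r / 2] f.
- exact: compact_cball.
- by exists x; rewrite /= subrr normr0 ltW.
- move=> q a /= /inr qr aq.
  have [phq|phq] := eqVneq (ph q) 0.
    move: aq; rewrite /f phq eqxx lte_fin => aq.
    have e0 : 0 < dotv (q - y) (q - y) - a by rewrite subr_gt0.
    apply: filterS (@dotv_continuous_sqr K n y q _ e0) => z.
    rewrite ltr_norml => /andP[zq _] _; case: ifP => _; last exact: ltry.
    by rewrite lte_fin; lra.
  have e0 : 0 < `|ph q| by rewrite normr_gt0.
  have [d d0 hd] := sdiff_cont (blin_mulmx _) (le_ph LE qr) e0.
  apply/nbhs_ballP; exists d => //= z; rewrite -ball_normE /= distrC => /hd.
  rewrite /f; case: eqP => [->|_ _ _]; last exact: ltry.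
  by rewrite sub0r normrN ltxx.
have xB : `|x - x| <= r / 2 by rewrite subrr normr0 ltW.
have phq0 : ph q0 = 0.
  by have := qmin x xB; rewrite /f ph_base eqxx; case: eqP.
exists q0; split; first exact: (le_M LE (inr _ q0r)).2.
have dE (u v : 'cV[K]_n) : dotv (u - v) (u - v) = dotv (v - u) (v - u).
  by rewrite -[u - v]opprB dotvNl dotvNr opprK.
move=> q Mq; rewrite ler_enorm (dE y) (dE y q).
have qle z : `|z - x| <= r / 2 -> ph z = 0 -> dotv (q0 - y) (q0 - y) <= dotv (z - y) (z - y).
  by move=> zr phz; have := qmin z zr; rewrite /f phq0 phz eqxx lee_fin.
have [qr|qr] := leP `|q - x| (r / 2).
  by apply: qle => //; exact: (le_M LE (inr _ qr)).1.
apply: le_trans (qle x xB ph_base) _.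
apply: le_trans (dotvv_le_norm _) _; apply: le_trans _ (norm_sqr_le_dotv _).
move: yr; rewrite ltr_pdivlMr ?mulr_gt0 // distrC => yr.
have h1 : (n%:R + 1) * `|x - y| <= r / 4 by lra.
have h2 : 1 * `|x - y| <= (n%:R + 1) * `|x - y| by rewrite ler_wpM2r.
have h3 : r / 4 <= `|q - y|.
  by have := ler_normD (q - y) (y - x); rewrite subrKA (distrC y x); lra.
apply: (@le_trans _ _ (((n%:R + 1) * `|x - y|) ^+ 2)).
  rewrite exprMn ler_wpM2r ?sqr_ge0 // expr2.
  by have := ler0n K n; nra.
by rewrite ler_sqr ?nnegrE ?mulr_ge0 ?(ltW n0) // (le_trans h1).
Qed.

Lemma nearest_close y : `|y - x| < r / (4 * (n%:R + 1)) ->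
  `|nearest M y - y| <= (n%:R + 1) * `|y - x|.
Proof.
move=> /nearest_spec[_ /(_ x (le_x LE)) h].
rewrite distrC -ler_sqr ?nnegrE ?mulr_ge0 ?addr_ge0 //.
apply: le_trans (norm_sqr_le_dotv _) _; apply: le_trans h _.
apply: le_trans (dotvv_le_norm _) _; rewrite exprMn ler_wpM2r ?sqr_ge0 // expr2.
by have := ler0n K n; nra.
Qed.

Lemma nearest_close_base y : `|y - x| < r / (4 * (n%:R + 1)) ->
  `|nearest M y - x| <= (n%:R + 2) * `|y - x|.
Proof.
move=> /nearest_close; have := ler_normD (nearest M y - y) (y - x).
by rewrite subrKA; lra.
Qed.

Lemma nearest_base : nearest M x = x.
Proof.
have n1 : 0 < 4 * (n%:R + 1) :> K by rewrite mulr_gt0 // ltr_wpDl.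
have xs : `|x - x| < r / (4 * (n%:R + 1)) by rewrite subrr normr0 divr_gt0.
apply/eqP; rewrite -subr_eq0 -normr_le0.
by have := nearest_close xs; rewrite subrr normr0 mulr0.
Qed.

(** First-order condition for the squared distance to y, minimised over M at the nearest point. The
    linear bound on mu makes the pair (nearest point, multiplier) continuous at y = x. *)
Lemma nearest_multiplier : exists2 C : K, 0 < C & exists2 d : K, 0 < d & forall y,
  `|y - x| < d -> [/\ M (nearest M y), `|nearest M y - x| < r,
    `|y - x| < r / (4 * (n%:R + 1)) &
    exists2 mu, y - nearest M y = (J (nearest M y))^T *m mu & `|mu| <= C * `|y - x|].
Proof.
have n1 : 0 < 4 * (n%:R + 1) :> K by rewrite mulr_gt0 // ltr_wpDl.
have n2 : 0 < n%:R + 2 :> K by rewrite ltr_wpDl.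
have [C C0 [d1 d10 h1]] := multiplier_bound_near.
have [d2 d20 h2] := manifold_multiplier.
have [D D0 hD] := norm_mulmx_bound (J x).
pose m := Num.min (Num.min d1 d2) r.
have m0 : 0 < m by rewrite !lt_min d10 d20.
exists (C * (D * (n%:R + 1))); first by rewrite !mulr_gt0 // ltr_wpDl.
exists (Num.min (r / (4 * (n%:R + 1))) (m / (n%:R + 2))).
  by rewrite lt_min !divr_gt0.
move=> y; rewrite lt_min => /andP[ys]; rewrite ltr_pdivlMr // => ym.
have [Mp pmin] := nearest_spec ys; have pc := nearest_close_base ys.
set q := nearest M y in Mp pmin pc *.
have qm : `|q - x| < m by apply: le_lt_trans pc _; rewrite mulrC.
move: (qm); rewrite !lt_min => /andP[/andP[q1 q2] qr]; split=> //.
have [|||mu muE] := h2 q (fun z => dotv (z - y) (z - y)) (fun z => 2 *: (z - y)) q2 Mp.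
- exists 1 => // z _.
  by have := sdiff_normsq (sdiff_subr y z); rewrite trmx1 mul1mx.
- move=> e e0; exists (e / 2) => [|z zd]; first by rewrite divr_gt0.
  by rewrite -scalerBr opprB addrA subrK normrZ ger0_norm //; lra.
- exists 1 => // z _ Mz; have := pmin z Mz.
  by rewrite -!(opprB _ y) !dotvNl !dotvNr !opprK.
have E : y - q = (J q)^T *m (- 2^-1 *: mu).
  rewrite -scalemxAr -muE scalerA mulNr mulVf ?pnatr_eq0 //.
  by rewrite scaleN1r opprB.
exists (- 2^-1 *: mu) => //; apply: le_trans (h1 _ _ q1) _.
rewrite -E -mulrA ler_pM2l //; apply: le_trans (hD _ _) _.
by rewrite -mulrA ler_pM2l // distrC; exact: nearest_close.
Qed.

(* The pair (c, mu) of the nearest point and its multiplier solves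
   E (c, mu) = (y, 0). *)
Definition kkt_map (w : 'cV[K]_(n + p)) : 'cV[K]_(n + p) :=
  col_mx (usubmx w + (J (usubmx w))^T *m dsubmx w) (ph (usubmx w)).

(** The terms with [H i] come from differentiating the Jacobian in (J c)^T mu. They vanish at (x,
    0), leaving the saddle-point matrix with blocks 1, J^T, J, 0. *)
Definition kkt_deriv (w k : 'cV[K]_(n + p)) : 'cV[K]_(n + p) :=
  col_mx (usubmx k + \sum_i (dsubmx k i 0 *: (row i (J (usubmx w)))^T +
                             dsubmx w i 0 *: (H i (usubmx w) *m usubmx k)))
         (J (usubmx w) *m usubmx k).

Let blin_dcoord i : blin (fun w : 'cV[K]_(n + p) => dsubmx w i 0 : K).
Proof.
split; [by move=> u v; rewrite !mxE|by move=> a u; rewrite !mxE|].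
exists 1 => // u; rewrite mul1r; apply: le_trans (norm_dsub u).
exact: entry_le_norm.
Qed.

Lemma blin_kkt_deriv w : blin (kkt_deriv w).
Proof.
apply: blin_col_mx; last exact: (blin_comp (blin_usub _ _) (blin_mulmx _)).
apply: blinD; first exact: blin_usub.
apply: blin_sum => i; apply: blinZ; first exact: blin_dcoord.
exact: (blin_comp (blin_usub _ _) (blin_mulmx _)).
Qed.

Lemma sdiff_kkt w : `|usubmx w - x| < r -> sdiff kkt_map (kkt_deriv w) w.
Proof.
move=> wr.
have usd : sdiff (usubmx : 'cV[K]_(n + p) -> 'cV[K]_n) usubmx w.
  exact: sdiff_lin (blin_usub _ _).
have -> : kkt_map = fun w => col_mx (usubmx w +
    \sum_i dsubmx w i 0 *: (row i (J (usubmx w)))^T) (ph (usubmx w)).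
  by apply/funext => v; rewrite /kkt_map trJ_mul.
apply: sdiff_col_mx; last first.
  exact: (sdiff_comp (blin_usub _ _) (blin_mulmx _) usd (le_ph LE wr)).
apply: sdiffD => //; apply: sdiff_sum => i.
apply: (@sdiffZ _ _ _ (fun w : 'cV[K]_(n + p) => dsubmx w i 0)
  (fun w => (row i (J (usubmx w)))^T) _ (mulmx (H i (usubmx w)) \o usubmx)).
- exact: blin_dcoord.
- exact: (blin_comp (blin_usub _ _) (blin_mulmx _)).
- exact: sdiff_lin (blin_dcoord i).
- exact: (sdiff_comp (blin_usub _ _) (blin_mulmx _) usd (le_J LE i wr)).
Qed.

Lemma kkt_deriv_base k : kkt_deriv (col_mx x 0) k =
  col_mx (usubmx k + (J x)^T *m dsubmx k) (J x *m usubmx k).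
Proof.
rewrite /kkt_deriv col_mxKu col_mxKd trJ_mul; congr (col_mx (_ + _) _).
by apply: eq_bigr => i _; rewrite [X in _ + X](_ : _ = 0) ?addr0 // mxE scale0r.
Qed.

(** Block elimination: if k has image (r1, r2), its multiplier part solves J J^T mu = J r1 - r2 by
    the Gram matrix, and its point part is r1 - J^T mu. *)
Lemma kkt_deriv_bound : exists2 c : K, 0 < c & forall k,
  c * `|k| <= `|kkt_deriv (col_mx x 0) k|.
Proof.
have [G G0 hG] := norm_mulmx_bound (invmx (J x *m (J x)^T)).
have [D D0 hD] := norm_mulmx_bound (J x).
have [D' D'0 hD'] := norm_mulmx_bound (J x)^T.
pose S : K := 1 + (1 + D') * (G * (D + 1)).
have S0 : 0 < S by rewrite ltr_wpDr // ltW // !mulr_gt0 // addr_gt0.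
exists S^-1 => [|k]; first by rewrite invr_gt0.
rewrite mulrC ler_pdivrMr // mulrC kkt_deriv_base.
set r1 := usubmx k + _; set r2 := J x *m _; set N := `|col_mx r1 r2|.
have n1 : `|r1| <= N by rewrite -[r1](@col_mxKu K _ _ _ _ r2) norm_usub.
have n2 : `|r2| <= N by rewrite -[r2](@col_mxKd K _ _ _ r1) norm_dsub.
have dE : dsubmx k = invmx (J x *m (J x)^T) *m (J x *m r1 - r2).
  rewrite /r1 /r2 (mulmxDr (J x)) addrAC subrr add0r (mulmxA (J x)) mulKmx //.
  exact: gram_unitmx (le_free LE).
have hd : `|dsubmx k| <= G * (D + 1) * N.
  rewrite dE (le_trans (hG _ _)) // -mulrA ler_pM2l //.
  apply: (le_trans (ler_normB _ _)); have := hD _ r1.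
  by have := ler_wpM2l (ltW D0) n1; lra.
have hu : `|usubmx k| <= N + D' * (G * (D + 1) * N).
  have -> : usubmx k = r1 - (J x)^T *m dsubmx k by rewrite /r1 addrK.
  apply: (le_trans (ler_normB _ _)); have := hD' _ (dsubmx k).
  by have := ler_wpM2l (ltW D'0) hd; lra.
rewrite -[k]vsubmxK; apply: (le_trans (norm_col_mx _ _)).
rewrite /S; lra.
Qed.

(** Along w = (c, mu) the map [kkt_map] has increments (s - t) b with b = (h, 0), so
    [implicit_sdiff] applies. At t = 0 the velocity is b, since J x h = 0 makes b a fixed vector of
    the derivative. *)
Lemma nearest_curve h : J x *m h = 0 ->
  let c t := nearest M (x + t *: h) in
  [/\ c 0 = x, sdiff c (fun s : K => s *: h) 0 &
    exists2 d : K, 0 < d & forall t : K, `|t| < d ->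
      [/\ M (c t), `|c t - x| < r & exists h', sdiff c (fun s : K => s *: h') t]].
Proof.
move=> Jh c.
have [C C0 [d1 d10 near1]] := nearest_multiplier.
have h1 : 0 < `|h| + 1 by rewrite ltr_wpDl.
pose T : K := d1 / (`|h| + 1); have T0 : 0 < T by rewrite divr_gt0.
have small t : `|t| < T -> `|x + t *: h - x| < d1.
  rewrite ltr_pdivlMr // => tT; rewrite addrAC subrr add0r normrZ.
  by apply: le_lt_trans tT; rewrite ler_wpM2l // lerDl.
(* The guard makes the statement true for every t, as [choice] requires; outside the radius the
   multiplier is a dummy 0. *)
have muex (t : K) : exists m, `|t| < T ->
    x + t *: h - c t = (J (c t))^T *m m /\ `|m| <= C * (`|t| * `|h|).
  have [tT|tT] := ltP `|t| T; last by exists 0.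
  have [_ _ _ [m mE mC]] := near1 _ (small t tT); exists m => _; split => //.
  by apply: le_trans mC _; rewrite addrAC subrr add0r normrZ.
have [mu muP] := choice muex.
have cx0 : c 0 = x by rewrite /c scale0r addr0 nearest_base.
have T00 : `|0 : K| < T by rewrite normr0.
have mu0 : mu 0 = 0.
  by apply/eqP; rewrite -normr_le0; have [_] := muP _ T00; rewrite normr0 mul0r mulr0.
pose w t := col_mx (c t) (mu t); pose b : 'cV[K]_(n + p) := col_mx h 0.
have cr t : `|t| < T -> `|usubmx (w t) - x| < r.
  by move=> /small/near1[_ ? _ _]; rewrite col_mxKu.
have cM t : `|t| < T -> M (c t) by move=> /small/near1[].
have Ew t : `|t| < T -> kkt_map (w t) = col_mx (x + t *: h) 0.
  move=> tT; rewrite /kkt_map col_mxKu col_mxKd; have [<- _] := muP t tT.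
  rewrite addrC subrK; congr col_mx; apply: (le_M LE _).1; last exact: cM.
  by have := cr t tT; rewrite col_mxKu.
have Ed s t : `|s| < T -> `|t| < T -> kkt_map (w s) - kkt_map (w t) = (s - t) *: b.
  move=> sT tT; rewrite !Ew // opp_col_mx add_col_mx subr0 scale_col_mx scaler0.
  by rewrite opprD addrACA subrr add0r -scalerBl.
have w0 : w 0 = col_mx x 0 by rewrite /w cx0 mu0.
have [q q0 hq] := kkt_deriv_bound.
have w0r : `|usubmx (w 0) - x| < r by rewrite w0 col_mxKu subrr normr0 (le_r0 LE).
have sd0 : sdiff w (fun s : K => s *: b) 0.
  apply: (@implicit_sdiff _ _ _ kkt_map (kkt_deriv (w 0)) w 0 b b q).
  - exact: blin_kkt_deriv.
  - exact: sdiff_kkt.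
  - exact: q0.
  - by rewrite w0.
  - by rewrite w0 kkt_deriv_base /b col_mxKu col_mxKd mulmx0 addr0 Jh.
  - move=> e e0; pose S : K := (n%:R + 2 + C) * (`|h| + 1).
    have S0 : 0 < S by rewrite mulr_gt0 // addr_gt0 // ltr_wpDl.
    exists (Num.min T (e / S)) => [|s]; first by rewrite lt_min T0 divr_gt0.
    rewrite subr0 lt_min => /andP[sT]; rewrite ltr_pdivlMr // => se.
    rewrite w0 /w opp_col_mx add_col_mx subr0.
    apply: le_lt_trans (norm_col_mx _ _) _; apply: le_lt_trans se.
    have [_ _ /nearest_close_base + _] := near1 _ (small s sT).
    rewrite -/(c s) addrAC subrr add0r normrZ => hc.
    have [_ hm] := muP s sT; rewrite /S.
    have := normr_ge0 s; have := normr_ge0 h; have := ler0n K n => n0' h0 s0.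
    have k1 : 0 <= `|s| * (n%:R + 2 + C) by rewrite mulr_ge0 // !addr_ge0 // ltW.
    lra.
  - by exists T => // s u; rewrite !subr0; exact: Ed.
have sub_c t D : sdiff w (fun s : K => s *: D) t ->
    sdiff c (fun s : K => s *: usubmx D) t.
  move=> wD e /wD[d d0 hd]; exists d => // s u sd ud.
  apply: le_trans (hd s u sd ud); apply: le_trans (norm_usub _).
  have [_ UZ _] := @blin_usub K n p.
  by rewrite !(blinB _ _ (@blin_usub K n p)) UZ /w !col_mxKu.
split => //.
  by have := sub_c _ _ sd0; rewrite /b col_mxKu.
(* For small t the derivative of [kkt_map] at w t differs from the one at w 0 by at most q / 2, so
   it stays bounded below by q / 2. It is then bijective and b has a preimage, the velocity at t. *)
have q20 : 0 < q / 2 by rewrite divr_gt0.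
have [d2 d20 close] := sdiff_close (blin_kkt_deriv _) (sdiff_kkt w0r) q20.
have [Cw Cw0 [d3 d30 wlip]] := sdiff_lip (blin_scale b) sd0.
have [d4 d40 wcont] := sdiff_cont (blin_scale b) sd0 d20.
pose m := Num.min T (Num.min d3 d4).
have m0 : 0 < m by rewrite !lt_min T0 d30.
exists m => // t; rewrite /m !lt_min => /and3P[tT t3 t4].
split; [exact: cM|by have := cr t tT; rewrite col_mxKu|].
have wt0 : `|w t - w 0| < d2 by apply: wcont; rewrite subr0.
have Dt k : q / 2 * `|k| <= `|kkt_deriv (w t) k|.
  have := close _ _ wt0 (blin_kkt_deriv _) (sdiff_kkt (cr t tT)) k.
  have := hq k; rewrite -w0; set X := kkt_deriv (w 0) k; set Y := kkt_deriv (w t) k.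
  by have := ler_normB Y (Y - X); rewrite subKr; lra.
have [D DE] := blin_surj (blin_kkt_deriv _) q20 Dt b.
exists (usubmx D); apply: sub_c.
apply: (@implicit_sdiff _ _ _ kkt_map (kkt_deriv (w t)) w t b D (q / 2)) => //.
- exact: blin_kkt_deriv.
- exact: sdiff_kkt (cr t tT).
- move=> e e0; exists (Num.min (d3 - `|t|) (e / Cw)) => [|s].
    by rewrite lt_min subr_gt0 t3 divr_gt0.
  rewrite lt_min ltr_pdivlMr // => /andP[sd se].
  apply: le_lt_trans (wlip s t _ _) _; rewrite ?subr0 //; last by rewrite mulrC.
  by have := ler_normD (s - t) t; rewrite subrK; lra.
- exists (T - `|t|) => [|s u sd ud]; first by rewrite subr_gt0.
  apply: Ed.
    by have := ler_normD (s - t) t; rewrite subrK; lra.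
  by have := ler_normD (u - t) t; rewrite subrK; lra.
Qed.

(** A vector h of the kernel is the velocity of the curve of nearest points to x + t h. Conversely
    [ph] vanishes along a curve on M, and one small t contradicts J x h being nonzero. *)
Lemma tangent_ker : tangent M x = [set h | J x *m h = 0].
Proof.
apply/seteqP; split => [h /= [c [c0 cM ch]]|h /= Jh]; last first.
  have [c0 sd [d d0 hd]] := nearest_curve Jh.
  exists (fun t => nearest M (x + t *: h)); split => //.
    by apply/nbhs_ballP; exists d => //= t; rewrite -ball_normE /= sub0r normrN => /hd[].
  apply: is_derive_eps => e e0; have [d' d'0 h'] := sdiff_at sd e0.
  by exists d' => // t; exact: h'.
apply/eqP; rewrite -normr_le0 leNgt; apply/negP => q0.
have [D D0 hD] := norm_mulmx_bound (J x).
pose S : K := D + `|h| + 1.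
have S0 : 0 < S by rewrite ltr_wpDl // addr_ge0 // ltW.
pose e : K := Num.min 1 (`|J x *m h| / (2 * S)).
have e0 : 0 < e by rewrite lt_min ltr01 divr_gt0 // mulr_gt0.
have eS : e * S < `|J x *m h|.
  have : e * (2 * S) <= `|J x *m h|.
    by rewrite -ler_pdivlMr ?mulr_gt0 // ge_min lexx orbT.
  have : 0 < e * S by rewrite mulr_gt0.
  lra.
have e1 : e <= 1 by rewrite ge_min lexx.
clearbody e.
have [d1 d10 h1] := derive_eps ch e0; have [d2 d20 h2] := sdiff_at (le_ph LE x_near) e0.
move: cM => /nbhs_ballP[d3 /= d30 cM].
have hh : 0 < `|h| + 1 by rewrite ltr_wpDl.
pose m : K := Num.min (Num.min d1 d3) (Num.min d2 r / (`|h| + 1)).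
have m0 : 0 < m by rewrite !lt_min d10 d30 divr_gt0 // lt_min d20 (le_r0 LE).
pose t : K := m / 2; have t0 : 0 < t by rewrite divr_gt0.
have tm : t < m by rewrite /t; lra.
move: tm; clearbody t; rewrite /m !lt_min ltr_pdivlMr // lt_min => /andP[/andP[t1 t3] /andP[t2 tr]].
have nt : `|t| = t by rewrite gtr0_norm.
have := h1 t; rewrite nt add0r c0 => /(_ t1) k1.
have ct : `|c t - x| <= t * (`|h| + 1).
  have := ler_normD (c t - x - t *: h) (t *: h); rewrite subrK normrZ nt.
  have : e * t <= t by rewrite ler_piMl // ltW.
  lra.
have Mct : M (c t) by apply: cM; rewrite -ball_normE /= sub0r normrN nt.
have phct : ph (c t) = 0 by apply: (le_M LE _).1 Mct; exact: le_lt_trans ct tr.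
have := h2 (c t - x) (le_lt_trans ct t2); rewrite subrKC phct ph_base subrr sub0r normrN => k2.
have k3 := hD _ (c t - x - t *: h).
have k4 : t * `|J x *m h| <= e * (t * (`|h| + 1)) + D * (e * t).
  have <- : `|J x *m (t *: h)| = t * `|J x *m h| by rewrite -scalemxAr normrZ nt.
  have -> : J x *m (t *: h) = J x *m (c t - x) - J x *m (c t - x - t *: h).
    by rewrite -mulmxBr subKr.
  apply: (le_trans (ler_normB _ _)).
  have := ler_wpM2l (ltW e0) ct; have := ler_wpM2l (ltW D0) k1; lra.
have : t * `|J x *m h| <= t * (e * S) by rewrite /S; lra.
by rewrite ler_pM2l // leNgt eS.
Qed.

End Manifold.

(** * Subgradients of a partly smooth function along its manifold *)

Lemma subdiff_monotone {K : realType} n (f : 'cV[K]_n -> \bar K) y z u w :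
  proper_fun f -> subdiff f y u -> subdiff f z w -> 0 <= dotv (u - w) (y - z).
Proof.
move=> fp fyu fzw; have := subdiff_fin fp fyu; have := subdiff_fin fp fzw.
have := fyu z; have := fzw y; move: fyu fzw => _ _.
case: (f y) => [a| |] //; case: (f z) => [b| |] //.
rewrite -!EFinD !lee_fin -(opprB y z) dotvNr dotvBl => h1 h2 _ _.
by have := lerD h1 h2; lra.
Qed.

(** A and B are the transposed Jacobians at y and at x: P B = 0 lets B be subtracted for free. The
    literal 0 is the Lagrangian gradient at x, as [lo_comp] produces it. *)
Lemma expansion_identity {K : realType} n p (P Q : 'M[K]_n) (A B : 'M[K]_(n, p))
    (d a : 'cV[K]_n) m : P *m B = 0 ->
  P *m (a - 0 - Q *m d) + (P *m Q *m (d - P *m d) + P *m ((A - B) *m m)) =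
  P *m (a + A *m m) - P *m Q *m P *m d.
Proof.
move=> PB; have -> : P *m ((A - B) *m m) = P *m (A *m m).
  by rewrite mulmxBl mulmxBr (mulmxA P B) PB mul0mx subr0.
rewrite subr0 (mulmxBr P a) (mulmxBr (P *m Q)) (mulmxDr P a) !mulmxA.
by rewrite (addrA (P *m a - _)) subrKA addrAC.
Qed.

Section PartlySmooth.
Context {K : realType} {n p : nat}.
Context (M : set 'cV[K]_n) (ph : 'cV[K]_n -> 'cV[K]_p) (J : 'cV[K]_n -> 'M[K]_(p, n)).
Context (H : 'I_p -> 'cV[K]_n -> 'M[K]_n) (x : 'cV[K]_n) (r : K).
Hypothesis LE : local_equations M ph J H x r.
Context (f : 'cV[K]_n -> \bar K) (g : 'cV[K]_n -> K) (gg : 'cV[K]_n -> 'cV[K]_n).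
Context (Hg : 'cV[K]_n -> 'M[K]_n).
Hypothesis fE : forall y, `|y - x| < r -> M y -> f y = (g y)%:E.
Hypothesis gD : forall y, `|y - x| < r -> sdiff g (dotv (gg y)) y.
Hypothesis ggD : forall y, `|y - x| < r -> sdiff gg (mulmx (Hg y)) y.

Let r0 : 0 < r := le_r0 LE.
Let x_near : `|x - x| < r. Proof. by rewrite subrr normr0. Qed.
Let P := orthoproj (tangent M x).
Let T_ker := tangent_ker LE.
Let free := le_free LE.

(** The subgradient inequality restricted to M says that y minimises g - <u, .> on M near y. *)
Lemma subdiff_multiplier : exists2 d : K, 0 < d & forall y u,
  `|y - x| < d -> M y -> subdiff f y u -> exists l, u = gg y + (J y)^T *m l.
Proof.
have [d d0 hd] := manifold_multiplier LE.
exists (Num.min d r) => [|y u]; first by rewrite lt_min d0.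
rewrite lt_min => /andP[yd yr] My fyu.
have ry : 0 < r - `|y - x| by rewrite subr_gt0.
have inr z : `|z - y| < r - `|y - x| -> `|z - x| < r.
  by have := ler_normD (z - y) (y - x); rewrite subrKA; lra.
have [|||mu E] := hd y (fun z => g z + dotv (- u) z) (fun z => gg z - u) yd My.
- exists (r - `|y - x|) => // z /inr zr.
  apply: (@sdiff_eqD _ _ _ _ (fun h => dotv (gg z) h + dotv (- u) h)).
    by move=> h; rewrite dotvDl.
  by apply: sdiffD; [exact: gD|exact: sdiff_lin (blin_dotv _)].
- move=> e e0; have [d' d'0 h'] := sdiff_cont (blin_mulmx _) (ggD yr) e0.
  by exists d' => // z zd; rewrite opprB addrA subrK; exact: h'.
- exists (r - `|y - x|) => // z /inr zr Mz; have := fyu z.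
  by rewrite !fE // -EFinD lee_fin dotvBr !dotvNl; lra.
exists (- mu); rewrite mulmxN -E opprB addrC subrK //.
Qed.

Context (us : 'cV[K]_n) (lam : 'cV[K]_p).
Hypothesis us_sub : subdiff f x us.
Hypothesis lamE : us = gg x + (J x)^T *m lam.

(** Hessian at x of g + <lam, ph> - <us, .>. The multiplier [lam] makes the gradient vanish at x in
    all directions, not only tangent ones, so curvature of M enters through the [H i] alone. *)
Definition lagr_hess : 'M[K]_n := Hg x + \sum_i lam i 0 *: H i x.
Let Q := lagr_hess.

Definition lagr_grad y := gg y + (J y)^T *m lam - us.
Definition lagr y := g y + (dotv lam (ph y) + dotv (- us) y).

Lemma lagr_grad_base : lagr_grad x = 0.
Proof. by rewrite /lagr_grad -lamE subrr. Qed.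

Lemma sdiff_lagr_grad : sdiff lagr_grad (mulmx Q) x.
Proof.
have -> : lagr_grad = fun y => gg y + (\sum_i lam i 0 *: (row i (J y))^T + - us).
  by apply/funext => y; rewrite /lagr_grad (trJ_mul J) addrA.
apply: (@sdiff_eqD _ _ _ _ (fun h => Hg x *m h + (\sum_i
   (0 *: (row i (J x))^T + lam i 0 *: (H i x *m h)) + 0))).
  move=> h; rewrite addr0 /Q /lagr_hess mulmxDl mulmx_suml; congr (_ + _).
  by apply: eq_bigr => i _; rewrite scale0r add0r scalemxAl.
apply: sdiffD; first exact: ggD.
apply: sdiffD; last exact: sdiff_cst.
apply: sdiff_sum => i.
apply: (@sdiffZ _ _ _ (fun=> lam i 0) (fun y => (row i (J y))^T) (fun=> 0) (mulmx (H i x))).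
- exact: blin_cst0.
- exact: blin_mulmx.
- exact: sdiff_cst.
- exact: (le_J LE i x_near).
Qed.

Lemma sdiff_lagr y : `|y - x| < r -> sdiff lagr (dotv (lagr_grad y)) y.
Proof.
move=> yr; apply: (@sdiff_eqD _ _ _ _ (fun h => dotv (gg y) h +
    ((dotv lam \o mulmx (J y)) h + dotv (- us) h))).
  by move=> h /=; rewrite /lagr_grad addrA !dotvDl dotv_mulmx.
apply: sdiffD; first exact: gD.
apply: sdiffD; last exact: sdiff_lin (blin_dotv _).
apply: (@sdiff_comp _ _ _ _ ph (dotv lam)).
- exact: blin_mulmx.
- exact: blin_dotv.
- exact: (le_ph LE yr).
- exact: sdiff_lin (blin_dotv _).
Qed.

Let near_lt (T : Type) (F : set_system T) (FF : Filter F) (V : normedModType K)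
  (y : T -> V) (a : V) (e : K) : y @ F --> a -> 0 < e -> \forall t \near F, `|y t - a| < e.
Proof. by move=> /cvgr_distC_lt h e0; exact: h. Qed.

(** 1 - P factors through J x, and J x (y - x) is minus the first-order remainder of [ph], which
    vanishes at both y and x. *)
Lemma normal_lo (T : Type) (F : set_system T) (FF : Filter F) (y : T -> 'cV[K]_n) :
  y @ F --> x -> (\forall t \near F, M (y t)) ->
  lo F (fun t => (y t - x) - P *m (y t - x)) (fun t => `|y t - x|).
Proof.
move=> yx yM; have [B BE] := orthoproj_compl free T_ker.
apply: (@lo_near _ _ F _ _ (fun t => B *m (- (ph (y t) - ph x - J x *m (y t - x))))).
  near=> t.
  have phy : ph (y t) = 0.
    apply: (le_M LE _).1; last by near: t.
    by near: t; exact: near_lt.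
  rewrite phy (ph_base LE) subrr sub0r opprK mulmxA -BE mulmxBl mul1mx //.
apply: lo_mulmx; apply: loN.
by apply: lo_comp yx; exact: (le_ph LE x_near).
Unshelve. all: by end_near. Qed.

(** Write u - us as the Lagrangian gradient at y plus (J y)^T (l - lam). After projection only (J y
    - J x)^T (l - lam) remains of the second term: a factor O(|y - x|) times a factor tending to
    0. *)
Lemma subdiff_expansion (T : Type) (F : set_system T) (FF : Filter F) (y u : T -> 'cV[K]_n) :
  y @ F --> x -> u @ F --> us -> (\forall t \near F, M (y t)) ->
  (\forall t \near F, subdiff f (y t) (u t)) ->
  lo F (fun t => P *m (u t - us) - P *m Q *m P *m (y t - x)) (fun t => `|y t - x|).
Proof.
move=> yx uus yM yu.
have [d1 d10 mult] := subdiff_multiplier.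
have [C C0 [d2 d20 bnd]] := multiplier_bound_near LE.
have near_y e : 0 < e -> \forall t \near F, `|y t - x| < e by exact: near_lt.
pose l t := get [set l | u t = gg (y t) + (J (y t))^T *m l].
have lP : \forall t \near F, u t = gg (y t) + (J (y t))^T *m l t.
  near=> t; apply: (@getPex _ [set l | u t = gg (y t) + (J (y t))^T *m l]).
  by apply: mult; near: t; [exact: near_y| |].
have gradE : \forall t \near F, u t - us = lagr_grad (y t) + (J (y t))^T *m (l t - lam).
  near=> t; have -> : u t = gg (y t) + (J (y t))^T *m l t by near: t.
  by rewrite mulmxBr /lagr_grad [RHS]addrAC; congr (_ - _); rewrite -addrA subrKC.
have lgc := lo_comp FF sdiff_lagr_grad yx; rewrite lagr_grad_base in lgc.
(* The normal vector (J y)^T (l - lam) is u - us minus the Lagrangian gradient. Both tend to 0, and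
   [multiplier_bound_near] passes this on to l - lam. *)
have l_small e : 0 < e -> \forall t \near F, `|l t - lam| <= e.
  move=> e0; have [D D0 hD] := norm_mulmx_bound (J x).
  have CD : 0 < C * D by rewrite mulr_gt0.
  have e1 : 0 < e / (C * D) / 2 by rewrite !divr_gt0.
  have [d3 d30 h3] := sdiff_cont (blin_mulmx _) sdiff_lagr_grad e1.
  near=> t.
  have yd2 : `|y t - x| < d2 by near: t; exact: near_y.
  have yd3 : `|y t - x| < d3 by near: t; exact: near_y.
  have ut : `|u t - us| < e / (C * D) / 2 by near: t; exact: near_lt.
  have E : u t - us = lagr_grad (y t) + (J (y t))^T *m (l t - lam) by near: t.
  have := h3 _ yd3; rewrite lagr_grad_base subr0 => h4.
  apply: le_trans (bnd _ (l t - lam) yd2) _.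
  have h5 : `|(J (y t))^T *m (l t - lam)| <= e / (C * D).
    have -> : (J (y t))^T *m (l t - lam) = (u t - us) - lagr_grad (y t).
      by rewrite E addrAC subrr add0r.
    by apply: le_trans (ler_normB _ _) _; lra.
  have h6 := le_trans (hD _ ((J (y t))^T *m (l t - lam))) (ler_wpM2l (ltW D0) h5).
  have := ler_wpM2l (ltW C0) h6; rewrite mulrA [_ * (e / _)]mulrC divfK ?gt_eqF //.
have [CJ CJ0 [d4 d40 Jlip]] := J_lip LE x_near.
have rest : lo F (fun t => (J (y t) - J x)^T *m (l t - lam)) (fun t => `|y t - x|).
  move=> e e0; have S0 : 0 < (p%:R + 1) * CJ by rewrite mulr_gt0 // ltr_wpDl.
  have e1 : 0 < e / ((p%:R + 1) * CJ) by rewrite divr_gt0.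
  near=> t; apply: le_trans (norm_mulmx _ _) _; rewrite norm_trmx.
  have h1 : `|J (y t) - J x| <= CJ * `|y t - x|.
    by apply: Jlip; near: t; exact: near_y.
  have h2 : `|l t - lam| <= e / ((p%:R + 1) * CJ) by near: t; exact: l_small.
  have h3 : p%:R * `|J (y t) - J x| <= (p%:R + 1) * (CJ * `|y t - x|).
    by apply: ler_pM => //; rewrite lerDl.
  have h4 : 0 <= p%:R * `|J (y t) - J x| by rewrite mulr_ge0.
  apply: le_trans (ler_pM h4 (normr_ge0 _) h3 h2) _.
  rewrite le_eqVlt; apply/orP; left; apply/eqP; field.
  by rewrite !gt_eqF // ltr_wpDl.
have nlo := normal_lo FF yx yM.
apply: (@lo_near _ _ F _ _ (fun t => P *m (lagr_grad (y t) - 0 - Q *m (y t - x)) +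
   (P *m Q *m ((y t - x) - P *m (y t - x)) + P *m ((J (y t) - J x)^T *m (l t - lam))))).
  near=> t.
  have -> : u t - us = lagr_grad (y t) + (J (y t))^T *m (l t - lam) by near: t.
  have PJ := mul_orthoproj_tr free T_ker; rewrite -/P in PJ.
  have -> : (J (y t) - J x)^T = (J (y t))^T - (J x)^T by rewrite linearB.
  exact: expansion_identity.
by apply: loD; [exact: lo_mulmx|apply: loD; exact: lo_mulmx].
Unshelve. all: by end_near. Qed.

(** * Identification and positivity of the Riemannian Hessian *)

Section RiemannianHessian.
Hypothesis Hg_sym : (Hg x)^T = Hg x.
Hypothesis H_sym : forall i, (H i x)^T = H i x.

Lemma lagr_hess_sym : Q^T = Q.
Proof.
rewrite /Q /lagr_hess linearD /= Hg_sym linear_sum; congr (_ + _).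
by apply: eq_bigr => i _; rewrite linearZ /= H_sym.
Qed.

Context (fbar : 'cV[K]_n -> \bar K).
Hypothesis fbarE : forall y, fbar y = (f y - (dotv y us)%:E)%E.

Section Curve.
Context (h : 'cV[K]_n).
Hypothesis Jh : J x *m h = 0.
Let c t := nearest M (x + t *: h).
Let psi t := fine (fbar (c t)).

Lemma psiE : exists2 d : K, 0 < d & forall t : K, `|t| < d -> psi t = lagr (c t).
Proof.
have [_ _ [d d0 hd]] := nearest_curve LE Jh; exists d => // t /hd[Mct ctr _].
rewrite /psi fbarE (fE ctr Mct) -EFinB /= /lagr.
by rewrite ((le_M LE ctr).1 Mct) dotv0r add0r dotvNl dotvC.
Qed.

Lemma psi_is_derive : exists2 d : K, 0 < d & forall t : K, `|t| < d ->
  exists2 h', sdiff c (fun s : K => s *: h') t &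
    is_derive (t : K^o) 1 psi (dotv (lagr_grad (c t)) h').
Proof.
have [_ _ [d d0 hd]] := nearest_curve LE Jh; have [d' d'0 hE] := psiE.
exists (Num.min d d') => [|t]; first by rewrite lt_min d0.
rewrite lt_min => /andP[td td']; have [Mct ctr [h' ch']] := hd t td.
exists h' => //.
have sl : sdiff (lagr \o c) (dotv (lagr_grad (c t)) \o (fun s : K => s *: h')) t.
  exact: (sdiff_comp (blin_scale h') (blin_dotv _) ch' (sdiff_lagr ctr)).
apply: is_derive_eps => e e0; have [d1 d10 h1] := sdiff_at sl e0.
exists (Num.min d1 (d' - `|t|)) => [|k]; first by rewrite lt_min d10 subr_gt0.
rewrite lt_min => /andP[k1 k2]; have := h1 k k1 => /=.
rewrite -!hE //; first by rewrite dotvZr.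
by have := ler_normD t k; lra.
Qed.

Lemma psi_derive : exists2 d : K, 0 < d & forall t : K, `|t| < d ->
  is_derive (t : K^o) 1 psi (derive1 psi t).
Proof.
have [d d0 hd] := psi_is_derive; exists d; first exact: d0.
move=> t td; have [h' _ D] := hd t td.
by rewrite derive1E derive_val.
Qed.

(** By the chain rule psi' t = <lagr_grad (c t), c' t>. The first factor is t Q h + o(t), and
    [sdiff_close] gives that c' t is close to h, which is why strictness of c at 0 matters. *)
Lemma psi_derive_expansion (e : K) : 0 < e -> exists2 d : K, 0 < d & forall t : K, `|t| < d ->
  `|derive1 psi t - t * dotv (Q *m h) h| <= e * `|t|.
Proof.
move=> e0; have [c0 sc0 _] := nearest_curve LE Jh.
have [CQ CQ0 hQ] := norm_mulmx_bound Q.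
pose A : K := `|h| + 1; have A0 : 0 < A by rewrite ltr_wpDl.
have n1 : 0 < n%:R + 1 :> K by rewrite ltr_wpDl.
pose S : K := (n%:R + 1) * ((A + CQ) * A + CQ * A).
have S0 : 0 < S by rewrite mulr_gt0 // addr_gt0 ?mulr_gt0 // addr_gt0.
pose e1 : K := Num.min 1 (e / S).
have e10 : 0 < e1 by rewrite lt_min ltr01 divr_gt0.
have e11 : e1 <= 1 by rewrite ge_min lexx.
have e1S : e1 * S <= e by rewrite -ler_pdivlMr // ge_min lexx orbT.
clearbody e1.
have [d1 d10 h1] := sdiff_close (blin_scale _) sc0 e10.
have [d2 d20 h2] := sdiff_at sc0 e10.
have [d3 d30 h3] := sdiff_at sdiff_lagr_grad e10.
have [d4 d40 h4] := psi_is_derive.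
exists (Num.min (Num.min d1 d2) (Num.min (d3 / A) d4)).
  by rewrite !lt_min d10 d20 divr_gt0.
move=> t; rewrite !lt_min => /andP[/andP[t1 t2] /andP[t3 t4]].
move: t3; rewrite ltr_pdivlMr // => t3.
have [h' ch' D] := h4 t t4.
have -> : derive1 psi t = dotv (lagr_grad (c t)) h' by rewrite derive1E derive_val.
have hh' : `|h' - h| <= e1.
  have := h1 t (fun s : K => s *: h'); rewrite subr0 => k0.
  move: (k0 t1 (blin_scale _) ch' 1).
  by rewrite !scale1r normr1 mulr1.
have ct : `|c t - x - t *: h| <= e1 * `|t|.
  by have := h2 t t2; rewrite add0r -/c c0.
have ctA : `|c t - x| <= A * `|t|.
  have := ler_normD (c t - x - t *: h) (t *: h); rewrite subrK normrZ /A.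
  by have := ler_wpM2r (normr_ge0 t) e11; lra.
have gct : `|lagr_grad (c t) - t *: (Q *m h)| <= e1 * ((A + CQ) * `|t|).
  have ctd : `|c t - x| < d3 by apply: le_lt_trans ctA _; rewrite mulrC.
  have := h3 (c t - x) ctd; rewrite subrKC lagr_grad_base subr0 => k1.
  have -> : lagr_grad (c t) - t *: (Q *m h) =
      (lagr_grad (c t) - Q *m (c t - x)) + Q *m (c t - x - t *: h).
    by rewrite [Q *m (_ - t *: h)]mulmxBr -scalemxAr addrA subrK.
  apply: (le_trans (ler_normD _ _)); have := hQ _ (c t - x - t *: h).
  have := ler_wpM2l (ltW CQ0) ct; have := ler_wpM2l (ltW e10) ctA; lra.
have h'A : `|h'| <= A.
  by have := ler_normD (h' - h) h; rewrite subrK /A; lra.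
have -> : dotv (lagr_grad (c t)) h' - t * dotv (Q *m h) h =
    dotv (lagr_grad (c t) - t *: (Q *m h)) h' + t * dotv (Q *m h) (h' - h).
  by rewrite (dotvBl (lagr_grad _)) dotvZl (dotvBr _ h'); ring.
have k1 := norm_dotv (lagr_grad (c t) - t *: (Q *m h)) h'.
have k2 := norm_dotv (Q *m h) (h' - h).
have k3 : `|Q *m h| <= CQ * A by apply: le_trans (hQ _ h) _; rewrite ler_pM2l // lerDl.
have k4 : `|dotv (lagr_grad (c t) - t *: (Q *m h)) h'| <=
    (n%:R + 1) * (e1 * ((A + CQ) * `|t|)) * A.
  apply: le_trans k1 _; apply: ler_pM => //.
  by apply: ler_pM => //; rewrite lerDl.
have k5 : `|dotv (Q *m h) (h' - h)| <= (n%:R + 1) * (CQ * A) * e1.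
  apply: le_trans k2 _; apply: ler_pM => //.
  by apply: ler_pM => //; rewrite lerDl.
apply: (le_trans (ler_normD _ _)); rewrite normrM.
have := ler_wpM2l (normr_ge0 t) k5; have := ler_wpM2r (normr_ge0 t) e1S; rewrite /S; lra.
Qed.

Lemma derive2_psi : derive1n 2 psi 0 = dotv (Q *m h) h.
Proof.
have psi0 : derive1 psi 0 = 0.
  have [d d0 hd] := psi_derive_expansion ltr01.
  have := hd 0; rewrite normr0 mul0r subr0 mulr0 => /(_ d0).
  by rewrite normr_le0 => /eqP.
rewrite /derive1n /= derive1E.
suff D : is_derive (0 : K^o) 1 (derive1 psi) (dotv (Q *m h) h) by rewrite derive_val.
apply: is_derive_eps => e e0; have [d d0 hd] := psi_derive_expansion e0.
by exists d => // t td; rewrite add0r psi0 subr0; exact: hd.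
Qed.

(* psi has a minimum at 0, since us is a subgradient of f at x. *)
Lemma lagr_hess_ge0 : 0 <= dotv (Q *m h) h.
Proof.
rewrite leNgt; apply/negP => q0; set q := dotv _ _ in q0.
(* With this precision psi' s <= s q / 2 < 0 for small s > 0, so psi would decrease strictly from
   its minimum. *)
have e0 : 0 < - q / 2 by lra.
have [c0 _ [d d0 hd]] := nearest_curve LE Jh.
have [d1 d10 h1] := psi_derive_expansion e0; have [d2 d20 h2] := psi_derive.
pose m : K := Num.min d (Num.min d1 d2).
have m0 : 0 < m by rewrite !lt_min d0 d10.
pose t : K := m / 2; have t0 : 0 < t by rewrite divr_gt0.
have : t < m by rewrite /t; lra.
clearbody t; rewrite !lt_min => /and3P[td t1 t2].
have inr (s : K) : 0 <= s <= t -> `|s| < d2.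
  by move=> /andP[s0 st]; rewrite ger0_norm // (le_lt_trans st).
have [||s] := @MVT K psi (derive1 psi) 0 t t0.
- by move=> s; rewrite in_itv /= => /andP[s0 s1]; apply: h2; apply: inr; rewrite !ltW.
- apply: derivable_within_continuous => s; rewrite in_itv /= => /inr s2.
  by have := h2 s s2; case.
rewrite in_itv /= => /andP[s0 st]; rewrite subr0 => E.
have := h1 s; rewrite gtr0_norm // => /(_ (lt_trans st t1)).
rewrite ler_norml -/q => /andP[_ k].
have {}k : derive1 psi s < 0.
  have : s * q < 0 by rewrite pmulr_rlt0.
  lra.
have : psi t < psi 0 by rewrite -subr_lt0 E nmulr_rlt0.
rewrite ltNge; apply/negP; rewrite negbK.
have [|Mct ctr _] := hd t; first by rewrite gtr0_norm.
rewrite /psi !fbarE /c c0 (fE ctr Mct) (fE x_near (le_x LE)) -!EFinB /=.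
have := us_sub (c t); rewrite (fE ctr Mct) (fE x_near (le_x LE)) -EFinD lee_fin.
by rewrite dotvBr !(dotvC us); lra.
Qed.

End Curve.

(** P Q P meets the specification, and polarisation makes it the only solution: a symmetric matrix
    fixed by P on both sides is determined by its quadratic form on the tangent space. *)
Lemma riem_hessE : riem_hess M fbar x = P *m Q *m P.
Proof.
have Pt : P^T = P := orthoproj_tr free T_ker.
have PP : P *m P = P := orthoproj_idem free T_ker.
have PT h : tangent M x h -> P *m h = h.
  by rewrite T_ker => /= Jh; exact: (orthoproj_id free T_ker).
have TP h : tangent M x (P *m h).
  by rewrite T_ker /= mulmxA (mul_orthoproj free T_ker) mul0mx.
rewrite /riem_hess -/P; set A := [set _ | _].
have AQ : A (P *m Q *m P).
  split; first by rewrite !trmx_mul Pt lagr_hess_sym mulmxA.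
    by rewrite !mulmxA PP -!mulmxA PP.
  move=> h Th; rewrite derive2_psi; last by move: Th; rewrite T_ker.
  by rewrite -!mulmxA (PT h Th) dotvC dotv_mulmx Pt (PT h Th) dotvC.
have [S1 P1 D1] : A (get A) by apply: (@getPex _ A); exists (P *m Q *m P).
have [S2 P2 D2] := AQ; set B := get A in S1 P1 D1 *; set C := P *m Q *m P in S2 P2 D2 *.
apply/eqP; rewrite -subr_eq0; apply/eqP; set E := B - C.
have SE : E^T = E by rewrite linearB /= S1 S2.
have quad a : dotv (E *m a) a = 0.
  have -> : E = P *m E *m P by rewrite /E mulmxBr mulmxBl P1 P2.
  rewrite -!mulmxA dotvC dotv_mulmx Pt dotvC /E mulmxBl (dotvBl (B *m _)).
  by rewrite D1 // D2 // subrr.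
have pol a b : dotv (E *m a) b = 0.
  have := quad (a + b); rewrite mulmxDr !dotvDl !dotvDr !quad add0r addr0.
  rewrite (dotvC (E *m b)) dotv_mulmx SE -mulr2n => /eqP.
  by rewrite mulrn_eq0 /= => /eqP.
clearbody E; apply/matrixP => i j; rewrite [RHS]mxE.
have -> : E i j = dotv (E *m delta_mx j 0) (delta_mx i 0).
  by rewrite dotvC dotv_delta -colE mxE.
exact: pol.
Qed.

(** Pairing a kernel vector h with its equation gives |h|^2 + a <Q P h, P h> = 0 with a nonnegative
    second term. *)
Lemma proj_lagr_hess_unit (a : K) : 0 < a -> 1%:M + a *: (P *m Q *m P) \in unitmx.
Proof.
move=> a0; have Pt : P^T = P := orthoproj_tr free T_ker.
apply: unitmx_ker => h E.
have JP : J x *m (P *m h) = 0 by rewrite mulmxA (mul_orthoproj free T_ker) mul0mx.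
have := congr1 (dotv h) E; rewrite dotv0r mulmxDl mul1mx dotvDr -scalemxAl dotvZr.
rewrite -!mulmxA [dotv h (P *m _)]dotv_mulmx Pt [dotv (P *m h) _]dotvC => k.
have := lagr_hess_ge0 JP => q0.
apply/eqP; rewrite -dotvv_eq0 eq_le dotvv_ge0 andbT.
have : 0 <= a * dotv (Q *m (P *m h)) (P *m h) by rewrite mulr_ge0 // ltW.
lra.
Qed.

End RiemannianHessian.

(** * Finite identification of the manifold *)

Section Identification.
Hypothesis fp : proper_fun f.
Hypothesis us_ri : ri (subdiff f x) us.
Hypothesis tangent_T : tangent M x = Tspace f x.
Hypothesis subdiff_cont : setmap_continuous M (subdiff f) x.

Lemma finite_identification (y u : nat -> 'cV[K]_n) :
  y @ \oo --> x -> u @ \oo --> us -> (\forall k \near \oo, subdiff f (y k) (u k)) ->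
  \forall k \near \oo, M (y k).
Proof.
move=> yx uus yu.
have [C1 C10 [d1 d10 near1]] := nearest_multiplier LE.
have [C C0 [d2 d20 bnd]] := multiplier_bound_near LE.
have [d3 d30 Jc] := J_cont LE x_near ltr01.
(* The default x keeps q k in M for every k, as the sequences of [setmap_continuous] must be. *)
pose q k := if `|y k - x| < d1 then nearest M (y k) else x.
have qM k : M (q k) by rewrite /q; case: ifP => [/near1[]|_] //; exact: (le_x LE).
have qE : \forall k \near \oo, q k = nearest M (y k).
  near=> k; rewrite /q ifT //; near: k; exact: near_lt.
have qx : q @ \oo --> x.
  apply/cvgrPdist_lt => e e0.
  have e1 : 0 < e / (n%:R + 2) by rewrite divr_gt0 // ltr_wpDl.
  near=> k.
  have yd : `|y k - x| < d1 by near: k; exact: near_lt.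
  have -> : q k = nearest M (y k) by near: k.
  have [_ _ /(nearest_close_base LE) h _] := near1 _ yd.
  rewrite distrC; apply: le_lt_trans h _.
  rewrite mulrC -ltr_pdivlMr ?ltr_wpDl //; near: k; exact: near_lt.
(* (J x)^T l is normal to M, hence parallel to the subdifferential, and us may be moved by (s / 2)
   (J x)^T l inside it. Subgradients w k at q k approach the moved point, so monotonicity bounds (s
   / 2) <l, J x (y k - q k)> by a vanishing multiple of |y k - q k|. *)
have key (l : 'cV[K]_p) (e : K) : 0 < e ->
    \forall k \near \oo, dotv l (J x *m (y k - q k)) <= e * `|y k - q k|.
  move=> e0; have orth h : orthocompl (par (subdiff f x)) h -> dotv h ((J x)^T *m l) = 0.
    move=> Th; have : tangent M x h by rewrite tangent_T.
    by rewrite T_ker /= dotv_mulmx trmxK => ->; rewrite dotv0l.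
  have [s s0 hs] := ri_orth us_ri orth.
  have s20 : 0 < s / 2 by rewrite divr_gt0.
  have subv : subdiff f x (us + (s / 2) *: ((J x)^T *m l)).
    by apply: hs; rewrite gtr0_norm //; lra.
  have [w [wsub wcv]] := subdiff_cont.2 q _ qM qx subv.
  have n1 : 0 < n%:R + 1 :> K by rewrite ltr_wpDl.
  pose e1 : K := s / 4 * e / (n%:R + 1).
  have e10 : 0 < e1 by rewrite !(divr_gt0, mulr_gt0).
  near=> k.
  have yk : subdiff f (y k) (u k) by near: k.
  have wk : subdiff f (q k) (w k) by near: k.
  have uk : `|u k - us| < e1 by near: k; exact: near_lt.
  have wl : `|w k - (us + (s / 2) *: ((J x)^T *m l))| < e1 by near: k; exact: near_lt.
  have := subdiff_monotone fp yk wk; set d := y k - q k.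
  have -> : u k - w k = (u k - us) - (w k - (us + (s / 2) *: ((J x)^T *m l))) -
      (s / 2) *: ((J x)^T *m l).
    by apply/matrixP => i j; rewrite !mxE; ring.
  set a := (u k - us) - _; rewrite (dotvBl a) dotvZl [dotv l _]dotv_mulmx => mono.
  have na : `|a| <= 2 * e1.
    have := ler_normB (u k - us) (w k - (us + (s / 2) *: ((J x)^T *m l))).
    by rewrite /a; lra.
  have h1 : dotv a d <= (n%:R + 1) * (2 * e1) * `|d|.
    apply: le_trans (ler_norm _) _; apply: le_trans (norm_dotv _ _) _.
    by rewrite ler_wpM2r // ler_pM // lerDl.
  have h2 : (n%:R + 1) * (2 * e1) = s / 2 * e.
    by rewrite /e1; field; rewrite gt_eqF.
  rewrite h2 in h1; rewrite -(ler_pM2l s20); lra.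
pose D : K := p%:R * (`|J x| + 1).
have D0 : 0 <= D by rewrite mulr_ge0 // addr_ge0.
have CD : 0 < C * D + 1 by rewrite ltr_wpDl // mulr_ge0 // ltW.
(* Chosen so that C D e <= 1 / 2. Since y k - q k = J (q k)^T mu, one gets |y k - q k| <= D |mu| <=
   D C e |y k - q k|, at most half of itself. *)
pose e : K := (C * D + 1)^-1 / 2.
have e0 : 0 < e by rewrite divr_gt0 // invr_gt0.
have small : \forall k \near \oo, `|J x *m (y k - q k)| <= e * `|y k - q k|.
  have pm (z : 'cV[K]_p) : \forall k \near \oo, forall i : 'I_p,
      dotv (delta_mx i 0) (J x *m (y k - q k)) <= e * `|y k - q k|.
    by apply: filter_forall => i; exact: key.
  have nm (z : 'cV[K]_p) : \forall k \near \oo, forall i : 'I_p,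
      dotv (- delta_mx i 0) (J x *m (y k - q k)) <= e * `|y k - q k|.
    by apply: filter_forall => i; exact: key.
  near=> k; apply: norm_le_entries => [|i j]; first by rewrite mulr_ge0 // ltW.
  rewrite [j]ord1 -dotv_delta ler_norml; apply/andP; split.
    rewrite lerNl -dotvNl; have : forall i : 'I_p,
        dotv (- delta_mx i 0) (J x *m (y k - q k)) <= e * `|y k - q k|.
      by near: k; exact: nm 0.
    exact.
  have : forall i : 'I_p, dotv (delta_mx i 0) (J x *m (y k - q k)) <= e * `|y k - q k|.
    by near: k; exact: pm 0.
  exact.
near=> k.
have yd : `|y k - x| < d1 by near: k; exact: near_lt.
have qk : q k = nearest M (y k) by near: k.
have [_ _ _ [mu muE _]] := near1 _ yd; rewrite -qk in muE.
have q2 : `|q k - x| < d2 by near: k; exact: near_lt.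
have q3 : `|q k - x| < d3 by near: k; exact: near_lt.
have sm : `|J x *m (y k - q k)| <= e * `|y k - q k| by near: k.
suff /eqP : `|y k - q k| = 0 by rewrite normr_eq0 subr_eq0 => /eqP ->.
have h1 := bnd _ mu q2; rewrite -muE in h1.
have h2 : `|J (q k)| <= `|J x| + 1.
  by have := ler_normD (J (q k) - J x) (J x); rewrite subrK; have := Jc _ q3; lra.
have h3 : `|y k - q k| <= D * `|mu|.
  rewrite {1}muE; apply: le_trans (norm_mulmx _ _) _; rewrite norm_trmx.
  by rewrite ler_wpM2r // ler_wpM2l.
have h4 := ler_wpM2l D0 (le_trans h1 (ler_wpM2l (ltW C0) sm)).
have h5 : (C * D + 1) * e = 2^-1 by rewrite /e; field; rewrite gt_eqF.
have h6 : D * (C * (e * `|y k - q k|)) <= 2^-1 * `|y k - q k|.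
  have -> : D * (C * (e * `|y k - q k|)) = (C * D * e) * `|y k - q k| by ring.
  by rewrite ler_wpM2r // -h5 ler_wpM2r ?lerDl // ltW.
apply/eqP; rewrite eq_le normr_ge0 andbT; lra.
Unshelve. all: by end_near. Qed.

End Identification.

End PartlySmooth.

(** * From the definition of partial smoothness to the expansion of a prox step *)

Section PSF.
Context {K : realType} {n : nat}.
Context (f fbar : 'cV[K]_n -> \bar K) (M : set 'cV[K]_n) (x us : 'cV[K]_n).
Hypothesis f_PSF : PSF f x M.
Hypothesis us_ri : ri (subdiff f x) us.
Hypothesis fbarE : forall y, fbar y = (f y - (dotv y us)%:E)%E.

Let P := orthoproj (Tspace f x).
Let Hs := riem_hess M fbar x.

(** All local properties are brought to one common radius r, with true gradients and symmetric
    Hessians for the equations and for the C^2 extension g. *)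
Lemma PSF_data : exists p (ph : 'cV[K]_n -> 'cV[K]_p) J H r g,
  [/\ local_equations M ph J H x r,
      forall y, `|y - x| < r -> M y -> f y = (g y)%:E,
      forall y, `|y - x| < r -> sdiff g (dotv (gradv g y)) y,
      forall y, `|y - x| < r -> sdiff (gradv g) (mulmx (hess g y)) y &
      (hess g x)^T = hess g x /\ forall i, (H i x)^T = H i x].
Proof.
have [_ [[Mx [p [phi [phi2 free Mphi]]]] [g [g2 fg]]] _ _] := f_PSF.
pose ph y : 'cV[K]_p := \col_i phi i y.
pose J y : 'M[K]_(p, n) := \matrix_(i, j) 'D_(basisv j) (phi i) y.
have phi_near : \forall y \near x, forall i, sdiff (phi i) (dotv (gradv (phi i) y)) y /\
    sdiff (gradv (phi i)) (mulmx (hess (phi i) y)) y.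
  apply: (@filter_forall _ _ (fun i y => sdiff (phi i) (dotv (gradv (phi i) y)) y /\
    sdiff (gradv (phi i)) (mulmx (hess (phi i) y)) y) (nbhs x)) => i.
  exact: (C2_near_c2 (phi2 i)).
have sym (h : 'cV[K]_n -> K) : C2_near h x -> (hess h x)^T = hess h x.
  move=> h2; have [_ gh] := nbhs_singleton (C2_near_c2 h2).
  by apply: c2_hess_sym gh; apply: filterS h2 => y [].
have /nbhs_ballP[r /= r0 hr] : \forall y \near x,
   [/\ M y <-> forall i, phi i y = 0, M y -> f y = (g y)%:E,
       forall i, sdiff (phi i) (dotv (gradv (phi i) y)) y /\
           sdiff (gradv (phi i)) (mulmx (hess (phi i) y)) y &
       sdiff g (dotv (gradv g y)) y /\ sdiff (gradv g) (mulmx (hess g y)) y].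
  near=> y; split; near: y => //; exact: (C2_near_c2 g2).
have {}hr y : `|y - x| < r -> [/\ M y <-> forall i, phi i y = 0, M y -> f y = (g y)%:E,
       forall i, sdiff (phi i) (dotv (gradv (phi i) y)) y /\
           sdiff (gradv (phi i)) (mulmx (hess (phi i) y)) y &
       sdiff g (dotv (gradv g y)) y /\ sdiff (gradv g) (mulmx (hess g y)) y].
  by move=> yr; apply: hr; rewrite -ball_normE /= distrC.
exists p, ph, J, (fun i => hess (phi i)), r, g; split; last first.
- by split=> [|i]; [exact: (sym g g2)|exact: (sym (phi i) (phi2 i))].
- by move=> y /hr[_ _ _ []].
- by move=> y /hr[_ _ _ []].
- by move=> y /hr[].
split => //.
- move=> y /hr[My _ _ _]; split.
    by move=> /My phi0; apply/matrixP => i j; rewrite !mxE.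
  move=> phy; apply/My => i.
  by have := congr1 (fun w : 'cV[K]_p => w i 0) phy; rewrite !mxE.
- move=> y /hr[_ _ phD _].
  apply: (@sdiff_eqD _ _ _ _ (fun h => \col_i dotv (gradv (phi i) y) h)).
    move=> h; apply/matrixP => i j; rewrite !mxE [j]ord1.
    by apply: eq_bigr => k _; rewrite !mxE.
  by apply: sdiff_col => i; have [] := phD i.
- move=> i y /hr[_ _ phD _].
  have -> : (fun z => (row i (J z))^T) = gradv (phi i).
    by apply/funext => z; apply/matrixP => k j; rewrite !mxE.
  by have [] := phD i.
Unshelve. all: by end_near. Qed.

Let TP : tangent M x = Tspace f x. Proof. by have [] := f_PSF. Qed.

Lemma PSF_hess_unit (a : K) : 0 < a -> 1%:M + a *: (P *m Hs *m P) \in unitmx.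
Proof.
move=> a0; have [p [ph [J [H [r [g [LE fE gD ggD [gs Hsym]]]]]]]] := PSF_data.
have us_sub := us_ri.1.
have [d d0 mult] := subdiff_multiplier LE fE gD ggD.
have [|lam lamE] := mult x us _ (le_x LE) us_sub; first by rewrite subrr normr0.
rewrite /Hs (riem_hessE LE fE gD ggD lamE gs Hsym fbarE) /P -TP.
have PP := orthoproj_idem (le_free LE) (tangent_ker LE).
rewrite !mulmxA PP -!mulmxA PP !mulmxA.
exact: (proj_lagr_hess_unit LE fE gD ggD us_sub lamE fbarE a0).
Qed.

Lemma PSF_expansion (y u : nat -> 'cV[K]_n) :
  y @ \oo --> x -> u @ \oo --> us -> (\forall k \near \oo, subdiff f (y k) (u k)) ->
  lo \oo (fun k => (y k - x) - P *m (y k - x)) (fun k => `|y k - x|) /\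
  lo \oo (fun k => P *m (u k - us) - P *m Hs *m P *m (y k - x)) (fun k => `|y k - x|).
Proof.
move=> yx uus yu; have [p [ph [J [H [r [g [LE fE gD ggD [gs Hsym]]]]]]]] := PSF_data.
have us_sub := us_ri.1; have [[[fp _ _] _] _ _ cont] := f_PSF.
have [d d0 mult] := subdiff_multiplier LE fE gD ggD.
have [|lam lamE] := mult x us _ (le_x LE) us_sub; first by rewrite subrr normr0.
have yM := finite_identification LE fp us_ri TP cont yx uus yu.
rewrite /Hs (riem_hessE LE fE gD ggD lamE gs Hsym fbarE) /P -TP.
have PP := orthoproj_idem (le_free LE) (tangent_ker LE).
split; first exact: (normal_lo LE _ yx yM).
set P' := orthoproj _ in PP *; set Q := lagr_hess _ _ _ _.
have -> : P' *m (P' *m Q *m P') *m P' = P' *m Q *m P'.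
  by rewrite !mulmxA PP -!mulmxA PP.
exact: (subdiff_expansion LE fE gD ggD lamE _ yx uus yM yu).
Qed.

Lemma PSF_proj_tr : P^T = P.
Proof.
have [p [ph [J [H [r [g [LE _ _ _ _]]]]]]] := PSF_data.
by rewrite /P -TP; exact: (orthoproj_tr (le_free LE) (tangent_ker LE)).
Qed.

(** With u k = (a k - y k) / c, the tangential expansion and the smallness of the normal part
    combine into (1 + c P Hs P) (y k - x) = P (a k - (x + c us)) + o(|y k - x|), which is then
    inverted. *)
Lemma prox_expansion (c : K) (a y : nat -> 'cV[K]_n) :
  0 < c -> (forall k, y k = prox c f (a k)) -> y @ \oo --> x ->
  a @ \oo --> x + c *: us ->
  lo \oo (fun k => (y k - x) - P *m (y k - x)) (fun k => `|y k - x|) /\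
  lo \oo (fun k => (y k - x) - invmx (1%:M + c *: (P *m Hs *m P)) *m P *m (a k - (x + c *: us)))
     (fun k => `|y k - x|).
Proof.
move=> c0 yE yx ax; have [[Gf [w fw]] _ _ _] := f_PSF.
have yu k : subdiff f (y k) (c^-1 *: (a k - y k)).
  by rewrite yE; exact: prox_subdiff fw.
have uus : (fun k => c^-1 *: (a k - y k)) @ \oo --> us.
  have -> : us = c^-1 *: ((x + c *: us) - x).
    by rewrite addrAC subrr add0r scalerA mulVf ?gt_eqF // scale1r.
  by apply: cvgZl_tmp; exact: cvgB.
have yu' : \forall k \near \oo, subdiff f (y k) (c^-1 *: (a k - y k)) by exact: nearW.
have [nlo elo] := PSF_expansion yx uus yu'; split => //.
set W := invmx _; have Wu := PSF_hess_unit c0.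
(* The normal part minus c times the tangential expansion: the two occurrences of P (y k - x)
   cancel, and the factor c^-1 of u k disappears. *)
apply: (lo_eq (f := fun k => W *m (((y k - x) - P *m (y k - x)) -
    c *: (P *m (c^-1 *: (a k - y k) - us) - P *m Hs *m P *m (y k - x))))); last first.
  by apply: lo_mulmx; apply: loB => //; exact: loZ.
move=> k; have E : W *m ((1%:M + c *: (P *m Hs *m P)) *m (y k - x)) = y k - x.
  by rewrite mulKmx.
rewrite -[X in _ = X - _]E.
rewrite -(mulmxA W) -mulmxBr; congr (W *m _).
rewrite scalerBr scalemxAr scalerBr scalerA mulfV ?gt_eqF // scale1r.
rewrite mulmxDl mul1mx -scalemxAl.
have -> : a k - y k - c *: us = (a k - (x + c *: us)) - (y k - x).
  by apply/matrixP => i j; rewrite !mxE; ring.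
rewrite (mulmxBr P (a k - _)).
clear E; move: (P *m Hs *m P *m (y k - x)) (P *m (y k - x)).
move: (P *m (a k - (x + c *: us))) (y k - x) => A B C D.
by apply/matrixP => i j; rewrite !mxE; ring.
Qed.

End PSF.

(** * Linearisation of the full iteration *)

Section Assembly.
Context {K : realType}.

(** Prox estimates concern the output at index k + 1; this makes them available for the current
    iterate. *)
Lemma lo_shift (V : normedModType K) (f : nat -> V) (g : nat -> K) :
  lo \oo (fun k => f k.+1) (fun k => g k.+1) -> lo \oo f g.
Proof.
(* The threshold N + 1 excludes k = 0, which is not the output of a step. *)
move=> fg e /fg[N _ hN]; exists N.+1 => // -[//|k] /=; exact: hN.
Qed.

Lemma lo_le (V : normedModType K) (f : nat -> V) (g h : nat -> K) :
  (forall k, g k <= h k) -> lo \oo f g -> lo \oo f h.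
Proof.
move=> gh fg e e0; apply: filterS (fg e e0) => k /le_trans; apply.
by rewrite ler_pM2l.
Qed.

Lemma cvg_succ (V : normedModType K) (f : nat -> V) (a : V) :
  f @ \oo --> a -> (fun k => f k.+1) @ \oo --> a.
Proof.
move=> /cvgrPdist_lt fa; apply/cvgrPdist_lt => e /fa[N _ hN].
by exists N => // k /= Nk; apply: hN => /=; exact: leqW.
Qed.

Lemma bo_cvg (V : normedModType K) (f : nat -> V) (a : V) (g : nat -> K) :
  bo \oo (fun k => f k - a) g -> g @ \oo --> (0 : K) -> f @ \oo --> a.
Proof.
move=> [C C0 fg] g0; apply/cvgrPdist_lt => e e0.
have /cvgrPdist_lt /(_ _ (divr_gt0 e0 C0)) := g0.
apply: filterS2 fg => k h1; rewrite sub0r normrN ltr_pdivlMr // distrC => h2.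
apply: le_lt_trans h1 _; apply: le_lt_trans h2; rewrite mulrC.
by rewrite ler_pM2r // ler_norm.
Qed.

(** The prox expansion projects only on the left, whereas the matrix also projects the current
    errors. The identity isolates this discrepancy in normal components and the gradient remainder,
    all negligible. *)
Lemma primal_identity n m (W P HF : 'M[K]_n) (PJ : 'M[K]_m) (Lt : 'M[K]_(n, m)) (c : K)
    (dx dx' gF : 'cV[K]_n) (dv : 'cV[K]_m) :
  dx' - ((W *m (1%:M - c *: (P *m HF *m P))) *m dx + (- (c *: (W *m (P *m Lt *m PJ)))) *m dv) =
  (dx' - W *m P *m (dx - c *: gF - c *: (Lt *m dv)))
  - (W *m (dx - P *m dx)
  + c *: (W *m P *m (HF *m (dx - P *m dx) + (gF - HF *m dx) + Lt *m (dv - PJ *m dv)))).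
Proof.
rewrite !(mulmxBr, mulmxDr, mulmxBl, mulNmx) -!(scalemxAl, scalemxAr) !mulmxA mulmx1.
move: (W *m dx) (W *m P *m dx) (W *m P *m gF) (W *m P *m HF *m dx)
  (W *m P *m HF *m P *m dx) (W *m P *m Lt *m dv) (W *m P *m Lt *m PJ *m dv).
by move=> *; apply/matrixP => i j; rewrite !mxE; ring.
Qed.

(** A and B are the blocks of the primal row: the new dx' is replaced by A dx + B dv at the cost of
    its normal part and of the primal error. The coefficient 2 is 1 + theta at theta = 1. *)
Lemma dual_identity n m (WJ PJ HG : 'M[K]_m) (PR : 'M[K]_n) (A : 'M[K]_n) (B : 'M[K]_(n, m))
    (L : 'M[K]_(m, n)) (c : K) (dx dx' : 'cV[K]_n) (dv dv' gG : 'cV[K]_m) :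
  dv' - (((c * (1 + 1)) *: (WJ *m (PJ *m L *m PR) *m A) - (1 * c) *: (WJ *m (PJ *m L *m PR))) *m dx
    + (WJ *m (1%:M - c *: (PJ *m HG *m PJ))
       + (c * (1 + 1)) *: (WJ *m (PJ *m L *m PR) *m B)) *m dv) =
  (dv' - WJ *m PJ *m (dv - c *: gG + c *: (L *m (2 *: dx' - dx))))
  - (WJ *m (dv - PJ *m dv)
  + c *: (WJ *m PJ *m (HG *m (dv - PJ *m dv) + (gG - HG *m dv))))
  + c *: (WJ *m PJ *m L *m (2 *: (dx' - PR *m dx')
     + 2 *: (PR *m (dx' - (A *m dx + B *m dv))) - (dx - PR *m dx))).
Proof.
rewrite !(mulmxBr, mulmxDr, mulmxDl, mulmxBl, mulNmx, scalerDr, scalerBr, mulmxN).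
rewrite -!(scalemxAl, scalemxAr) ?(mulmxBr, mulmxDr, mulmxN).
rewrite -?(scalemxAl, scalemxAr) !mulmxA mulmx1.
move: (WJ *m dv) (WJ *m PJ *m dv) (WJ *m PJ *m gG) (WJ *m PJ *m HG *m dv)
  (WJ *m PJ *m HG *m PJ *m dv) (WJ *m PJ *m L *m dx) (WJ *m PJ *m L *m dx')
  (WJ *m PJ *m L *m PR *m dx) (WJ *m PJ *m L *m PR *m dx')
  (WJ *m PJ *m L *m PR *m A *m dx) (WJ *m PJ *m L *m PR *m B *m dv).
by move=> *; apply/matrixP => i j; rewrite !mxE; ring.
Qed.

Section Iteration.
Context {n m : nat}.
Context (R F : 'cV[K]_n -> \bar K) (J G : 'cV[K]_m -> \bar K) (L : 'M[K]_(m, n)).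
Context (gR gJ : K) (x : nat -> 'cV[K]_n) (v : nat -> 'cV[K]_m).
Context (xs : 'cV[K]_n) (vs : 'cV[K]_m) (MR : set 'cV[K]_n) (MJ : set 'cV[K]_m).
Hypotheses (gR0 : 0 < gR) (gJ0 : 0 < gJ).
Hypothesis iter : primal_dual R F J G L gR gJ 1 x v.
Hypotheses (x_cvg : x @ \oo --> xs) (v_cvg : v @ \oo --> vs).
Hypotheses (R_PSF : PSF R xs MR) (Js_PSF : PSF (conjugate J) vs MJ).
Hypothesis R_nondeg : ri (subdiff R xs) (- (L^T *m vs) - grad F xs).
Hypothesis Js_nondeg : ri (subdiff (conjugate J) vs) (L *m xs - grad (conjugate G) vs).
Hypotheses (F_C2 : finite_C2_near F xs) (Gs_C2 : finite_C2_near (conjugate G) vs).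

Let dx k := x k - xs.
Let dv k := v k - vs.
(** A common scale for both blocks, additive so that each block is trivially O(z); it is compared
    with the Euclidean norm only at the end. *)
Let z k : K := `|dx k| + `|dv k|.
Let dF k := grad F (x k) - grad F xs.
Let dG k := grad (conjugate G) (v k) - grad (conjugate G) vs.
Let HF := hess (fine \o F) xs.
Let HG := hess (fine \o conjugate G) vs.
Let PR := orthoproj (Tspace R xs).
Let PJ := orthoproj (Tspace (conjugate J) vs).
Let WR := invmx (1%:M + gR *: (PR *m riem_hess MR (Rbar R F L xs vs) xs *m PR)).
Let WJ := invmx (1%:M + gJ *: (PJ *m riem_hess MJ (Jsbar J G L xs vs) vs *m PJ)).
Let HFbar := 1%:M - gR *: (PR *m HF *m PR).
Let HGbar := 1%:M - gJ *: (PJ *m HG *m PJ).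

Let z0 : z @ \oo --> (0 : K).
Proof.
apply/cvgrPdist_lt => e e0; have e20 : 0 < e / 2 by rewrite divr_gt0.
near=> k; rewrite sub0r normrN ger0_norm ?addr_ge0 //.
have : `|x k - xs| < e / 2.
  by near: k; have /cvgr_distC_lt := x_cvg; exact.
have : `|v k - vs| < e / 2.
  by near: k; have /cvgr_distC_lt := v_cvg; exact.
rewrite /z /dx /dv; lra.
Unshelve. all: by end_near. Qed.

Let bo_dx : bo \oo dx z.
Proof. by exists 1 => //; apply: nearW => k; rewrite mul1r lerDl. Qed.

Let bo_dv : bo \oo dv z.
Proof. by exists 1 => //; apply: nearW => k; rewrite mul1r lerDr. Qed.

Let lo_dF : lo \oo (fun k => dF k - HF *m dx k) z.
Proof.
have /C2_near_c2/nbhs_singleton[_ sF] := F_C2.2.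
exact: (lo_trans (lo_comp _ sF x_cvg) bo_dx).
Qed.

Let lo_dG : lo \oo (fun k => dG k - HG *m dv k) z.
Proof.
have /C2_near_c2/nbhs_singleton[_ sG] := Gs_C2.2.
exact: (lo_trans (lo_comp _ sG v_cvg) bo_dv).
Qed.

Let bo_dF : bo \oo dF z.
Proof.
apply: (bo_eq (f := fun k => (dF k - HF *m dx k) + HF *m dx k)) => [k|].
  by rewrite subrK.
by apply: boD; [exact: lo_bo|exact: bo_mulmx].
Qed.

Let bo_dG : bo \oo dG z.
Proof.
apply: (bo_eq (f := fun k => (dG k - HG *m dv k) + HG *m dv k)) => [k|].
  by rewrite subrK.
by apply: boD; [exact: lo_bo|exact: bo_mulmx].
Qed.

Let A k := dx k - gR *: dF k - gR *: (L^T *m dv k).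

Let bo_A : bo \oo A z.
Proof.
by apply: boB; [apply: boB => //|]; apply: boZ => //; exact: bo_mulmx.
Qed.

Let RbarE y : Rbar R F L xs vs y = (R y - (dotv y (- (L^T *m vs) - grad F xs))%:E)%E.
Proof. by rewrite /Rbar -opprD dotvNr EFinN oppeK. Qed.

Let bo_self_absorb N (f h : nat -> 'cV[K]_N) :
  lo \oo (fun k => f k - h k) (fun k => `|f k|) -> bo \oo h z -> bo \oo f z.
Proof.
move=> fh hz; apply: (bo_absorb (h := h) (r := fun k => f k - h k)) => //.
  by apply: lo_le fh => k; rewrite lerDr addr_ge0.
by move=> k; have := ler_normD (h k) (f k - h k); rewrite subrKC.
Qed.

(** The order matters: the prox estimate is relative to |dx k.+1|, absorption with A = O(z) gives dx
    k.+1 = O(z), and only then do all errors become o(z). The normal part of dx k follows by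
    shifting the index. *)
Let primal_facts :
  [/\ lo \oo (fun k => dx k.+1 - PR *m dx k.+1) z,
      lo \oo (fun k => dx k - PR *m dx k) z,
      lo \oo (fun k => dx k.+1 - WR *m PR *m A k) z &
      bo \oo (fun k => dx k.+1) z].
Proof.
pose a k := x k - gR *: grad F (x k) - gR *: (L^T *m v k).
have aE k : a k - (xs + gR *: (- (L^T *m vs) - grad F xs)) = A k.
  rewrite /a /A /dx /dF /dv !(mulmxBr, scalerBr, scalerN).
  move: (L^T *m v k) (L^T *m vs) (grad F (x k)) (grad F xs) => *.
  by apply/matrixP => i j; rewrite !mxE; ring.
have acv : a @ \oo --> xs + gR *: (- (L^T *m vs) - grad F xs).
  by apply: bo_cvg z0; apply: (bo_eq (f := A)) => // k; rewrite aE.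
have yE k : x k.+1 = prox gR R (a k) by have [] := iter k.
have [n1 n2] := prox_expansion R_PSF R_nondeg RbarE gR0 yE (cvg_succ x_cvg) acv.
have {}n2 : lo \oo (fun k => dx k.+1 - WR *m PR *m A k) (fun k => `|dx k.+1|).
  by apply: lo_eq n2 => k; rewrite aE.
have bx : bo \oo (fun k => dx k.+1) z.
  by apply: bo_self_absorb n2 _; exact: bo_mulmx.
split=> //; [exact: lo_trans n1 bx| |exact: lo_trans n2 bx].
apply: lo_trans bo_dx; exact: (lo_shift (f := fun k => dx k - PR *m dx k)).
Qed.

(** Error of the argument of the dual prox; 2 dx' - dx is the error of the extrapolated point. *)
Let B k := dv k - gJ *: dG k + gJ *: (L *m (2 *: dx k.+1 - dx k)).

Let bo_B : bo \oo B z.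
Proof.
have [_ _ _ bx] := primal_facts.
apply: boD; first by apply: boB => //; exact: boZ.
by apply: boZ; apply: bo_mulmx; apply: boB => //; exact: boZ.
Qed.

Let JsbarE y : Jsbar J G L xs vs y =
  (conjugate J y - (dotv y (L *m xs - grad (conjugate G) vs))%:E)%E.
Proof. by []. Qed.

Let dual_facts :
  lo \oo (fun k => dv k - PJ *m dv k) z /\ lo \oo (fun k => dv k.+1 - WJ *m PJ *m B k) z.
Proof.
pose b k := v k - gJ *: grad (conjugate G) (v k) +
   gJ *: (L *m (x k.+1 + 1 *: (x k.+1 - x k))).
have bE k : b k - (vs + gJ *: (L *m xs - grad (conjugate G) vs)) = B k.
  rewrite /b /B /dx /dG /dv scale1r !(mulmxBr, mulmxDr, scalerBr, scalerDr) -!scalemxAr.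
  move: (L *m x k.+1) (L *m x k) (L *m xs) (grad _ (v k)) (grad _ vs) => *.
  by apply/matrixP => i j; rewrite !mxE; ring.
have bcv : b @ \oo --> vs + gJ *: (L *m xs - grad (conjugate G) vs).
  by apply: bo_cvg z0; apply: (bo_eq (f := B)) => // k; rewrite bE.
have yE k : v k.+1 = prox gJ (conjugate J) (b k) by have [] := iter k.
have [n1 n2] := prox_expansion Js_PSF Js_nondeg JsbarE gJ0 yE (cvg_succ v_cvg) bcv.
have {}n2 : lo \oo (fun k => dv k.+1 - WJ *m PJ *m B k) (fun k => `|dv k.+1|).
  by apply: lo_eq n2 => k; rewrite bE.
have bv : bo \oo (fun k => dv k.+1) z.
  by apply: bo_self_absorb n2 _; exact: bo_mulmx.
split; last exact: lo_trans n2 bv.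
apply: lo_trans bo_dv; exact: (lo_shift (f := fun k => dv k - PJ *m dv k)).
Qed.

Let Lbt := PR *m L^T *m PJ.
Let X k := WR *m HFbar *m dx k + - (gR *: (WR *m Lbt)) *m dv k.

Let lo_primal : lo \oo (fun k => dx k.+1 - X k) z.
Proof.
have [_ nx ex _] := primal_facts; have [nv _] := dual_facts.
apply: (lo_eq (f := fun k => (dx k.+1 - WR *m PR *m A k) -
   (WR *m (dx k - PR *m dx k) + gR *: (WR *m PR *m (HF *m (dx k - PR *m dx k) +
     (dF k - HF *m dx k) + L^T *m (dv k - PJ *m dv k)))))).
  by move=> k; exact/esym/primal_identity.
apply: loB => //; apply: loD; first exact: lo_mulmx.
apply: loZ; apply: lo_mulmx; apply: loD; last exact: lo_mulmx.
by apply: loD => //; exact: lo_mulmx.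
Qed.

Let Lb := PJ *m L *m PR.
Let Y k := ((gJ * (1 + 1)) *: (WJ *m Lb *m (WR *m HFbar)) - (1 * gJ) *: (WJ *m Lb)) *m dx k
  + (WJ *m HGbar + (gJ * (1 + 1)) *: (WJ *m Lb *m - (gR *: (WR *m Lbt)))) *m dv k.

Let lo_dual : lo \oo (fun k => dv k.+1 - Y k) z.
Proof.
have [nx' nx _ _] := primal_facts; have [nv ev] := dual_facts.
apply: (lo_eq (f := fun k => (dv k.+1 - WJ *m PJ *m B k) -
   (WJ *m (dv k - PJ *m dv k) + gJ *: (WJ *m PJ *m (HG *m (dv k - PJ *m dv k) +
     (dG k - HG *m dv k)))) + gJ *: (WJ *m PJ *m L *m (2 *: (dx k.+1 - PR *m dx k.+1)
     + 2 *: (PR *m (dx k.+1 - X k)) - (dx k - PR *m dx k))))).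
  by move=> k; exact/esym/dual_identity.
apply: loD.
  apply: loB => //; apply: loD; first exact: lo_mulmx.
  by apply: loZ; apply: lo_mulmx; apply: loD => //; exact: lo_mulmx.
apply: loZ; apply: lo_mulmx; apply: loB => //; apply: loD; apply: loZ => //.
exact: lo_mulmx.
Qed.

Let M_PDE k : M_PD R F J G L gR gJ 1 MR MJ xs vs *m col_mx (dx k) (dv k) = col_mx (X k) (Y k).
Proof.
rewrite /M_PD mul_block_col -/PR -/PJ -/HF -/HG -/WR -/WJ -/HFbar -/HGbar -/Lb.
have -> : Lb^T = Lbt.
  rewrite /Lb /Lbt !trmx_mul (PSF_proj_tr R_PSF) (PSF_proj_tr Js_PSF).
  by rewrite mulmxA.
congr col_mx; rewrite /Y; congr (_ + _).
  by rewrite !mulmxA.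
congr (_ *m _); congr (_ + _).
by rewrite mulmxN -scalemxAr scalerN scalerA !mulmxA; congr (- (_ *: _)); ring.
Qed.

Lemma primal_dual_linearization :
  (fun k => col_mx (x k.+1) (v k.+1) - col_mx xs vs) =
  (fun k => M_PD R F J G L gR gJ 1 MR MJ xs vs *m (col_mx (x k) (v k) - col_mx xs vs))
  +o_\oo (fun k => enorm (col_mx (x k) (v k) - col_mx xs vs)).
Proof.
(* Two blocks, each within e / 4 of z k, and z k is at most twice the Euclidean norm. *)
apply/eqaddoP => e e0; have e4 : 0 < e / 4 by rewrite divr_gt0.
near=> k; rewrite !fctE !opp_col_mx !add_col_mx -/(dx k) -/(dv k) -/(dx k.+1) -/(dv k.+1).
rewrite M_PDE opp_col_mx add_col_mx.
apply: le_trans (norm_col_mx _ _) _.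
have h1 : `|dx k.+1 - X k| <= e / 4 * z k by near: k; exact: lo_primal.
have h2 : `|dv k.+1 - Y k| <= e / 4 * z k by near: k; exact: lo_dual.
rewrite [`|enorm _|]ger0_norm ?sqrtr_ge0 //.
have h3 := norm_le_enorm (col_mx (dx k) (dv k)).
have h4 := norm_usub (col_mx (dx k) (dv k)); rewrite col_mxKu in h4.
have h5 := norm_dsub (col_mx (dx k) (dv k)); rewrite col_mxKd in h5.
have h6 : z k <= 2 * enorm (col_mx (dx k) (dv k)) by rewrite /z; lra.
have := ler_wpM2l (ltW e4) h6; lra.
Unshelve. all: by end_near. Qed.

End Iteration.

End Assembly.

Theorem proposition3p6 (K : realType) (n m : nat)
    (R F : 'cV[K]_n -> \bar K) (J G : 'cV[K]_m -> \bar K) (L : 'M[K]_(m, n))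
    (betaF betaG gammaR gammaJ : K)
    (* (A.1) *)
    (R_Gamma0 : Gamma0 R) (F_Gamma0 : Gamma0 F)
    (F_diff : forall x, finite_differentiable F x)
    (betaF_gt0 : 0 < betaF)
    (gradF_lip : forall x y,
       enorm (grad F x - grad F y) <= betaF^-1 * enorm (x - y))
    (* (A.2) *)
    (J_Gamma0 : Gamma0 J) (G_Gamma0 : Gamma0 G)
    (betaG_gt0 : 0 < betaG) (G_strong : strongly_convex_fun betaG G)
    (* (A.4) *)
    (A4 : opran (opadd (opadd (subdiff R) (opfun (grad F)))
                   (opcomp L (parallel_sum (subdiff J) (subdiff G)))) 0)
    (gammaR_gt0 : 0 < gammaR) (gammaJ_gt0 : 0 < gammaJ)
    (step : 1 < 2 * Num.min betaF betaG * Num.min gammaJ^-1 gammaR^-1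
                * (1 - Num.sqrt (gammaJ * gammaR * opnorm L ^+ 2)))
    (x : nat -> 'cV[K]_n) (v : nat -> 'cV[K]_m)
    (iter : primal_dual R F J G L gammaR gammaJ 1 x v)
    (xs : 'cV[K]_n) (vs : 'cV[K]_m)
    (KT : kuhn_tucker R F J G L xs vs)
    (x_cvg : x @ \oo --> xs) (v_cvg : v @ \oo --> vs)
    (MR : set 'cV[K]_n) (MJ : set 'cV[K]_m)
    (R_PSF : PSF R xs MR) (Js_PSF : PSF (conjugate J) vs MJ)
    (R_nondeg : ri (subdiff R xs) (- (L^T *m vs) - grad F xs))
    (Js_nondeg : ri (subdiff (conjugate J) vs)
                   (L *m xs - grad (conjugate G) vs))
    (F_C2 : finite_C2_near F xs) (Gs_C2 : finite_C2_near (conjugate G) vs) :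
  let z k := col_mx (x k) (v k) in
  let zs := col_mx xs vs in
  let M := M_PD R F J G L gammaR gammaJ 1 MR MJ xs vs in
  (fun k => z k.+1 - zs) =
    (fun k => M *m (z k - zs)) +o_\oo (fun k => enorm (z k - zs)).
Proof.
move=> z zs Mpd.
exact: (primal_dual_linearization gammaR_gt0 gammaJ_gt0 iter x_cvg v_cvg R_PSF Js_PSF
  R_nondeg Js_nondeg F_C2 Gs_C2).
Qed.
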